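(* Let $b>0$ and $T>0$. For every $m>0$ consider the minimization problems $$\text{(A)}\quad \min\{\mathcal E(u) : \mathcal M(u)=m,\ u\in H^1_{\mathrm{loc}}\cap A_{T/2}\},$$ $$\text{(A0)}\quad \min\{\mathcal E(u) : \mathcal M(u)=m,\ \mathcal P(u)=0,\ u\in H^1_{\mathrm{loc}}\cap A_{T/2}\}.$$ Then for all $m>0$: (i) The minimizers of (A) and of (A0) are the same. (ii) There exists a unique (up to translations $u\mapsto u(\cdot+y)$, $y\in\mathbb R$, and phase shift $u\mapsto e^{i\theta}u$, $\theta\in\mathbb R$) minimizer of (A). It is the rescaled function $\mathrm{cn}_{\alpha,\beta,k}=\frac1\alpha\,\mathrm{cn}\left(\frac{\cdot}{\beta},k\right)$, where the parameters $\alpha>0$, $\beta>0$ and $k\in(0,1)$ are uniquely determined (by $b,T,m$). Its fundamental period is $T$. The map from $m\in(0,\infty)$ to $k\in(0,1)$ is one-to-one, onto and increasing. (iii) In particular, given $k\in(0,1)$, if $b=2k^2$, $T=4K(k)$ and $m=\mathcal M(\mathrm{cn}(\cdot,k))=2\big(E(k)-(1-k^2)K(k)\big)/k^2$, then the unique (up to translations and phase shift) minimizer of (A) is $\mathrm{cn}(\cdot,k)$.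
   Context: Functions are complex-valued on $\mathbb R$. For $T>0$, $A_{T/2}=\{f\in L^2_{\mathrm{loc}}(\mathbb R): f(x+T/2)=-f(x)\}$ (half-anti-periodic functions; they are $T$-periodic). $H^1_{\mathrm{loc}}=H^1_{\mathrm{loc}}(\mathbb R;\mathbb C)$. For $T$-periodic $u$ in $H^1_{\mathrm{loc}}$, $$\mathcal M(u)=\tfrac12\int_0^T|u|^2dx,\quad \mathcal P(u)=\tfrac12\,\mathrm{Im}\int_0^T u\,\overline{u_x}\,dx,\quad \mathcal E(u)=\tfrac12\int_0^T|u_x|^2dx-\tfrac b4\int_0^T|u|^4dx.$$ Jacobi elliptic functions with modulus $k\in(0,1)$: with $x=F(\phi,k)=\int_0^\phi\frac{d\theta}{\sqrt{1-k^2\sin^2\theta}}$, $\mathrm{sn}(x,k)=\sin\phi$, $\mathrm{cn}(x,k)=\cos\phi$, $\mathrm{dn}(x,k)=\sqrt{1-k^2\sin^2\phi}$. Complete elliptic integrals: $K(k)=F(\pi/2,k)$, $E(k)=\int_0^{\pi/2}\sqrt{1-k^2\sin^2\theta}\,d\theta$. *)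

(* Defs.v *)
From HB Require Import structures.
From mathcomp Require Import all_boot all_order all_algebra.
From mathcomp Require Import complex.
From mathcomp Require Import all_classical all_reals all_analysis.

Set Implicit Arguments.
Unset Strict Implicit.
Unset Printing Implicit Defensive.

Import Order.TTheory GRing.Theory Num.Theory.
Import numFieldNormedType.Exports.

Local Open Scope classical_set_scope.
Local Open Scope ring_scope.
Local Open Scope complex_scope.

Section Functionals.
Variable R : realType.
Implicit Types (u v : R -> R[i]) (b T m : R).

Local Notation normc := ComplexField.Normc.normc.
Local Notation mu := (@lebesgue_measure R).

Definition cintegral (D : set R) u : R[i] :=
  (\int[mu]_(x in D) complex.Re (u x)) +i* (\int[mu]_(x in D) complex.Im (u x)).

Definition L2loc u : Prop :=
  [/\ measurable_fun setT (fun x => complex.Re (u x)),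
      measurable_fun setT (fun x => complex.Im (u x)) &
      locally_integrable setT (fun x => normc (u x) ^+ 2)].

(* Test functions for weak derivatives: C^1 with compact support, as in Brezis,
   Functional Analysis, Sobolev Spaces and PDEs, Section 8.2.  Mollification
   shows that C^oo test functions give the same weak derivatives; real-valued
   test functions suffice by linearity. *)
Definition test_fun (phi : R -> R) : Prop :=
  [/\ forall x, derivable phi x 1,
      continuous (derive1 phi) &
      compact (closure [set x | phi x != 0])].

Definition weak_derivatives u : set (R -> R[i]) :=
  [set v | L2loc v /\ forall phi, test_fun phi ->
    cintegral setT (fun x => u x * (derive1 phi x)%:C) =
    - cintegral setT (fun x => v x * (phi x)%:C)].

Definition H1loc u : Prop := L2loc u /\ exists v, weak_derivatives u v.

(* A representative of u_x, which is unique up to a null set; meaningful when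
   u is in H1loc. *)
Definition wderiv u : R -> R[i] := xget (cst 0) (weak_derivatives u).

Definition half_antiperiodic T u : Prop :=
  L2loc u /\ {ae mu, forall x, u (x + T / 2) = - u x}.

Definition mass T u : R := 2^-1 * \int[mu]_(x in `[0, T]) (normc (u x) ^+ 2).

Definition momentum T u : R :=
  2^-1 * complex.Im (cintegral `[0, T] (fun x => u x * (wderiv u x)^*)).

Definition energy b T u : R :=
  2^-1 * \int[mu]_(x in `[0, T]) (normc (wderiv u x) ^+ 2)
  - b / 4 * \int[mu]_(x in `[0, T]) (normc (u x) ^+ 4).

Definition admissible T m : set (R -> R[i]) :=
  [set u | [/\ H1loc u, half_antiperiodic T u & mass T u = m]].

Definition admissible0 T m : set (R -> R[i]) :=
  admissible T m `&` [set u | momentum T u = 0].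

Definition minimizers (J : (R -> R[i]) -> R) (S : set (R -> R[i])) :
    set (R -> R[i]) :=
  [set u | S u /\ forall v, S v -> J u <= J v].

Definition translate_phase (y theta : R) u : R -> R[i] :=
  fun x => (cos theta +i* sin theta) * u (x + y).

(* Elements of L2loc are identified when they agree almost everywhere. *)
Definition unique_minimizer (J : (R -> R[i]) -> R) (S : set (R -> R[i])) u :
    Prop :=
  minimizers J S u /\
  forall v, minimizers J S v ->
    exists y theta : R, {ae mu, forall x, v x = translate_phase y theta u x}.

Definition fundamental_period u T : Prop :=
  [/\ 0 < T, forall x, u (x + T) = u x &
      forall S, 0 < S -> (forall x, u (x + S) = u x) -> T <= S].

End Functionals.

Section Elliptic.
Variable R : realType.
Implicit Types k phi x : R.

Local Notation mu := (@lebesgue_measure R).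

Definition ellF_integrand k (t : R) : R :=
  (Num.sqrt (1 - k ^+ 2 * sin t ^+ 2))^-1.

(* The integral from 0 to phi is oriented, hence the case split. *)
Definition ellF phi k : R :=
  if 0 <= phi then \int[mu]_(t in `[0, phi]) ellF_integrand k t
  else - \int[mu]_(t in `[phi, 0]) ellF_integrand k t.

Definition ellK k : R := ellF (pi / 2) k.

Definition ellE k : R :=
  \int[mu]_(t in `[0, pi / 2]) Num.sqrt (1 - k ^+ 2 * sin t ^+ 2).

(* The amplitude: for 0 < k < 1, the unique phi with x = F(phi, k). *)
Definition am x k : R := xget 0 [set phi | x = ellF phi k].

Definition cn x k : R := cos (am x k).

Definition cn_rescaled (alpha beta k : R) : R -> R[i] :=
  fun x => (alpha^-1 * cn (x / beta) k)%:C.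

End Elliptic.

(* Main.v *)
(* Write u = f + i g almost everywhere with f and g absolutely continuous and anti-periodic with
   anti-period T/2. For each modulus k, let c(x) = cn(kappa x, k) with kappa = 4 K(k) / T, so that
   c'^2 = V(c) for an explicit quartic V. The core is the family of sharp inequalities
     int |u'|^2 >= lin(k) int |u|^2 + coef(k) (int |u|^4)^(1/2)     (integrals over a period)
   with equality only for constant multiples of translates of c. For real u normalized by
   max |u| = 1 it is a calibration argument: completing the square in u' -/+ sqrt(V(u)) between the
   extrema leaves a boundary term that does not depend on u; AM-GM then absorbs the normalization.
   The complex case follows from Minkowski's inequality applied to f^2 and g^2.
   Choosing k with coef(k) = b (int |u|^4)^(1/2) gives
     2 E(u) >= 2 m lin(k) + coef(k)^2 / (2 b) =: envelope(k).
   Testing the inequality for the modulus l with the function c of modulus k bounds the increments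
   of lin by those of coef; hence the envelope has a unique minimum point, characterized by
   2 kappa^2 k^2 int c^2 = 2 m b, whose left side is increasing in k from 0 to +oo. There the
   minimum is attained by a multiple of c. All minimizers are complex multiples of translates of c,
   in particular have zero momentum, which makes the two problems equivalent. *)
Require Import Defs.
From HB Require Import structures.
From mathcomp Require Import all_boot all_order all_algebra.
From mathcomp Require Import complex ring lra.
From mathcomp Require Import all_classical all_reals all_analysis.
From mathcomp Require Import measurable_realfun.

Set Implicit Arguments.
Unset Strict Implicit.
Unset Printing Implicit Defensive.

Import Order.TTheory GRing.Theory Num.Theory.
Import numFieldNormedType.Exports.

Local Open Scope classical_set_scope.
Local Open Scope ring_scope.
Local Open Scope complex_scope.

(** * Integrals over intervals and absolutely continuous functions *)

Section IntervalIntegrals.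
Variable R : realType.
Implicit Types (f g h v w : R -> R) (a b c x y : R).
Local Notation mu := (@lebesgue_measure R).

(** The quartic term makes the energy nonconvex, so uniqueness cannot come from convexity. Instead
    an explicit lower bound is matched by an explicit function, which replaces any compactness
    argument for existence, and the nonnegative remainders are kept to decide equality.
    Anti-periodicity is what makes the calibration work: the minimum of a real u is minus its
    maximum and is attained half a period away, so the boundary terms have the same total for every
    normalized u. Normalizing by the maximum M produces X / M^2 + M^2 Q with X = int u^4 and Q = int
    c^4; AM-GM replaces it by 2 (X Q)^(1/2), which is why the square root of the quartic integral
    appears. With s = (int |u|^4)^(1/2) the inequality reads 2 E(u) >= 2 m lin(k) + coef(k) s - b
    s^2 / 2. The right-hand side is stationary in s at s = coef(k) / b, and its value there is the
    envelope. Since s depends on u, the modulus is picked after u, and the envelope is then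
    minimized over all moduli. *)

Definition itv_integrable f := forall a b, mu.-integrable `[a, b] (EFin \o f).

Lemma continuous_itv_integrable f : continuous f -> itv_integrable f.
Proof.
move=> cf a b; apply: continuous_compact_integrable; first exact: segment_compact.
exact: continuous_subspaceT.
Qed.

Lemma itv_integrable_measurable f : itv_integrable f -> measurable_fun setT f.
Proof.
move=> fi.
have -> : setT = \bigcup_(n : nat) (`[- n%:R, n%:R]%classic : set R).
  apply/seteqP; split => // x _; exists (Num.bound `|x|) => //=.
  by rewrite in_itv/= -ler_norml ltW// archi_boundP.
apply/measurable_fun_bigcup => // n.
by apply/measurable_EFinP; exact: measurable_int (fi _ _).
Qed.

Lemma integral_itv_cat f a b c : a <= b -> b <= c -> itv_integrable f ->
  \int[mu]_(x in `[a, c]) f x = \int[mu]_(x in `[a, b]) f x + \int[mu]_(x in `[b, c]) f x.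
Proof.
move=> ab bc fi; rewrite addrC; apply/eqP; rewrite -subr_eq; apply/eqP.
rewrite (@Rintegral_itvB _ f (BLeft a) (BRight c) b) ?bnd_simp//.
by apply: Rintegral_itv_obnd_cbnd; apply: integrableS (fi b c) => //; exact: subset_itv_oc_cc.
Qed.

Lemma itv_integrableD f g : itv_integrable f -> itv_integrable g ->
  itv_integrable (fun x => f x + g x).
Proof. by move=> fi gi a b; apply: (integrableD _ (fi a b) (gi a b)). Qed.

Lemma itv_integrableZ (r : R) f : itv_integrable f -> itv_integrable (fun x => r * f x).
Proof. by move=> fi a b; apply: (integrableZl _ r (fi a b)). Qed.

Lemma itv_integrableB f g : itv_integrable f -> itv_integrable g ->
  itv_integrable (fun x => f x - g x).
Proof. by move=> fi gi a b; apply: (integrableB _ (fi a b) (gi a b)). Qed.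

Lemma itv_integrable_norm f : itv_integrable f -> itv_integrable (fun x => `|f x|).
Proof. by move=> fi a b; apply: integrable_norm. Qed.

Lemma le_itv_integrable f g : measurable_fun setT f -> itv_integrable g ->
  (forall x, `|f x| <= g x) -> itv_integrable f.
Proof.
move=> mf gi fg a b; apply: (le_integrable _ _ _ (gi a b)) => //.
- by apply/measurable_EFinP; exact: measurable_funS mf.
- by move=> x _ /=; rewrite lee_fin (le_trans (fg x))// ler_norm.
Qed.

(** Constants are integrable on bounded intervals, and (|f| - 1)^2 >= 0 gives |f| <= 1 + f^2. *)
Lemma itv_integrable_of_sqr f : measurable_fun setT f ->
  itv_integrable (fun x => f x ^+ 2) -> itv_integrable f.
Proof.
move=> mf f2; apply: (@le_itv_integrable _ (fun x => 1 + f x ^+ 2)) => //.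
  apply: itv_integrableD => //; apply: continuous_itv_integrable => x; exact: cvg_cst.
by move=> x; rewrite -real_normK ?num_real//; have := sqr_ge0 (`|f x| - 1); nra.
Qed.

Lemma itv_integrableM_sqr f g : measurable_fun setT f -> measurable_fun setT g ->
  itv_integrable (fun x => f x ^+ 2) -> itv_integrable (fun x => g x ^+ 2) ->
  itv_integrable (fun x => f x * g x).
Proof.
move=> mf mg f2 g2; apply: (@le_itv_integrable _ (fun x => f x ^+ 2 + g x ^+ 2)).
- exact: measurable_funM.
- exact: itv_integrableD.
- move=> x; rewrite normrM -(real_normK (num_real (f x))) -(real_normK (num_real (g x))).
  by have := sqr_ge0 (`|f x| - `|g x|); have := normr_ge0 (f x); have := normr_ge0 (g x); nra.
Qed.

Lemma itv_integrableM_cont f g : continuous f -> itv_integrable g ->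
  itv_integrable (fun x => f x * g x).
Proof.
move=> cf gi a b.
have [ba|ab] := ltP b a; first by rewrite set_itv_ge ?bnd_simp -?ltNge//; exact: integrable_set0.
have cn : continuous (fun x => `|f x|) by move=> x; apply: cvg_norm; exact: cf.
have [c _ cM] := EVT_max ab (continuous_subspaceT cn).
apply: (le_integrable _ _ _ (itv_integrableZ `|f c| (itv_integrable_norm gi) a b)) => //.
  apply/measurable_EFinP/measurable_funM; last first.
    by apply/measurable_EFinP; exact: measurable_int (gi _ _).
  exact: (measurable_funS _ _ (continuous_measurable_fun cf)).
move=> x xab /=; rewrite lee_fin !normrM !normr_id ler_wpM2r//.
exact: cM.
Qed.

Lemma itv_integrableMr_cont f g : continuous f -> itv_integrable g ->
  itv_integrable (fun x => g x * f x).
Proof.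
move=> cf gi; have -> : (fun x => g x * f x) = (fun x => f x * g x) by apply/funext => x; rewrite mulrC.
exact: itv_integrableM_cont.
Qed.

Lemma eq_itv_integral f g a b : (forall x, a <= x <= b -> f x = g x) ->
  \int[mu]_(x in `[a, b]) f x = \int[mu]_(x in `[a, b]) g x.
Proof. by move=> fg; apply: eq_Rintegral => x; rewrite inE/= in_itv/=; exact: fg. Qed.

Lemma itv_integralD f g a b : itv_integrable f -> itv_integrable g ->
  \int[mu]_(x in `[a, b]) (f x + g x) =
  \int[mu]_(x in `[a, b]) f x + \int[mu]_(x in `[a, b]) g x.
Proof. by move=> fi gi; rewrite RintegralD. Qed.

Lemma itv_integralB f g a b : itv_integrable f -> itv_integrable g ->
  \int[mu]_(x in `[a, b]) (f x - g x) =
  \int[mu]_(x in `[a, b]) f x - \int[mu]_(x in `[a, b]) g x.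
Proof. by move=> fi gi; rewrite RintegralB. Qed.

Lemma itv_integralZ (r : R) f a b : itv_integrable f ->
  \int[mu]_(x in `[a, b]) (r * f x) = r * \int[mu]_(x in `[a, b]) f x.
Proof. by move=> fi; rewrite RintegralZl. Qed.

Lemma le_itv_integral f g a b : itv_integrable f -> itv_integrable g ->
  (forall x, a <= x <= b -> f x <= g x) ->
  \int[mu]_(x in `[a, b]) f x <= \int[mu]_(x in `[a, b]) g x.
Proof.
by move=> fi gi fg; apply: le_Rintegral => // x; rewrite /= in_itv/=; exact: fg.
Qed.

Lemma itv_integral_cst (r : R) a b : a <= b -> \int[mu]_(x in `[a, b]) r = r * (b - a).
Proof.
move=> ab; rewrite Rintegral_cst//; rewrite [X in fine X](_ : _ = if a < b then (b - a)%:E else 0%:E).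
  by case: ltP => //= ba; rewrite (@le_anti _ _ a b) ?ab// subrr.
by rewrite [LHS](lebesgue_measure_itv `[a, b])/= lte_fin.
Qed.

Lemma is_derive_continuous f g : (forall x, is_derive x 1 f (g x)) -> continuous f.
Proof.
by move=> fg x; apply: differentiable_continuous; apply/derivable1_diffP; case: (fg x).
Qed.

Lemma FTC2_itv (F f : R -> R) a b : a <= b -> continuous f ->
  (forall x, is_derive x 1 F (f x)) -> \int[mu]_(x in `[a, b]) f x = F b - F a.
Proof.
rewrite le_eqVlt => /predU1P[<-|ab] cf dF; first by rewrite set_itv1 Rintegral_set1 subrr.
have cF := is_derive_continuous dF.
rewrite /Rintegral (@continuous_FTC2 _ f F a b)//.
- exact: continuous_subspaceT.
- split => [x _| |]; first by case: (dF x).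
  + by apply: cvg_at_right_filter; exact: cF.
  + by apply: cvg_at_left_filter; exact: cF.
- by move=> x _; rewrite derive1E; case: (dF x).
Qed.

Lemma ae_mono (P Q : R -> Prop) : (forall x, P x -> Q x) ->
  {ae mu, forall x, P x} -> {ae mu, forall x, Q x}.
Proof. by move=> PQ aP; have := ae_filter_ringOfSetsType mu => aF; exact: filterS aP. Qed.

Lemma ae_and (P Q : R -> Prop) :
  {ae mu, forall x, P x} -> {ae mu, forall x, Q x} -> {ae mu, forall x, P x /\ Q x}.
Proof. by move=> aP aQ; have := ae_filter_ringOfSetsType mu => aF; exact: filterS2 aP aQ. Qed.

Lemma ae_exists (P : R -> Prop) c d : c < d -> {ae mu, forall x, P x} ->
  exists2 x, c < x < d & P x.
Proof.
move=> cd [N [mN N0 PN]]; apply: contrapT => nP.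
have : (mu `]c, d[%classic <= mu N)%E.
  apply: le_measure; rewrite ?inE//= => x /=; rewrite in_itv/= => xcd.
  by apply: PN => Px; apply: nP; exists x.
by rewrite N0 lebesgue_measure_itv/= lte_fin cd -EFinD lee_fin leNgt subr_gt0 cd.
Qed.

Lemma continuous_ae_eq0 f a b : a < b -> continuous f ->
  {ae mu, forall x, `[a, b]%classic x -> f x = 0} -> forall x, a <= x <= b -> f x = 0.
Proof.
move=> ab cf f0 x /andP[ax xb]; apply: contrapT => /eqP fx0.
have : \forall y \near x, f y != 0.
  have /cvgrPdist_lt/(_ `|f x|) := cf x; rewrite normr_gt0 => /(_ fx0).
  by apply: filterS => y; apply: contraTneq => ->; rewrite subr0 ltxx.
move=> /nbhs_ballP[e /= e0 xe].
have [|y /andP[]] := @ae_exists _ (Num.max a (x - e)) (Num.min b (x + e)) _ f0.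
  rewrite lt_min !gt_max ab/=; apply/andP; split; lra.
rewrite lt_min gt_max => /andP[ay xey] /andP[yb yxe].
have /eqP yf : f y != 0 by apply: xe; rewrite /ball/= ltr_distlC; lra.
by move=> H; apply/yf/H; rewrite /= in_itv/=; lra.
Qed.

Lemma continuous_ae_eq f g : continuous f -> continuous g ->
  {ae mu, forall x, f x = g x} -> forall x, f x = g x.
Proof.
move=> cf cg fg x; apply/eqP; rewrite -subr_eq0; apply/eqP.
apply: (@continuous_ae_eq0 (fun y => f y - g y) (x - 1) (x + 1)); try lra.
- by move=> y; apply: cvgB; [exact: cf|exact: cg].
- by apply: ae_mono fg => y -> _; rewrite subrr.
Qed.

Lemma integral_sqr_eq0 f a b : itv_integrable (fun x => f x ^+ 2) -> measurable_fun setT f ->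
  \int[mu]_(x in `[a, b]) (f x ^+ 2) = 0 ->
  {ae mu, forall x, `[a, b]%classic x -> f x = 0}.
Proof.
move=> fi mf f0.
have mf2 : measurable_fun `[a, b] (EFin \o (fun x => f x ^+ 2)) by exact: measurable_int (fi a b).
have /ae_eq_integral_abs : (\int[mu]_(x in `[a, b]) `|(f x ^+ 2)%:E| = 0)%E.
  rewrite -[RHS]/(0%:E) -f0 /Rintegral fineK.
    by apply: eq_integral => x _; rewrite gee0_abs// lee_fin sqr_ge0.
  exact: integrable_fin_num (fi a b).
move=> /(_ (measurable_itv _) mf2); apply: ae_mono => x /= f2 /f2.
by move=> [] /eqP; rewrite sqrf_eq0 => /eqP.
Qed.

Lemma ae_eq_itv_integral f g a b : measurable_fun setT f -> measurable_fun setT g ->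
  {ae mu, forall x, `[a, b]%classic x -> f x = g x} ->
  \int[mu]_(x in `[a, b]) f x = \int[mu]_(x in `[a, b]) g x.
Proof.
move=> mf mg fg; congr fine; apply: ae_eq_integral => //.
- by apply/measurable_EFinP; exact: measurable_funS mf.
- by apply/measurable_EFinP; exact: measurable_funS mg.
- by apply: ae_mono fg => x H /H /= ->.
Qed.

Lemma locally_nondecreasing f a b : a <= b ->
  (forall x, a <= x <= b -> exists2 d, 0 < d &
     forall y, a <= y <= b -> `|y - x| < d -> (y <= x -> f y <= f x) /\ (x <= y -> f x <= f y)) ->
  f a <= f b.
Proof.
move=> ab H.
(* Continuous induction: sup S belongs to S, and unless it is b the set S extends past it. *)
pose S := [set x | a <= x <= b /\ f a <= f x].
have Sa : S a by split => //; rewrite lexx.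
have Sb : ubound S b by move=> x [/andP[]].
have hS : has_sup S by split; [exists a|exists b].
have ac : a <= sup S by apply: ub_le_sup => //; exists b.
have cb : sup S <= b by apply: sup_le_ub => //; exists a.
have [|d d0 Hd] := H (sup S); first by rewrite ac.
have [x Sx xd] := sup_adherent d0 hS.
have xs : x <= sup S by apply: ub_le_sup => //; exists b.
have Sc : f a <= f (sup S).
  apply: (le_trans Sx.2); have [] := Hd x Sx.1; last by move=> + _; exact.
  by rewrite ltr_norml; lra.
have [cb'|] := ltP (sup S) b; last by move=> bc; rewrite (_ : b = sup S)//; lra.
pose y := Num.min b (sup S + d / 2).
have yc : sup S < y by rewrite lt_min cb'/=; lra.
have yb : y <= b by rewrite ge_min lexx.
have yd : y <= sup S + d / 2 by rewrite ge_min lexx orbT.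
have : S y.
  split; first by lra.
  have [||_] := Hd y; [by lra|by rewrite ltr_norml; lra|].
  by move=> /(_ (ltW yc)); exact: le_trans.
by move=> /(ub_le_sup (ex_intro _ _ Sb)); rewrite leNgt yc.
Qed.

(** The base point and the case split are those of [ellF], which makes [ellF] an instance of this
    definition by conversion. *)
Definition primitive h x :=
  if 0 <= x then \int[mu]_(t in `[0, x]) h t else - \int[mu]_(t in `[x, 0]) h t.

(** Local absolute continuity, encoded through the fundamental theorem of calculus; v is the
    derivative of f almost everywhere. *)
Definition is_primitive f v :=
  itv_integrable v /\ forall a b, a <= b -> f b - f a = \int[mu]_(t in `[a, b]) v t.

Lemma primitiveP h : itv_integrable h -> is_primitive (primitive h) h.
Proof.
move=> hi; split=> // a b ab; rewrite /primitive.
case: (leP 0 a) => a0; case: (leP 0 b) => b0; try lra.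
- by rewrite (@integral_itv_cat h 0 a b)//; lra.
- by rewrite (@integral_itv_cat h a 0 b)//; lra.
- by rewrite (@integral_itv_cat h a b 0)//; lra.
Qed.

Lemma itv_integrable_locally h : itv_integrable h -> locally_integrable setT h.
Proof.
move=> hi; split; [exact: itv_integrable_measurable|exact: openT|move=> K _ cK].
have [M [_ MK]] := compact_bounded cK.
pose N := Num.max M 0 + 1.
have KN : K `<=` `[- N, N].
  move=> x /(MK N) /=; rewrite in_itv/= -ler_norml; apply.
  by rewrite /N (@le_lt_trans _ _ (Num.max M 0)) ?le_max ?lexx// ltrDl.
have /integrableP[mh] := hi (- N) N; apply: le_lt_trans.
apply: ge0_subset_integral => //=; first exact: compact_measurable.
by apply/measurable_EFinP/measurableT_comp => //; exact/measurable_EFinP.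
Qed.

Lemma is_primitive_derive_pt f h x : is_primitive f h -> lebesgue_pt h x ->
  is_derive x 1 f (h x).
Proof.
move=> [hi fh] hx.
have x1 : x < x + 1 by rewrite ltrDl.
have x0 : ((BLeft (x - 1)%R : itv_bound R) < BRight x)%E by rewrite lte_fin ltrBlDr ltrDl.
have [dF F'] := FTC1_lebesgue_pt x1 (hi _ _) x0 hx.
set F := (fun y => _) in dF F'.
have dF' : is_derive x 1 F (h x) by apply: DeriveDef; [exact: dF|rewrite -derive1E].
have := is_deriveD (is_derive_cst (f (x - 1)) x 1) dF'; rewrite add0r; apply: near_eq_is_derive.
have : x \in `]x - 1, x + 1[ by rewrite in_itv/=; lra.
move=> /near_in_itvoo; apply: filterS => y; rewrite in_itv/= => xy.
rewrite [LHS](_ : _ = f (x - 1) + F y)// /F -fh; last by lra.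
by rewrite addrC subrK.
Qed.

Lemma is_primitive_derive f h x : is_primitive f h -> {for x, continuous h} ->
  is_derive x 1 f (h x).
Proof.
move=> fh ch; apply: is_primitive_derive_pt => //.
apply: (@continuous_lebesgue_pt _ _ _ setT) => //.
- by split; [exact: openT|].
- by have := itv_integrable_measurable fh.1.
Qed.

Lemma is_primitive_ae f h : is_primitive f h -> {ae mu, forall x, is_derive x 1 f (h x)}.
Proof.
move=> fh; have := lebesgue_differentiation (itv_integrable_locally fh.1).
by apply: ae_mono => x; exact: is_primitive_derive_pt.
Qed.

Lemma is_primitive_continuous f h : is_primitive f h -> continuous f.
Proof.
move=> [hi fh] x.
have x1 : x - 1 <= x + 1 by lra.
have /continuous_within_itvP := parameterized_integral_continuous x1 (hi _ _).
have x2 : x - 1 < x + 1 by lra.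
move=> /(_ x2)[] /(_ x) cx _ _.
have {}cx : {for x, continuous (fun y => f (x - 1) + \int[mu]_(t in `[x - 1, y]) h t)}.
  by apply: cvgD; [exact: cvg_cst|apply: cx; rewrite in_itv/=; lra].
rewrite /prop_for /continuous_at in cx.
have fE y : x - 1 <= y -> f y = f (x - 1) + \int[mu]_(t in `[x - 1, y]) h t.
  by move=> /fh <-; rewrite addrC subrK.
rewrite /continuous_at (fE x); last by lra.
apply: cvg_trans cx; apply: near_eq_cvg.
have : x \in `]x - 1, x + 1[ by rewrite in_itv/=; lra.
move=> /near_in_itvoo; apply: filterS => y; rewrite in_itv/= => xy.
by rewrite (fE y)//; lra.
Qed.

Lemma is_primitiveD f g h w : is_primitive f h -> is_primitive g w ->
  is_primitive (fun x => f x + g x) (fun x => h x + w x).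
Proof.
move=> [hi fh] [wi gw]; split; first exact: itv_integrableD.
by move=> a b ab; rewrite RintegralD// -fh// -gw//; ring.
Qed.

Lemma is_primitiveZ (r : R) f h : is_primitive f h ->
  is_primitive (fun x => r * f x) (fun x => r * h x).
Proof.
move=> [hi fh]; split; first exact: itv_integrableZ.
by move=> a b ab; rewrite RintegralZl// -fh//; ring.
Qed.

Lemma derive_is_primitive f h : continuous h -> (forall x, is_derive x 1 f (h x)) ->
  is_primitive f h.
Proof.
move=> ch fh; split; first exact: continuous_itv_integrable.
by move=> a b ab; rewrite (FTC2_itv ab ch fh).
Qed.

Lemma is_primitive_unique f h w : is_primitive f h -> is_primitive f w ->
  {ae mu, forall x, h x = w x}.
Proof.
move=> /is_primitive_ae fh /is_primitive_ae fw.
by apply: ae_mono (ae_and fh fw) => x [[_ <-] [_ <-]].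
Qed.

Lemma MVT_unordered (G p : R -> R) x y : (forall x, is_derive x 1 G (p x)) ->
  exists2 z, Num.min x y <= z <= Num.max x y & G y - G x = p z * (y - x).
Proof.
move=> Gp.
have cG := is_derive_continuous Gp.
wlog xy : x y / x <= y.
  move=> H; case/orP: (le_total x y) => [/H //|/H[z zyx E]]; exists z; first by rewrite minC maxC.
  by rewrite -opprB E; ring.
have [z zxy E] := @MVT_segment _ G p x y xy (fun z _ => Gp z) (continuous_subspaceT cG).
by exists z => //; rewrite (min_idPl xy) (max_idPr xy); move: zxy; rewrite in_itv.
Qed.

(** Chain rule for absolutely continuous f. On a short interval the mean value theorem replaces the
    increment of G by p (xi) times the integral of h, and continuity of p bounds the error by e
    times the integral of |h|. With W a primitive of |h| and D the discrepancy, e W + D and e W - D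
    are locally nondecreasing, hence nondecreasing. *)
Lemma is_primitive_comp f h (G p : R -> R) : is_primitive f h -> continuous p ->
  (forall x, is_derive x 1 G (p x)) -> is_primitive (fun x => G (f x)) (fun x => p (f x) * h x).
Proof.
move=> fh cp Gp.
have cf := is_primitive_continuous fh.
have cpf : continuous (fun x => p (f x)) by move=> x; apply: continuous_comp; [exact: cf|exact: cp].
have [hi fhE] := fh.
have phi := itv_integrableM_cont cpf hi.
split => // a b ab.
have nhi := itv_integrable_norm hi.
have local e x : 0 < e -> exists2 d, 0 < d & forall s t, s <= t ->
    `|s - x| < d -> `|t - x| < d ->
    `|G (f t) - G (f s) - \int[mu]_(z in `[s, t]) (p (f z) * h z)| <= e * \int[mu]_(z in `[s, t]) `|h z|.
  move=> e0.
  have e20 : 0 < e / 2 by lra.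
  have /cvgrPdist_lt/(_ _ e20)/nbhs_ballP[eta /= eta0 Heta] := cp (f x).
  have /cvgrPdist_lt/(_ _ eta0)/nbhs_ballP[d /= d0 Hd] := cf x.
  exists d => // s t st sx tx.
  have fz z : `|z - x| < d -> `|f x - f z| < eta by move=> zx; apply: Hd; rewrite /ball/= distrC.
  have pz z : `|f x - z| < eta -> `|p (f x) - p z| < e / 2 by move=> zx; apply: Heta.
  have [xi xist ->] := MVT_unordered (f s) (f t) Gp.
  have xix : `|f x - xi| < eta.
    move: (fz _ sx) (fz _ tx) xist; rewrite !ltr_norml ge_min le_max; lra.
  rewrite fhE// -RintegralZl// -RintegralB//; last first.
    exact: (itv_integrableZ (p xi) hi).
  rewrite -RintegralZl//.
  apply: le_trans (le_normr_Rintegral _ _) _ => //.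
    exact: (itv_integrableB (itv_integrableZ (p xi) hi) phi).
  apply: le_Rintegral => //.
  - exact: (itv_integrable_norm (itv_integrableB (itv_integrableZ (p xi) hi) phi)).
  - exact: (itv_integrableZ e nhi).
  move=> z; rewrite /= in_itv/= => zst.
  rewrite -mulrBl normrM ler_wpM2r//.
  have /fz/pz : `|z - x| < d by move: sx tx; rewrite !ltr_norml; lra.
  by have := pz _ xix; rewrite !ltr_norml ler_norml; lra.
have Wp := primitiveP nhi; have Ip := primitiveP phi.
set W := primitive (fun x => `|h x|) in Wp; set I := primitive _ in Ip.
apply/eqP; rewrite -subr_eq0 -normr_le0; apply/ler_addgt0Pl => e1 e10.
pose B := \int[mu]_(z in `[a, b]) `|h z|.
have B0 : 0 <= B by apply: Rintegral_ge0.
(* B may vanish, hence the denominator B + 1; it still gives e B <= e1. *)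
pose e := e1 / (B + 1).
have e0 : 0 < e by rewrite divr_gt0//; lra.
rewrite addr0; apply: (@le_trans _ _ (e * B)); last first.
  by rewrite /e mulrAC ler_pdivrMr; [nra|lra].
rewrite /B -Wp.2// -Ip.2//.
pose D x := G (f x) - I x.
have localD x : exists2 d, 0 < d & forall s t, s <= t ->
    `|s - x| < d -> `|t - x| < d -> `|D t - D s| <= e * (W t - W s).
  have [d d0 H] := local e x e0; exists d => // s t st sx tx.
  by have := H s t st sx tx; rewrite -Wp.2// -Ip.2// /D; congr (`|_| <= _); ring.
have steps : forall x, a <= x <= b -> exists2 d, 0 < d & forall y, a <= y <= b ->
    `|y - x| < d -> (y <= x -> `|D x - D y| <= e * (W x - W y)) /\
                    (x <= y -> `|D y - D x| <= e * (W y - W x)).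
  move=> x _; have [d d0 H] := localD x; exists d => // y _ yx.
  by split => yx'; apply: H => //; rewrite subrr normr0.
have bnd s t : `|D t - D s| <= e * (W t - W s) ->
    e * W s + D s <= e * W t + D t /\ e * W s - D s <= e * W t - D t.
  by rewrite ler_norml mulrBr; clear; lra.
rewrite (_ : _ - _ = D b - D a); last by rewrite /D; ring.
have Dp : e * W a + D a <= e * W b + D b.
  apply: (locally_nondecreasing (f := fun x => e * W x + D x)) => // x xab.
  have [d d0 H] := steps x xab; exists d => // y yab yx.
  by have [H1 H2] := H y yab yx; split=> /[dup] [/H1|/H2] /bnd[].
have Dm : e * W a - D a <= e * W b - D b.
  apply: (locally_nondecreasing (f := fun x => e * W x - D x)) => // x xab.
  have [d d0 H] := steps x xab; exists d => // y yab yx.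
  by have [H1 H2] := H y yab yx; split=> /[dup] [/H1|/H2] /bnd[].
by rewrite ler_norml mulrBr; move: Dp Dm; clear; lra.
Qed.

(** The pushforward of Lebesgue measure under a translation has the right values on half-open
    intervals, so by uniqueness it is Lebesgue measure and preimages of null sets are null. *)
Lemma null_translate (P : R -> Prop) y :
  {ae mu, forall x, P x} -> {ae mu, forall x, P (x + y)}.
Proof.
have mg : measurable_fun setT (fun x : measurableTypeR R => x + y : measurableTypeR R).
  by apply: continuous_measurable_fun => x; apply: cvgD; [exact: cvg_id|exact: cvg_cst].
move=> [N [mN N0 PN]].
exists ((fun x => x + y) @^-1` N); split.
- by rewrite -[X in measurable X]setTI; exact: mg.
- pose shift_y := (fun x => x + y) : measurableTypeR R -> measurableTypeR R.
  rewrite -[LHS]/(pushforward mu shift_y N) -N0; apply/esym.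
  apply: (@lebesgue_measure_unique R (pushforward mu shift_y)) => //.
  move=> _ [[a b] _ <-] /=.
  rewrite /pushforward (_ : _ @^-1` _ = `]a - y, b - y]%classic).
    by rewrite !lebesgue_measure_itv/= !lte_fin ltrD2r; case: ltP => // _; rewrite -!EFinB; congr EFin; ring.
  by apply/seteqP; split => x /=; rewrite !in_itv/= ltrBlDr lerBrDr.
- by move=> x /= nP; apply: PN.
Qed.

End IntervalIntegrals.

(** * Weak derivatives *)

Section WeakDerivatives.
Variable R : realType.
Implicit Types (f g h v w u phi : R -> R) (a b c x y : R).
Local Notation mu := (@lebesgue_measure R).

Lemma integral_supported f a b : (forall x, ~~ (a <= x <= b) -> f x = 0) ->
  \int[mu]_x f x = \int[mu]_(x in `[a, b]) f x.
Proof.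
move=> f0; rewrite [RHS]Rintegral_mkcond; apply: eq_Rintegral => x _.
rewrite patchE; case: ifPn => //; rewrite notin_setE/= in_itv/= => H.
by rewrite f0//; exact/negP.
Qed.

Lemma is_derive_sqr x : is_derive x 1 (fun y : R => y ^+ 2) (2 * x).
Proof.
apply: DeriveDef; first exact: exprn_derivable.
by rewrite exp_derive expr1 scaler1.
Qed.

(** Polarization: 4 f g = (f + g)^2 - (f - g)^2, and squares are covered by the chain rule. *)
Lemma is_primitiveM f g h w : is_primitive f h -> is_primitive g w ->
  is_primitive (fun x => f x * g x) (fun x => f x * w x + g x * h x).
Proof.
move=> fh gw.
have c2 : continuous (fun y : R => 2 * y) by move=> y; apply: cvgM; [exact: cvg_cst|exact: cvg_id].
have P := is_primitive_comp (is_primitiveD fh gw) c2 is_derive_sqr.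
have M := is_primitive_comp (is_primitiveD fh (is_primitiveZ (-1) gw)) c2 is_derive_sqr.
have := is_primitiveD (is_primitiveZ 4^-1 P) (is_primitiveZ (- 4^-1) M).
congr is_primitive; apply/funext => x; by field.
Qed.

Lemma test_fun_supp phi : test_fun phi -> exists2 N : R, 0 < N &
  forall x, ~~ (- N <= x <= N) -> phi x = 0 /\ derive1 phi x = 0.
Proof.
move=> [_ _ cphi].
have [M [_ MK]] := compact_bounded cphi.
pose N := Num.max M 0 + 1.
have N0 : 0 < N by rewrite /N ltr_pwDr// le_max lexx orbT.
have MN : M < N by rewrite /N (@le_lt_trans _ _ (Num.max M 0)) ?le_max ?lexx// ltrDl.
have supp x : ~~ (- N <= x <= N) -> phi x = 0.
  move=> xN; apply/eqP/negPn/negP => phix.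
  by move: xN; rewrite -ler_norml (MK _ MN)//; exact: subset_closure.
exists N => // x xN; split; first exact: supp.
rewrite derive1E.
have : \forall y \near x, ~~ (- N <= y <= N).
  rewrite -ler_norml -ltNge in xN.
  have cn : {for x, continuous (fun y : R => `|y|)} by apply: cvg_norm; exact: cvg_id.
  by near=> y; rewrite -ler_norml -ltNge; near: y; exact: cvgr_gt cn _ xN.
move=> near0.
have : is_derive x 1 phi 0.
  have := @is_derive_cst R R R 0 x 1; apply: near_eq_is_derive.
  by apply: filterS near0 => y /supp ->.
by case.
Unshelve. all: by end_near. Qed.

Lemma test_fun_is_primitive phi : test_fun phi -> is_primitive phi (derive1 phi).
Proof.
move=> [dphi cphi _]; apply: derive_is_primitive => // x.
by rewrite derive1E; exact: derivableP.
Qed.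

Lemma integration_by_parts_test f h phi : is_primitive f h -> test_fun phi ->
  \int[mu]_x (f x * derive1 phi x) = - \int[mu]_x (h x * phi x).
Proof.
move=> fh tphi.
have [N N0 supp] := test_fun_supp tphi.
have pphi := test_fun_is_primitive tphi.
have cphi := is_primitive_continuous pphi.
have cphi' : continuous (derive1 phi) by case: tphi.
have cf := is_primitive_continuous fh.
(* The endpoints -M and M lie strictly outside [-N, N], so the boundary terms vanish. *)
pose M := N + 1.
have suppM x : ~~ (- M <= x <= M) -> phi x = 0 /\ derive1 phi x = 0.
  by move=> xM; apply: supp; apply: contra xM; rewrite /M; lra.
rewrite (@integral_supported _ (- M) M); last by move=> x /suppM[_ ->]; rewrite mulr0.
rewrite (@integral_supported _ (- M) M); last by move=> x /suppM[-> _]; rewrite mulr0.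
have [_ E] := is_primitiveM fh pphi.
have MM : - M <= M by rewrite /M; lra.
have := E _ _ MM.
have [|-> _] := supp M; first by rewrite /M; apply/negP; lra.
have [|-> _] := supp (- M); first by rewrite /M; apply/negP; lra.
rewrite !mulr0 subrr.
rewrite RintegralD//.
- move=> /esym/eqP; rewrite addr_eq0 => /eqP ->; congr (- _).
  by apply: eq_Rintegral => x _; rewrite mulrC.
- exact: (itv_integrableM_cont cf (continuous_itv_integrable cphi')).
- exact: (itv_integrableM_cont cphi fh.1).
Qed.

(** Zero mean is what makes the primitive started at a vanish again beyond b. *)
Lemma test_fun_primitive (p : R -> R) a b : a <= b -> continuous p ->
  (forall x, ~~ (a < x < b) -> p x = 0) -> \int[mu]_(x in `[a, b]) p x = 0 ->
  exists2 phi, test_fun phi & derive1 phi = p.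
Proof.
move=> ab cp supp p0.
have pP := primitiveP (continuous_itv_integrable cp).
pose phi x := primitive p x - primitive p a.
have dphi x : is_derive x 1 phi (p x).
  have := is_deriveB (is_primitive_derive pP (cp x)) (is_derive_cst (primitive p a) x 1).
  by rewrite subr0.
have phi' : derive1 phi = p by apply/funext => x; rewrite derive1E; case: (dphi x).
exists phi => //; split.
- by move=> x; case: (dphi x).
- by rewrite phi'.
- apply: (@subclosed_compact _ _ `[a, b]%classic).
  + exact: closed_closure.
  + exact: segment_compact.
  + rewrite closureEbigcap => x; apply; split; first exact: itv_closed.
    move=> y /= /eqP phiy; rewrite in_itv/=; apply/negPn/negP => yab; apply: phiy.
    have zero s r : r <= a \/ b <= s -> s <= r -> \int[mu]_(x in `[s, r]) p x = 0.
      move=> H sr; rewrite -[RHS](mul0r (r - s)) -itv_integral_cst//.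
      by apply: eq_itv_integral => z zsr; apply: supp; apply/negP; case: H; lra.
    have pi := continuous_itv_integrable cp.
    rewrite /phi; case: (leP a y) yab => ya /= yab.
      rewrite pP.2// (integral_itv_cat ab _ pi); last by move/negP: yab; lra.
      by rewrite p0 add0r zero//; [right|move/negP: yab; lra].
    by rewrite -opprB pP.2 ?(ltW ya)// zero ?oppr0//; [left|lra].
Qed.

(** A trapezoid whose slopes have width d. It serves as a fixed weight of positive mass and as an
    approximation of the indicator of an interval. *)
Lemma tent_exists a b d : 0 < d -> a + 2 * d < b -> exists2 tau : R -> R,
   continuous tau & [/\ forall x, ~~ (a < x < b) -> tau x = 0,
    forall x, a + d <= x <= b - d -> tau x = 1 & forall x, 0 <= tau x <= 1].
Proof.
move=> d0 ab.
pose tau x := Num.max 0 (Num.min 1 (Num.min ((x - a) / d) ((b - x) / d))).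
exists tau.
    have cid : continuous (fun x : R => x) by move=> x; exact: cvg_id.
  have ccst (r : R) : continuous (fun x : R => r) by move=> x; exact: cvg_cst.
  have cl : continuous (fun x => (x - a) / d) by move=> x; apply: cvgMl; apply: cvgB; [exact: cid|exact: ccst].
  have cr : continuous (fun x => (b - x) / d) by move=> x; apply: cvgMl; apply: cvgB; [exact: ccst|exact: cid].
  exact: (max_fun_continuous (ccst 0) (min_fun_continuous (ccst 1) (min_fun_continuous cl cr))).
have dV : 0 < d^-1 by rewrite invr_gt0.
split=> [x xab|x xab|x].
- apply: max_l; rewrite !ge_min; apply/orP; right.
  have [xa|ax] := leP x a.
    by apply/orP; left; rewrite pmulr_lle0//; lra.
  by apply/orP; right; rewrite pmulr_lle0//; move/negP: xab; lra.
- rewrite /tau min_l ?max_r// le_min !ler_pdivlMr// !mul1r; lra.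
- by rewrite /tau le_max lexx/= ge_max ler01 ge_min lexx.
Qed.

(* The du Bois-Reymond lemma *)
Lemma weakly_constant w : itv_integrable w ->
  (forall phi, test_fun phi -> \int[mu]_x (w x * derive1 phi x) = 0) ->
  exists c, {ae mu, forall x, w x = c}.
Proof.
move=> wi H.
(* A reference bump of mass k > 0: subtracting a multiple of it turns any compactly supported
   continuous function into the derivative of a test function. *)
have [tau0 ctau0 [supp0 tau01 tau0b]] : exists2 tau : R -> R,
   continuous tau & [/\ forall x, ~~ (0 < x < 3) -> tau x = 0,
    forall x, 0 + 1 <= x <= 3 - 1 -> tau x = 1 & forall x, 0 <= tau x <= 1].
  by apply: tent_exists; lra.
pose k := \int[mu]_(x in `[0, 3]) tau0 x.
have i0 := continuous_itv_integrable ctau0.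
have k0 : 0 < k.
  have : 1 * (2 - 1) <= \int[mu]_(x in `[1, 2]) tau0 x.
    rewrite -itv_integral_cst; last by lra.
    apply: le_itv_integral => //; first by apply: continuous_itv_integrable => x; exact: cvg_cst.
    by move=> x x12; rewrite tau01//; lra.
  have e01 : 0 <= \int[mu]_(x in `[0, 1]) tau0 x by apply: Rintegral_ge0 => x _; case/andP: (tau0b x).
  have e23 : 0 <= \int[mu]_(x in `[2, 3]) tau0 x by apply: Rintegral_ge0 => x _; case/andP: (tau0b x).
  have le13 : 1 <= 3 :> R by clear; lra.
  have le12 : 1 <= 2 :> R by clear; lra.
  have le23 : 2 <= 3 :> R by clear; lra.
  have lt01 : 0 < 1 * (2 - 1) :> R by clear; lra.
  rewrite /k (integral_itv_cat ler01 le13 i0) (integral_itv_cat le12 le23 i0).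
  by move=> /(lt_le_trans lt01) H12; rewrite ltr_wpDl// ltr_pwDl.
pose c := \int[mu]_x (w x * tau0 x) / k.
exists c.
have weaken (f : R -> R) a b : (forall x, ~~ (a < x < b) -> f x = 0) ->
    forall x, ~~ (a <= x <= b) -> f x = 0.
  by move=> H1 x xab; apply: H1; apply: contra xab => /andP[/ltW -> /ltW ->].
have zero_mean tau a b : a <= b -> continuous tau -> (forall x, ~~ (a < x < b) -> tau x = 0) ->
    \int[mu]_(x in `[a, b]) ((w x - c) * tau x) = 0.
  move=> ab ctau supp.
  pose a' := Num.min a 0; pose b' := Num.max b 3.
  have aa' : a' <= a by rewrite /a' ge_min lexx.
  have a'0 : a' <= 0 by rewrite /a' ge_min lexx orbT.
  have bb' : b <= b' by rewrite /b' le_max lexx.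
  have b'3 : 3 <= b' by rewrite /b' le_max lexx orbT.
  have supp' x : ~~ (a' < x < b') -> tau x = 0.
    by move=> H1; apply: supp; apply: contra H1 => /andP[ax xb]; rewrite (le_lt_trans aa')//= (lt_le_trans xb).
  have supp0' x : ~~ (a' < x < b') -> tau0 x = 0.
    by move=> H1; apply: supp0; apply: contra H1 => /andP[ax xb]; rewrite (le_lt_trans a'0)//= (lt_le_trans xb).
  have it := continuous_itv_integrable ctau.
  have enlarge f : (forall x, ~~ (a <= x <= b) -> f x = 0) ->
      \int[mu]_(x in `[a, b]) f x = \int[mu]_(x in `[a', b']) f x.
    move=> H1; rewrite -(integral_supported H1); apply: integral_supported => x xab; apply: H1.
    by apply: contra xab => /andP[/(le_trans aa') ->/= /le_trans ->].
  have enlarge0 f : (forall x, ~~ (0 <= x <= 3) -> f x = 0) ->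
      \int[mu]_(x in `[0, 3]) f x = \int[mu]_(x in `[a', b']) f x.
    move=> H1; rewrite -(integral_supported H1); apply: integral_supported => x xab; apply: H1.
    by apply: contra xab => /andP[/(le_trans a'0) ->/= /le_trans ->].
  pose l := \int[mu]_(x in `[a', b']) tau x / k.
  pose p x := tau x - l * tau0 x.
  have il0 := itv_integrableZ l i0.
  have cp : continuous p.
    by move=> x; apply: cvgB; [exact: ctau|apply: cvgMr; exact: ctau0].
  have a'b' : a' <= b' by rewrite (le_trans aa')// (le_trans ab).
  have [||phi tphi phi'] := @test_fun_primitive p a' b' a'b' cp.
  - by move=> x xab; rewrite /p supp'// supp0'// mulr0 subr0.
  - rewrite itv_integralB// itv_integralZ// /l -(enlarge0 _ (weaken _ _ _ supp0)) -/k.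
    by rewrite divfK ?subrr// gt_eqF.
  have := H phi tphi; rewrite phi'.
  rewrite (@integral_supported _ a' b'); last first.
    by move=> x xab; rewrite /p (weaken _ _ _ supp')// (weaken _ _ _ supp0')// mulr0 subr0 mulr0.
  have iwt := itv_integrableMr_cont ctau wi.
  have iwt0 := itv_integrableMr_cont ctau0 wi.
  rewrite (@eq_itv_integral _ _ (fun x => w x * tau x - l * (w x * tau0 x))); last first.
    by move=> x _; rewrite /p; ring.
  rewrite itv_integralB//; last exact: itv_integrableZ.
  rewrite itv_integralZ// => /eqP; rewrite subr_eq0 => /eqP E.
  rewrite enlarge; last by move=> x /(weaken _ _ _ supp) ->; rewrite mulr0.
  rewrite (@eq_itv_integral _ _ (fun x => w x * tau x - c * tau x)); last by move=> x _; ring.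
  rewrite itv_integralB//; last exact: itv_integrableZ.
  rewrite itv_integralZ// E /l /c (@integral_supported _ a' b'); last first.
    by move=> x /(weaken _ _ _ supp0') ->; rewrite mulr0.
  by rewrite [X in _ - X]mulrC mulrA [X in _ - X]mulrAC subrr.
pose g x := w x - c.
have gi : itv_integrable g by apply: itv_integrableB => //; apply: continuous_itv_integrable => x; exact: cvg_cst.
(* Test g = w - c with a trapezoid on [s, t]. The error lives on two end pieces of length d and is
   at most the integral of |g| there, which tends to 0 with d because the primitive A is
   continuous. *)
have zero_int s t : s < t -> \int[mu]_(x in `[s, t]) g x = 0.
  move=> st.
  have ngi := itv_integrable_norm gi.
  have pA := primitiveP ngi; set A := primitive _ in pA.
  have cA := is_primitive_continuous pA.
  suff bnd d : 0 < d -> s + 2 * d < t ->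
      `|\int[mu]_(x in `[s, t]) g x| <= (A (s + d) - A s) + (A t - A (t - d)).
    apply/eqP; rewrite -normr_le0; apply/ler_addgt0Pl => e e0; rewrite addr0.
    have e20 : 0 < e / 2 by lra.
    have /cvgrPdist_lt/(_ _ e20)/nbhs_ballP[d1 /= d10 H1] := cA s.
    have /cvgrPdist_lt/(_ _ e20)/nbhs_ballP[d2 /= d20 H2] := cA t.
    pose d := Num.min (Num.min (d1 / 2) (d2 / 2)) ((t - s) / 3).
    have d0 : 0 < d by rewrite !lt_min; apply/andP; split; [apply/andP; split|]; lra.
    have dd1 : d <= d1 / 2 by rewrite /d !ge_min lexx.
    have dd2 : d <= d2 / 2 by rewrite /d !ge_min lexx orbT.
    have dst : d <= (t - s) / 3 by rewrite /d ge_min lexx orbT.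
    have := bnd d d0; move/(_ _)/le_trans; apply; first by lra.
    have /H1 : ball s d1 (s + d) by rewrite /ball/= ltr_norml; lra.
    have /H2 : ball t d2 (t - d) by rewrite /ball/= ltr_norml; lra.
    rewrite /= !ltr_norml; lra.
  move=> d0 dst.
  have [tau ctau [supp tau1 taub]] := tent_exists d0 dst.
  have igt := itv_integrableMr_cont ctau gi.
  have := zero_mean _ s t (ltW st) ctau supp => Z.
  rewrite -[X in `|X|]subr0 -Z -itv_integralB//.
  have idf := itv_integrableB gi igt.
  have gtau x : `|g x - g x * tau x| <= `|g x|.
    have /andP[t0 t1] := taub x.
    rewrite -{1}[g x]mulr1 -mulrBr normrM ler_piMr// ger0_norm ?subr_ge0//.
    by rewrite lerBlDr lerDl.
  apply: le_trans (le_normr_Rintegral _ _) _ => //.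
  have indf := itv_integrable_norm idf.
  rewrite (@integral_itv_cat _ _ s (s + d) t)//; try lra.
  rewrite (@integral_itv_cat _ _ (s + d) (t - d) t)//; try lra.
  rewrite pA.2; last by lra.
  rewrite pA.2; last by lra.
  rewrite -[X in _ + (X + _)](_ : 0 = _) ?add0r.
    by apply: lerD; apply: le_itv_integral => // x _; exact: gtau.
  rewrite (@eq_itv_integral _ _ (fun=> 0)) ?itv_integral_cst ?mul0r//; first by lra.
  by move=> x /tau1 ->; rewrite mulr1 /g subrr normr0.
(* All interval integrals of g vanish, so g is an almost everywhere derivative of a constant
   function. *)
have pg : is_primitive (fun=> 0) g.
  split=> // s t; rewrite le_eqVlt subrr => /predU1P[<-|st]; last by rewrite zero_int.
  by rewrite set_itv1 Rintegral_set1.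
apply: ae_mono (is_primitive_ae pg) => x [_].
by rewrite (_ : 'D_1 _ x = 0) ?derive_cst// => /esym/eqP; rewrite subr_eq0 => /eqP.
Qed.

(** Subtract from u a primitive V of v: by integration by parts u - V has vanishing weak derivative,
    so it is constant almost everywhere. *)
Lemma weak_derivative_primitive u v : itv_integrable u -> itv_integrable v ->
  (forall phi, test_fun phi ->
    \int[mu]_x (u x * derive1 phi x) = - \int[mu]_x (v x * phi x)) ->
  exists2 U, is_primitive U v & {ae mu, forall x, u x = U x}.
Proof.
move=> ui vi H.
have pV := primitiveP vi; set V := primitive v in pV.
have cV := is_primitive_continuous pV.
have wi := itv_integrableB ui (continuous_itv_integrable cV).
have [|c cw] := weakly_constant wi.
  move=> phi tphi.
  have [N N0 supp] := test_fun_supp tphi.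
  have cphi' : continuous (derive1 phi) by case: tphi.
  have supp' x : ~~ (- N <= x <= N) -> u x * derive1 phi x = 0 by move=> /supp[_ ->]; rewrite mulr0.
  have suppV x : ~~ (- N <= x <= N) -> V x * derive1 phi x = 0 by move=> /supp[_ ->]; rewrite mulr0.
  have := H phi tphi; rewrite -(integration_by_parts_test pV tphi).
  rewrite (integral_supported supp') (integral_supported suppV) => E.
  rewrite (@integral_supported _ (- N) N); last by move=> x /supp[_ ->]; rewrite mulr0.
  under eq_Rintegral do rewrite mulrBl.
  by rewrite itv_integralB ?E ?subrr//; apply: itv_integrableMr_cont => //; exact: continuous_itv_integrable.
exists (fun x => c + V x).
  by split=> // s r sr; rewrite -pV.2//; ring.
by apply: ae_mono cw => x <-; rewrite subrK.
Qed.

End WeakDerivatives.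

(** * Elliptic integrals and the function cn *)

Section DerivativeChain.
Variable R : realType.

Lemma is_derive_chain (f g : R -> R) (x a b : R) : is_derive x 1 g b ->
  is_derive (g x) 1 f a -> is_derive x 1 (fun y => f (g y)) (a * b).
Proof. by move=> dg df; exact: is_derive1_comp. Qed.

End DerivativeChain.

Section EvenPeriodicPrimitive.
Variable R : realType.
Variable h : R -> R.
Hypothesis ch : continuous h.
Hypothesis h_even : forall x, h (- x) = h x.
Hypothesis h_pi : forall x, h (x + pi) = h x.
Local Notation H := (primitive h).

Lemma primitive0 : H 0 = 0.
Proof. by rewrite /primitive lexx set_itv1 Rintegral_set1. Qed.

Lemma primitive_is_derive (x : R) : is_derive x 1 H (h x).
Proof. by apply: is_primitive_derive; [exact/primitiveP/continuous_itv_integrable|exact: ch]. Qed.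

Lemma primitive_opp x : H (- x) = - H x.
Proof.
apply/eqP; rewrite -addr_eq0; apply/eqP.
have -> : 0 = H (- 0) + H 0 by rewrite oppr0 primitive0 addr0.
apply: (@is_derive_0_is_cst _ (fun y => H (- y) + H y)) => y.
have := is_deriveD (is_derive1_comp (primitive_is_derive (- y)) (is_deriveN (is_derive_id y 1))) (primitive_is_derive y).
by rewrite h_even mulrN1 addNr.
Qed.

Lemma primitive_addpi x : H (x + pi) = H x + H pi.
Proof.
suff : H (x + pi) - H x = H (0 + pi) - H 0.
  by rewrite add0r primitive0 subr0 => <-; rewrite [RHS]addrC subrK.
apply: (@is_derive_0_is_cst _ (fun y => H (y + pi) - H y) x 0) => y.
have dy : is_derive y 1 (fun y : R => y + pi) (1 + 0) := is_deriveD (is_derive_id y 1) (is_derive_cst pi y 1).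
have := is_deriveB (is_derive_chain dy (primitive_is_derive (y + pi))) (primitive_is_derive y).
by rewrite h_pi addr0 mulr1 subrr.
Qed.

Lemma primitive_pi : H pi = 2 * H (pi / 2).
Proof.
have := primitive_addpi (- (pi / 2)).
rewrite (_ : - (pi / 2) + pi = pi / 2); last by field.
rewrite primitive_opp; lra.
Qed.

Lemma primitive_2pi : H (2 * pi) = 4 * H (pi / 2).
Proof. by rewrite (_ : 2 * pi = pi + pi) ?primitive_addpi ?primitive_pi; ring. Qed.

End EvenPeriodicPrimitive.

(** * The amplitude, cn, its derivatives and its even moments *)

Section JacobiFunctions.
Variables (R : realType) (k : R).
Hypothesis k01 : 0 < k < 1.
Implicit Types x phi t : R.
Local Notation mu := (@lebesgue_measure R).

Definition ellDelta t := 1 - k ^+ 2 * sin t ^+ 2.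

Lemma ellDelta_gt0 t : 0 < ellDelta t.
Proof.
rewrite /ellDelta; have := cos2Dsin2 t; have := sqr_ge0 (cos t).
have [k0 k1] : 0 < k /\ k < 1 by apply/andP.
have k2 : k ^+ 2 < 1 by rewrite expr_lt1// ltW.
have := sqr_ge0 (sin t); set s := sin t ^+ 2; set c := cos t ^+ 2; nra.
Qed.

Lemma ellDelta_le1 t : ellDelta t <= 1.
Proof. by rewrite /ellDelta; have := sqr_ge0 (k * sin t); rewrite exprMn; lra. Qed.

Lemma continuous_ellDelta : continuous ellDelta.
Proof.
move=> t; apply: cvgB; first exact: cvg_cst.
by apply: cvgMr; apply: (@continuous_comp _ _ _ (@sin R) (fun y => y ^+ 2)); [exact: continuous_sin|exact: exprn_continuous].
Qed.

Lemma ellF_integrandE t : ellF_integrand k t = (Num.sqrt (ellDelta t))^-1.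
Proof. by []. Qed.

Lemma ellF_integrand_ge1 t : 1 <= ellF_integrand k t.
Proof.
have := ellDelta_gt0 t; have := ellDelta_le1 t => h1 h0.
rewrite ellF_integrandE invf_ge1 ?sqrtr_gt0//.
by rewrite -[leRHS]sqrtr1 ler_wsqrtr.
Qed.

Lemma continuous_ellF_integrand : continuous (ellF_integrand k).
Proof.
move=> t; apply: cvgV; first by rewrite gt_eqF// sqrtr_gt0 ellDelta_gt0.
apply: continuous_comp; first exact: continuous_ellDelta.
exact: sqrt_continuous.
Qed.

(** The power cn^(2p) after the substitution t = am x, where dx = [ellF_integrand] dt. The case p =
    0 yields K, p = 1 the mass and p = 2 the quartic integral. *)
Definition weighted_integrand (p : nat) t := cos t ^+ p.*2 * ellF_integrand k t.

Lemma weighted_integrand0 : weighted_integrand 0 = ellF_integrand k.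
Proof. by apply/funext => t; rewrite /weighted_integrand expr0 mul1r. Qed.

Lemma continuous_weighted_integrand p : continuous (weighted_integrand p).
Proof.
move=> t; apply: cvgM; last exact: continuous_ellF_integrand.
by apply: (@continuous_comp _ _ _ (@cos R) (fun y => y ^+ p.*2)); [exact: continuous_cos|exact: exprn_continuous].
Qed.

Lemma weighted_integrand_even p t : weighted_integrand p (- t) = weighted_integrand p t.
Proof. by rewrite /weighted_integrand /ellF_integrand cosN sinN sqrrN. Qed.

Lemma weighted_integrand_pi p t : weighted_integrand p (t + pi) = weighted_integrand p t.
Proof.
rewrite /weighted_integrand /ellF_integrand cosDpi sinDpi sqrrN.
by rewrite -!mul2n !exprM sqrrN.
Qed.

Definition ellI p := \int[mu]_(t in `[0, pi / 2]) weighted_integrand p t.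

Lemma primitive_ellI p : primitive (weighted_integrand p) (pi / 2) = ellI p.
Proof. by rewrite /primitive ltW// divr_gt0 ?pi_gt0. Qed.

Lemma ellKE : ellK k = ellI 0.
Proof. by rewrite -primitive_ellI weighted_integrand0. Qed.

Local Notation F := (fun phi => ellF phi k).
Local Notation K := (ellK k).

Lemma ellF_primitive : F = primitive (weighted_integrand 0).
Proof. by rewrite weighted_integrand0. Qed.

Lemma is_derive_ellF phi : is_derive phi 1 F (ellF_integrand k phi).
Proof.
have := primitive_is_derive (continuous_weighted_integrand (p := 0)) phi.
by rewrite -ellF_primitive weighted_integrand0.
Qed.

Lemma ellF_incr : {mono F : x y / x <= y}.
Proof.
apply: le_mono => x y xy.
have [z _ E] := MVT_segment (ltW xy) (fun z _ => is_derive_ellF z) (continuous_subspaceT (is_derive_continuous is_derive_ellF)).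
by rewrite -subr_gt0 E mulr_gt0 ?subr_gt0// (lt_le_trans ltr01)// ellF_integrand_ge1.
Qed.

Lemma continuous_ellF : continuous F.
Proof.
by rewrite ellF_primitive; apply/is_primitive_continuous/primitiveP/continuous_itv_integrable/continuous_weighted_integrand.
Qed.

Lemma ellF_addpi phi : ellF (phi + pi) k = ellF phi k + 2 * K.
Proof.
rewrite ellKE -primitive_ellI -[LHS]/(F (phi + pi)) -[ellF phi k]/(F phi) ellF_primitive.
have c := continuous_weighted_integrand (p := 0).
have e := weighted_integrand_even 0; have p := weighted_integrand_pi 0.
by rewrite primitive_addpi// primitive_pi.
Qed.

Lemma ellF0 : ellF 0 k = 0.
Proof. by rewrite -[LHS]/(F 0) ellF_primitive primitive0. Qed.

Lemma ellF_opp phi : ellF (- phi) k = - ellF phi k.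
Proof.
have := primitive_opp (continuous_weighted_integrand (p := 0)) (weighted_integrand_even 0) phi.
by rewrite -ellF_primitive.
Qed.

Lemma ellF_ge phi : 0 <= phi -> phi <= ellF phi k.
Proof.
move=> p0; rewrite /ellF p0.
rewrite -[leLHS]mul1r -[X in 1 * X]subr0 -itv_integral_cst//; apply: le_itv_integral.
- by apply: continuous_itv_integrable => ?; exact: cvg_cst.
- exact: continuous_itv_integrable continuous_ellF_integrand.
- by move=> x _; exact: ellF_integrand_ge1.
Qed.

(** F is odd and F(phi) >= phi for phi >= 0, so the intermediate value theorem applies on
    [-|x|, |x|]. Hence [am] never takes its default value for want of a solution. *)
Lemma ellF_surj x : exists phi, ellF phi k = x.
Proof.
have x0 : - `|x| <= `|x| by have := normr_ge0 x; lra.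
have [|c _ E] := IVT (v := x) x0 (continuous_subspaceT continuous_ellF); last by exists c.
have := ellF_ge (normr_ge0 x); have := ellF_opp `|x|; have := ler_norm x; have := ler_norm (- x).
rewrite normrN ge_min le_max => h1 h2 -> h3; apply/andP; split; apply/orP.
  by left; lra.
by right; lra.
Qed.

Local Notation am := (fun x => am x k).

Lemma amK x : ellF (am x) k = x.
Proof.
rewrite /Defs.am; case: xgetP => [phi -> //|H].
by have [phi E] := ellF_surj x; case: (H phi); rewrite /= E.
Qed.

Lemma ellFK phi : am (ellF phi k) = phi.
Proof. by apply: (inc_inj ellF_incr); rewrite amK. Qed.

Lemma am0 : am 0 = 0.
Proof. by rewrite -[in LHS]ellF0 ellFK. Qed.

Lemma am_add2K x : am (x + 2 * K) = am x + pi.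
Proof. by rewrite -[in LHS](amK x) -ellF_addpi ellFK. Qed.

Lemma am_mono : {mono am : x y / x <= y}.
Proof. by move=> x y; rewrite -ellF_incr !amK. Qed.

Lemma am2K : am (2 * K) = pi.
Proof. by rewrite -[2 * K]add0r am_add2K am0 add0r. Qed.

Lemma ellK_ge : pi / 2 <= K.
Proof. by apply: ellF_ge; rewrite divr_ge0 ?pi_ge0. Qed.

Lemma ellK_gt0 : 0 < K.
Proof. by apply: lt_le_trans ellK_ge; rewrite divr_gt0 ?pi_gt0. Qed.

Definition dn x := Num.sqrt (ellDelta (am x)).

Lemma dn_gt0 x : 0 < dn x.
Proof. by rewrite sqrtr_gt0 ellDelta_gt0. Qed.

Lemma dn_sqr x : dn x ^+ 2 = 1 - k ^+ 2 * sin (am x) ^+ 2.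
Proof. by rewrite sqr_sqrtr// ltW// ellDelta_gt0. Qed.

Lemma is_derive_am x : is_derive x 1 am (dn x).
Proof.
rewrite -{1}(amK x) -[dn x]invrK.
apply: (@is_derive_inverse _ F).
- by near=> y; rewrite ellFK.
- by near=> y; exact: continuous_ellF.
- exact: is_derive_ellF.
- by rewrite invr_eq0 gt_eqF// dn_gt0.
Unshelve. all: by end_near. Qed.

Lemma is_derive_ellDelta t : is_derive t 1 ellDelta (- (k ^+ 2 * (2 * sin t * cos t))).
Proof.
have H := is_deriveB (is_derive_cst (1 : R) t 1)
  (is_deriveZ (k ^+ 2) (is_derive1_comp (is_derive_sqr (sin t)) (is_derive_sin t))).
by apply: (is_derive_eq H); rewrite sub0r.
Qed.

Local Notation cn := (fun x => cn x k).
Definition cn' x := - (sin (am x) * dn x).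

Lemma is_derive_cn x : is_derive x 1 cn (cn' x).
Proof.
have := is_derive1_comp (is_derive_cos (am x)) (is_derive_am x).
by rewrite mulNr.
Qed.

Lemma continuous_cn : continuous cn.
Proof. exact: is_derive_continuous is_derive_cn. Qed.

Lemma is_derive_dn x : is_derive x 1 dn (- k ^+ 2 * sin (am x) * cos (am x)).
Proof.
have dD : is_derive x 1 (fun y => ellDelta (am y)) _ :=
  is_derive1_comp (is_derive_ellDelta (am x)) (is_derive_am x).
have H := is_derive_chain dD (is_derive1_sqrt (ellDelta_gt0 (am x))).
apply: (is_derive_eq H); rewrite -/(dn x); field.
by rewrite gt_eqF// dn_gt0.
Qed.

Lemma cn'_sqr x : cn' x ^+ 2 = (1 - cn x ^+ 2) * (1 - k ^+ 2 + k ^+ 2 * cn x ^+ 2).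
Proof.
rewrite sqrrN exprMn dn_sqr /Defs.cn.
have := cos2Dsin2 (am x); set c := cos _ ^+ 2; set s := sin _ ^+ 2 => E.
have -> : c = 1 - s by rewrite -E; ring.
ring.
Qed.

Lemma is_derive_cn' x : is_derive x 1 cn' (- cn x * (1 - 2 * k ^+ 2 + 2 * k ^+ 2 * cn x ^+ 2)).
Proof.
have H := is_deriveN (is_deriveM (is_derive1_comp (is_derive_sin (am x)) (is_derive_am x)) (is_derive_dn x)).
apply: (is_derive_eq H); rewrite /= /GRing.scale/= /Defs.cn.
have := dn_sqr x; have := cos2Dsin2 (am x).
rewrite /=; set c := cos _; set s := sin _; set d := dn _ => E D.
have -> : - (s * (- k ^+ 2 * s * c) + d * (c * d)) = - (c * d ^+ 2 - k ^+ 2 * c * s ^+ 2) by ring.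
rewrite D (_ : s ^+ 2 = 1 - c ^+ 2); last by rewrite -E; ring.
by ring.
Qed.

Lemma cn0 : cn 0 = 1.
Proof. by rewrite /Defs.cn am0 cos0. Qed.

Lemma cn_add2K x : cn (x + 2 * K) = - cn x.
Proof. by rewrite /Defs.cn am_add2K cosDpi. Qed.

Lemma cn'_add2K x : cn' (x + 2 * K) = - cn' x.
Proof. by rewrite /cn' /dn am_add2K sinDpi /ellDelta sinDpi sqrrN mulNr. Qed.

Lemma cn'0 : cn' 0 = 0.
Proof. by rewrite /cn' am0 sin0 mul0r oppr0. Qed.

Lemma cn_bound x : -1 <= cn x <= 1.
Proof. by rewrite cos_geN1 cos_le1. Qed.

Lemma cn'_le0 x : 0 <= x <= 2 * K -> cn' x <= 0.
Proof.
move=> /andP[x0 x2]; rewrite oppr_le0 mulr_ge0 ?(ltW (dn_gt0 _))// sin_ge0_pi//.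
by rewrite -{1}am0 -am2K !am_mono x0 x2.
Qed.

(** Below 4 K the amplitude lies strictly between 0 and 2 pi, where cos differs from 1; the part
    beyond pi is reflected to the injectivity range of cos. This makes the period of cn
    fundamental. *)
Lemma cn_eq1 x : 0 < x -> cn x = 1 -> 4 * K <= x.
Proof.
move=> x0 cx; rewrite leNgt; apply/negP => x4.
have a0 : 0 < am x by rewrite -am0 (leW_mono am_mono).
have a2 : am x < pi *+ 2.
  have -> : pi *+ 2 = am (2 * K + 2 * K) by rewrite am_add2K am2K mulr2n.
  by rewrite (leW_mono am_mono) -mulrDl (_ : 2 + 2 = 4)//; ring.
have in_pi (a : R) : 0 < a -> a <= pi -> cos a = 1 -> False.
  move=> a_gt0 a_pi ca; suff : a = 0 by lra.
  by apply: cos_inj; [rewrite in_itv/= ltW|rewrite in_itv/= lexx pi_ge0|rewrite ca cos0].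
have [api|pia] := leP (am x) pi; first exact: (in_pi (am x)).
apply: (in_pi (- am x + pi *+ 2)).
- by rewrite addrC subr_gt0.
- by rewrite mulr2n; lra.
- by rewrite cosD2pi cosN.
Qed.

(** Substitute t = am (c x). The amplitude runs from 0 to am (4 K) = 2 pi, which is four
    quarter-periods of the even, pi-periodic integrand. *)
Lemma integral_cn_pow (p : nat) (c : R) : 0 < c ->
  \int[mu]_(x in `[0, 4 * K / c]) cn (c * x) ^+ p.*2 = 4 / c * ellI p.
Proof.
move=> c0.
pose H := primitive (weighted_integrand p).
have dH (y : R) : is_derive y 1 (fun x => c^-1 * H (am (c * x))) (cn (c * y) ^+ p.*2).
  have dc : is_derive y 1 (fun x : R => c * x) (c * 1) := is_deriveZ c (is_derive_id y 1).
  have dP := primitive_is_derive (continuous_weighted_integrand (p := p)) (am (c * y)).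
  have E := is_deriveZ c^-1 (is_derive_chain dc (is_derive_chain (is_derive_am (c * y)) dP)).
  apply: (is_derive_eq E); rewrite /GRing.scale/= /weighted_integrand ellF_integrandE -/(dn _) -/(Defs.cn _ k).
  field.
  by rewrite !gt_eqF ?dn_gt0.
have cc : continuous (fun x => cn (c * x) ^+ p.*2).
  move=> x; apply: (@continuous_comp _ _ _ (fun x => cn (c * x)) (fun y => y ^+ p.*2)); last exact: exprn_continuous.
  apply: (@continuous_comp _ _ _ (fun x : R => c * x) cn); last exact: continuous_cn.
  by apply: cvgMr; exact: cvg_id.
rewrite (FTC2_itv _ cc dH); last first.
  by rewrite divr_ge0// ?(ltW c0)// mulr_ge0// ltW// ellK_gt0.
rewrite mulr0 am0 [H 0]primitive0 mulr0 subr0 [c * _]mulrC divfK ?gt_eqF//.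
have -> : am (4 * K) = 2 * pi.
  by rewrite (_ : 4 * K = 2 * K + 2 * K) ?am_add2K ?am2K; ring.
rewrite /H primitive_2pi.
- by rewrite primitive_ellI; field; rewrite gt_eqF.
- exact: continuous_weighted_integrand.
- exact: weighted_integrand_even.
- exact: weighted_integrand_pi.
Qed.

End JacobiFunctions.

(** * The sharp inequality for real functions *)

Section Periodicity.
Variables (R : realType) (L : R).
Hypothesis L_gt0 : 0 < L.

(** |f| has period L, so a shift by the integer part of (x - y) / L suffices. *)
Lemma antiperiodic_reduce (f : R -> R) x y : (forall z, f (z + L) = - f z) ->
  exists2 z, y <= z <= y + L & `|f x| = `|f z|.
Proof.
move=> fL.
have shift_nat (n : nat) z : `|f (z + n%:R * L)| = `|f z|.
  elim: n => [|n IH]; first by rewrite mul0r addr0.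
  by rewrite -IH -[in RHS]normrN -fL; congr (`|f _|); rewrite -natr1; ring.
have shift_int (n : int) z : `|f (z + n%:~R * L)| = `|f z|.
  case: n => n; first exact: shift_nat.
  by rewrite NegzE mulrNz mulNr -[LHS](shift_nat n.+1) subrK.
exists (x - (Num.floor ((x - y) / L))%:~R * L).
  have := floor_le ((x - y) / L); have := lt_succ_floor ((x - y) / L).
  rewrite ltr_pdivrMr// ler_pdivlMr// intrD mulrDl mul1r; lra.
by rewrite -mulNr -intrN shift_int.
Qed.

Lemma antiperiodic_max (f : R -> R) : continuous f -> (forall z, f (z + L) = - f z) ->
  exists2 x0, 0 <= x0 <= L & forall x, `|f x| <= `|f x0|.
Proof.
move=> cf fL.
have cn : continuous (fun x => `|f x|) by move=> x; apply: cvg_norm; exact: cf.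
have [x0 x0L xmax] := EVT_max (ltW L_gt0) (continuous_subspaceT cn).
exists x0; first by move: x0L; rewrite in_itv.
move=> x; have [z zL ->] := antiperiodic_reduce x 0 fL.
by apply: xmax; rewrite in_itv/= -[X in _ <= _ <= X]add0r.
Qed.

Lemma antiperiodic_eq (f g : R -> R) y : (forall z, f (z + L) = - f z) ->
  (forall z, g (z + L) = - g z) -> (forall z, y <= z <= y + L -> f z = g z) ->
  forall x, f x = g x.
Proof.
move=> fL gL fg x.
have dL z : f (z + L) - g (z + L) = - (f z - g z) by rewrite fL gL; ring.
have [z zL] := antiperiodic_reduce (f := fun z => f z - g z) x y dL.
by rewrite (fg z zL) subrr normr0 => /eqP; rewrite normr_eq0 subr_eq0 => /eqP.
Qed.

End Periodicity.

Section LastHit.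
Variable R : realType.

(** The supremum of the hitting times is itself a hitting time by continuity. This isolates a
    stretch on which a solution has just left an extremum. *)
Lemma last_hit (f : R -> R) a b c : continuous f -> a <= b -> f a = c ->
  exists2 p, a <= p <= b & f p = c /\ forall t, p < t <= b -> f t != c.
Proof.
move=> cf ab fa.
pose S := [set t | a <= t <= b /\ f t = c].
have Sa : S a by split; [rewrite lexx|].
have Sb : ubound S b by move=> x [/andP[]].
have hS : has_sup S by split; [exists a|exists b].
have ap : a <= sup S by apply: ub_le_sup => //; exists b.
have pb : sup S <= b by apply: sup_le_ub => //; exists a.
exists (sup S); first by rewrite ap.
split; last first.
  move=> t /andP[pt tb]; apply/eqP => ft.
  have : t <= sup S by apply: ub_le_sup; [exists b|split=> //; lra].
  by rewrite leNgt pt.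
apply: contrapT => /eqP fpc.
have fpc0 : 0 < `|f (sup S) - c| by rewrite normr_gt0 subr_eq0.
have /cvgrPdist_lt/(_ _ fpc0)/nbhs_ballP[d /= d0 Hd] := cf (sup S).
have [t St td] := sup_adherent d0 hS.
have tS : t <= sup S by apply: ub_le_sup => //; exists b.
have /Hd : ball (sup S) d t by rewrite /ball/= ltr_norml; lra.
by rewrite /= St.2 ltxx.
Qed.

Lemma first_hit (f : R -> R) a b c : continuous f -> a <= b -> f b = c ->
  exists2 q, a <= q <= b & f q = c /\ forall t, a <= t < q -> f t != c.
Proof.
move=> cf ab fb.
have cf' : continuous (fun x => f (- x)).
  by move=> x; apply: (@continuous_comp _ _ _ (fun x : R => - x) f); [apply: cvgN; exact: cvg_id|exact: cf].
have [||p pab [fp H]] := @last_hit (fun x => f (- x)) (- b) (- a) c cf'.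
- by rewrite lerN2.
- by rewrite opprK.
exists (- p); first by lra.
split => // t tap; have := H (- t); rewrite opprK; apply; lra.
Qed.

End LastHit.

(** * Calibration and the case of equality at a fixed modulus *)

Section SharpInequality.
Variables (R : realType) (k T : R).
Hypothesis k01 : 0 < k < 1.
Hypothesis T_gt0 : 0 < T.
Implicit Types (f h : R -> R) (x y s t : R).
Local Notation mu := (@lebesgue_measure R).

Definition kappa := 4 * ellK k / T.
Definition cnT x := cn (kappa * x) k.
Definition cnT' x := kappa * cn' k (kappa * x).
(* cnT satisfies cnT'^2 = cn_pot cnT and cnT'' = - cn_lin cnT - 2 kappa^2 k^2 cnT^3. *)
Definition cn_lin := kappa ^+ 2 * (1 - 2 * k ^+ 2).
Definition cn_pot s := kappa ^+ 2 * ((1 - s ^+ 2) * (1 - k ^+ 2 + k ^+ 2 * s ^+ 2)).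
Definition cn_speed s := Num.sqrt (cn_pot s).
Definition cn_mass := \int[mu]_(x in `[0, T]) (cnT x ^+ 2).
Definition cn_quartic := \int[mu]_(x in `[0, T]) (cnT x ^+ 4).
(** Chosen so that cnT itself gives equality: [cn_coef] times the root of [cn_quartic] is the
    quartic term of [cnT_virial]. *)
Definition cn_coef := 2 * kappa ^+ 2 * k ^+ 2 * Num.sqrt cn_quartic.

Lemma kappa_gt0 : 0 < kappa.
Proof. by rewrite divr_gt0// mulr_gt0// ellK_gt0. Qed.

Lemma kappa_half : kappa * (T / 2) = 2 * ellK k.
Proof. by rewrite /kappa; field; rewrite gt_eqF. Qed.

Lemma cnT_anti x : cnT (x + T / 2) = - cnT x.
Proof. by rewrite /cnT mulrDr kappa_half cn_add2K. Qed.

Lemma is_derive_scale (c x : R) : is_derive x 1 (fun y => c * y) c.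
Proof. by have := is_deriveZ c (is_derive_id x (1 : R)); rewrite /GRing.scale/= mulr1. Qed.

Lemma is_derive_cnT x : is_derive x 1 cnT (cnT' x).
Proof.
have := is_derive_chain (is_derive_scale kappa x) (is_derive_cn k01 (kappa * x)).
by rewrite mulrC.
Qed.

Lemma is_derive_cnT' x :
  is_derive x 1 cnT' (- (cn_lin * cnT x + 2 * kappa ^+ 2 * k ^+ 2 * cnT x ^+ 3)).
Proof.
have H := is_deriveZ kappa (is_derive_chain (is_derive_scale kappa x) (is_derive_cn' k01 (kappa * x))).
by apply: (is_derive_eq H); rewrite /GRing.scale/= /cn_lin /cnT; ring.
Qed.

Lemma continuous_cnT : continuous cnT.
Proof. exact: is_derive_continuous is_derive_cnT. Qed.

Lemma continuous_cnT' : continuous cnT'.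
Proof. exact: is_derive_continuous is_derive_cnT'. Qed.

Lemma is_primitive_cnT : is_primitive cnT cnT'.
Proof. exact: derive_is_primitive continuous_cnT' is_derive_cnT. Qed.

Lemma cnT'_sqr x : cnT' x ^+ 2 = cn_pot (cnT x).
Proof. by rewrite exprMn cn'_sqr. Qed.

Lemma cnT_bound x : `|cnT x| <= 1.
Proof. by rewrite ler_norml cn_bound. Qed.

Lemma cn_pot_ge0 s : `|s| <= 1 -> 0 <= cn_pot s.
Proof.
move=> s1; have s2 : s ^+ 2 <= 1 by rewrite -real_normK ?num_real// expr_le1.
have [k0 k1] : 0 < k /\ k < 1 by apply/andP.
have k2 : k ^+ 2 < 1 by rewrite expr_lt1// ltW.
rewrite mulr_ge0 ?sqr_ge0// mulr_ge0 ?subr_ge0// addr_ge0 ?subr_ge0 ?(ltW k2)//.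
by rewrite -exprMn sqr_ge0.
Qed.

Lemma cn_speed_sqr s : `|s| <= 1 -> cn_speed s ^+ 2 = cn_pot s.
Proof. by move=> s1; rewrite sqr_sqrtr// cn_pot_ge0. Qed.

Lemma continuous_cn_pot : continuous cn_pot.
Proof.
move=> s; apply: cvgMr; apply: cvgM.
  by apply: cvgB; [exact: cvg_cst|exact: exprn_continuous].
by apply: cvgD; [exact: cvg_cst|apply: cvgMr; exact: exprn_continuous].
Qed.

Lemma continuous_cn_speed : continuous cn_speed.
Proof.
by move=> s; apply: continuous_comp; [exact: continuous_cn_pot|exact: sqrt_continuous].
Qed.

Local Notation G := (primitive cn_speed).
(** The integral of [cn_speed] over [-1, 1], that is the action of one swing between the extrema. *)
Definition cn_gap := G 1 - G (- 1).

Lemma is_derive_G s : is_derive s 1 G (cn_speed s).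
Proof.
by apply: is_primitive_derive; [exact/primitiveP/continuous_itv_integrable/continuous_cn_speed|exact: continuous_cn_speed].
Qed.

Lemma continuous_pow f (n : nat) : continuous f -> continuous (fun x => f x ^+ n).
Proof.
by move=> cf x; apply: (@continuous_comp _ _ _ f (fun y => y ^+ n)); [exact: cf|exact: exprn_continuous].
Qed.

(** The cross term h * [cn_speed] (f) is the derivative of G (f), so only the endpoint values of f
    survive. *)
Lemma complete_square f h s a b : is_primitive f h -> itv_integrable (fun x => h x ^+ 2) ->
  s ^+ 2 = 1 -> (forall x, `|f x| <= 1) -> a <= b ->
  \int[mu]_(x in `[a, b]) ((h x - s * cn_speed (f x)) ^+ 2) =
  \int[mu]_(x in `[a, b]) (h x ^+ 2) + \int[mu]_(x in `[a, b]) cn_pot (f x)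
  - 2 * s * (G (f b) - G (f a)).
Proof.
move=> fh h2 s2 f1 ab.
have cf := is_primitive_continuous fh.
have [GI GE] := is_primitive_comp fh continuous_cn_speed is_derive_G.
have iP : itv_integrable (fun x => cn_pot (f x)).
  by apply: continuous_itv_integrable => x; apply: continuous_comp; [exact: cf|exact: continuous_cn_pot].
rewrite GE// -itv_integralD// -itv_integralZ// -itv_integralB//; first last.
- exact: itv_integrableZ.
- exact: itv_integrableD.
apply: eq_itv_integral => x _.
rewrite -(cn_speed_sqr (f1 x)) -[X in _ = _ + X - _]mul1r -[X in X * _ ^+ 2]s2; ring.
Qed.

Lemma itv_integrable_cn_pot f : continuous f -> itv_integrable (fun x => cn_pot (f x)).
Proof.
by move=> cf; apply: continuous_itv_integrable => x; apply: continuous_comp; [exact: cf|exact: continuous_cn_pot].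
Qed.

Lemma half_period_double : T / 2 + T / 2 = T.
Proof. by field. Qed.

Section Calibration.
Variables (f h : R -> R) (x0 : R).
Hypothesis fh : is_primitive f h.
Hypothesis h2 : itv_integrable (fun x => h x ^+ 2).
Hypothesis f1 : forall x, `|f x| <= 1.
Hypothesis fL : forall x, f (x + T / 2) = - f x.
Hypothesis x0L : 0 <= x0 <= T / 2.
Hypothesis fx0 : f x0 = 1.

(* Complete the square in h -/+ cn_speed (f) with signs -, +, - on [0, x0], [x0, x0 + T/2],
   [x0 + T/2, T]: the cross terms are increments of the primitive of cn_speed along f, and
   they add up to 4 cn_gap for every f. *)
Lemma calibration :
  \int[mu]_(x in `[x0, x0 + T / 2]) ((h x + cn_speed (f x)) ^+ 2) <=
  \int[mu]_(x in `[0, T]) (h x ^+ 2) + \int[mu]_(x in `[0, T]) cn_pot (f x) - 4 * cn_gap.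
Proof.
have ip := itv_integrable_cn_pot (is_primitive_continuous fh).
have [x00 x0L'] : 0 <= x0 /\ x0 <= T / 2 by apply/andP.
have i1 : x0 <= x0 + T / 2 by lra.
have i2 : x0 + T / 2 <= T by lra.
have i3 : x0 <= T by lra.
have s1 : (1 : R) ^+ 2 = 1 by rewrite expr1n.
have sN1 : (-1 : R) ^+ 2 = 1 by rewrite sqrrN expr1n.
have E1 := complete_square fh h2 s1 f1 x00.
have E2 := complete_square fh h2 sN1 f1 i1.
have E3 := complete_square fh h2 s1 f1 i2.
have N1 : 0 <= \int[mu]_(x in `[0, x0]) ((h x - 1 * cn_speed (f x)) ^+ 2).
  by apply: Rintegral_ge0 => x _; exact: sqr_ge0.
have N3 : 0 <= \int[mu]_(x in `[x0 + T / 2, T]) ((h x - 1 * cn_speed (f x)) ^+ 2).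
  by apply: Rintegral_ge0 => x _; exact: sqr_ge0.
rewrite (integral_itv_cat x00 i3 h2) (integral_itv_cat i1 i2 h2).
rewrite (integral_itv_cat x00 i3 ip) (integral_itv_cat i1 i2 ip).
have -> : \int[mu]_(x in `[x0, x0 + T / 2]) ((h x + cn_speed (f x)) ^+ 2) =
  \int[mu]_(x in `[x0, x0 + T / 2]) ((h x - -1 * cn_speed (f x)) ^+ 2).
  by apply: eq_itv_integral => x _; rewrite mulN1r opprK.
have fT : f T = f 0.
  by rewrite -[X in f X]half_period_double -[X in X + _]add0r !fL opprK.
move: N1 N3; rewrite E1 E2 E3 fL fx0 fT /cn_gap.
move: (Rintegral mu `[0, x0] _) (Rintegral mu `[0, x0] _).
move: (Rintegral mu `[x0, x0 + T / 2] _) (Rintegral mu `[x0, x0 + T / 2] _).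
move: (Rintegral mu `[x0 + T / 2, T] _) (Rintegral mu `[x0 + T / 2, T] _).
move: (G 1) (G (-1)) (G (f 0)); clear E1 E2 E3 => *; lra.
Qed.

End Calibration.

Lemma itv_integrable_cnT'_sqr : itv_integrable (fun x => cnT' x ^+ 2).
Proof. exact/continuous_itv_integrable/continuous_pow/continuous_cnT'. Qed.

(** [cn_speed] at cnT is |cnT'|, so there is no remainder on an interval where s is the sign of
    cnT'. *)
Lemma cnT'_speed s a b : a <= b -> s ^+ 2 = 1 -> (forall x, a <= x <= b -> 0 <= s * cnT' x) ->
  \int[mu]_(x in `[a, b]) ((cnT' x - s * cn_speed (cnT x)) ^+ 2) = 0.
Proof.
move=> ab s2 H; rewrite (eq_itv_integral (g := fun=> 0)) ?itv_integral_cst ?mul0r//.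
move=> x /H sx; suff -> : cn_speed (cnT x) = s * cnT' x.
  by rewrite mulrA -expr2 s2 mul1r subrr expr0n.
rewrite /cn_speed -cnT'_sqr (_ : cnT' x ^+ 2 = (s * cnT' x) ^+ 2); last by rewrite [RHS]exprMn s2 mul1r.
by rewrite sqrtr_sqr ger0_norm.
Qed.

Lemma cnT'_anti x : cnT' (x + T / 2) = - cnT' x.
Proof. by rewrite /cnT' mulrDr kappa_half cn'_add2K// mulrN. Qed.

Lemma cnT'_le0 x : 0 <= x <= T / 2 -> cnT' x <= 0.
Proof.
move=> /andP[x0 xT]; have k0 := kappa_gt0.
by rewrite pmulr_rle0// cn'_le0// mulr_ge0 ?(ltW k0)//= -kappa_half ler_pM2l.
Qed.

Lemma cnT_0 : cnT 0 = 1.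
Proof. by rewrite /cnT mulr0 cn0. Qed.

Lemma cnT'_0 : cnT' 0 = 0.
Proof. by rewrite /cnT' mulr0 cn'0 ?mulr0. Qed.

(** cnT falls from 1 to -1 on the first half-period and rises back on the second; with the matching
    signs both completed squares vanish. *)
Lemma cnT_calibrated :
  \int[mu]_(x in `[0, T]) (cnT' x ^+ 2) + \int[mu]_(x in `[0, T]) cn_pot (cnT x) = 4 * cn_gap.
Proof.
have ip := itv_integrable_cn_pot continuous_cnT.
have h2 := itv_integrable_cnT'_sqr.
have i1 : 0 <= T / 2 by rewrite divr_ge0// ltW.
have i2 : T / 2 <= T by rewrite -[leRHS]half_period_double lerDl.
have s1 : (1 : R) ^+ 2 = 1 by rewrite expr1n.
have sN1 : (-1 : R) ^+ 2 = 1 by rewrite sqrrN expr1n.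
have k0 := kappa_gt0.
have E1 := complete_square is_primitive_cnT h2 sN1 cnT_bound i1.
have E2 := complete_square is_primitive_cnT h2 s1 cnT_bound i2.
rewrite cnT'_speed// in E1; last first.
  by move=> x xT; rewrite mulN1r oppr_ge0 cnT'_le0.
rewrite cnT'_speed// in E2; last first.
  move=> x xT; rewrite mul1r -[x](subrK (T / 2)) cnT'_anti oppr_ge0 cnT'_le0//.
  by move: xT; rewrite lerBrDr add0r lerBlDr half_period_double.
rewrite (integral_itv_cat i1 i2 h2) (integral_itv_cat i1 i2 ip).
have cTL : cnT (T / 2) = -1 by rewrite -[T / 2]add0r cnT_anti cnT_0.
have cTT : cnT T = 1 by rewrite -[X in cnT X]half_period_double cnT_anti cTL opprK.
move: E1 E2; rewrite cnT_0 cTL cTT /cn_gap.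
move: (Rintegral mu `[0, T / 2] _) (Rintegral mu `[0, T / 2] _).
move: (Rintegral mu `[T / 2, T] _) (Rintegral mu `[T / 2, T] _).
move: (G 1) (G (-1)) => *; lra.
Qed.

(* Multiply the equation for cnT by cnT and integrate over a period. *)
Lemma cnT_virial :
  \int[mu]_(x in `[0, T]) (cnT' x ^+ 2) =
  cn_lin * cn_mass + 2 * kappa ^+ 2 * k ^+ 2 * cn_quartic.
Proof.
pose h x := cnT' x ^+ 2 - (cn_lin * cnT x ^+ 2 + 2 * kappa ^+ 2 * k ^+ 2 * cnT x ^+ 4).
have dh x : is_derive x 1 (fun y => cnT y * cnT' y) (h x).
  have H := is_deriveM (is_derive_cnT x) (is_derive_cnT' x).
  by apply: (is_derive_eq H); rewrite /GRing.scale/= /h; ring.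
have i2 := continuous_itv_integrable (continuous_pow (n := 2) continuous_cnT).
have i4 := continuous_itv_integrable (continuous_pow (n := 4) continuous_cnT).
have id := itv_integrable_cnT'_sqr.
have ch : continuous h.
  move=> x; apply: cvgB; first exact: (continuous_pow (n := 2) continuous_cnT').
  apply: cvgD; apply: cvgMr; [exact: (continuous_pow (n := 2) continuous_cnT)|exact: (continuous_pow (n := 4) continuous_cnT)].
have := FTC2_itv (ltW T_gt0) ch dh.
have cT' : cnT' T = 0.
  by rewrite -[X in cnT' X]half_period_double -[X in X + _]add0r !cnT'_anti cnT'_0 !oppr0.
rewrite cT' cnT'_0 !mulr0 subrr /h.
have iZ2 := itv_integrableZ cn_lin i2.
have iZ4 := itv_integrableZ (2 * kappa ^+ 2 * k ^+ 2) i4.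
rewrite itv_integralB//; last exact: itv_integrableD.
rewrite itv_integralD// !itv_integralZ// => /eqP.
by rewrite subr_eq0 => /eqP.
Qed.

Lemma integral_cn_pot f : continuous f ->
  \int[mu]_(x in `[0, T]) cn_pot (f x) = kappa ^+ 2 * (1 - k ^+ 2) * T
    - cn_lin * \int[mu]_(x in `[0, T]) (f x ^+ 2)
    - kappa ^+ 2 * k ^+ 2 * \int[mu]_(x in `[0, T]) (f x ^+ 4).
Proof.
move=> cf.
have i2 := continuous_itv_integrable (continuous_pow (n := 2) cf).
have i4 := continuous_itv_integrable (continuous_pow (n := 4) cf).
have i0 : itv_integrable (fun=> kappa ^+ 2 * (1 - k ^+ 2)).
  by apply: continuous_itv_integrable => x; exact: cvg_cst.
have iZ2 := itv_integrableZ cn_lin i2.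
have iZ4 := itv_integrableZ (kappa ^+ 2 * k ^+ 2) i4.
rewrite -[X in _ * X - _ - _]subr0 -itv_integral_cst ?(ltW T_gt0)//.
rewrite -!itv_integralZ// -!itv_integralB//; last exact: itv_integrableB.
by apply: eq_itv_integral => x _; rewrite /cn_pot /cn_lin; ring.
Qed.

(** [cnT_calibrated] replaces 4 [cn_gap] by integrals of cnT. The constant terms of the two
    potentials cancel, and [cnT_virial] removes the mass of cnT, leaving only its quartic
    integral. *)
Lemma normalized_inequality f h x0 : is_primitive f h -> itv_integrable (fun x => h x ^+ 2) ->
  (forall x, `|f x| <= 1) -> (forall x, f (x + T / 2) = - f x) -> 0 <= x0 <= T / 2 -> f x0 = 1 ->
  \int[mu]_(x in `[x0, x0 + T / 2]) ((h x + cn_speed (f x)) ^+ 2) <=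
  \int[mu]_(x in `[0, T]) (h x ^+ 2) - cn_lin * \int[mu]_(x in `[0, T]) (f x ^+ 2)
  - kappa ^+ 2 * k ^+ 2 * (\int[mu]_(x in `[0, T]) (f x ^+ 4) + cn_quartic).
Proof.
move=> fh h2 f1 fL x0L fx0.
have := calibration fh h2 f1 fL x0L fx0.
rewrite -cnT_calibrated cnT_virial (integral_cn_pot (is_primitive_continuous fh)).
rewrite (integral_cn_pot continuous_cnT) -/cn_mass -/cn_quartic.
move: (Rintegral mu `[x0, x0 + T / 2] _) (Rintegral mu `[0, T] _) (Rintegral mu `[0, T] _) (Rintegral mu `[0, T] _) => I1 I2 I3 I4.
move: cn_mass cn_quartic cn_lin kappa => m q l a.
by move=> /le_trans; apply; rewrite le_eqVlt; apply/orP; left; apply/eqP; ring.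
Qed.

Lemma continuous_within_acos : {within `[-1, 1], continuous (@acos R)}.
Proof.
have cc : {within `[0, pi], continuous (@cos R)} by apply: continuous_subspaceT; exact: continuous_cos.
have := segment_can_continuous (pi_ge0 R) cc (@cosK R).
by rewrite cos0 cospi /= min_r ?max_l//; lra.
Qed.

(** The inverse of cnT on its falling half-period [0, T / 2]: the time at which it reaches s. *)
Definition cnT_inv s := kappa^-1 * ellF (acos s) k.

Lemma cnT_inv1 : cnT_inv 1 = 0.
Proof. by rewrite /cnT_inv acos1 ellF0 mulr0. Qed.

Lemma cnT_invN1 : cnT_inv (-1) = T / 2.
Proof.
rewrite /cnT_inv acosN1 -[pi]add0r ellF_addpi// ellF0 add0r -kappa_half.
by rewrite mulKf// gt_eqF// kappa_gt0.
Qed.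

Lemma cnT_invK s : -1 <= s <= 1 -> cnT (cnT_inv s) = s.
Proof.
move=> s1; rewrite /cnT /cnT_inv mulVKf ?gt_eqF ?kappa_gt0// /cn ellFK// acosK// in_itv.
Qed.

(** The endpoints are excluded because [cn_speed] vanishes there. *)
Lemma is_derive_cnT_inv s : -1 < s < 1 -> is_derive s 1 cnT_inv (- (cn_speed s)^-1).
Proof.
move=> s1; have k0 := kappa_gt0.
have s2 : 0 < 1 - s ^+ 2 by nra.
have H := is_deriveZ kappa^-1 (is_derive_chain (is_derive1_acos s1) (is_derive_ellF k01 (acos s))).
apply: (is_derive_eq H); rewrite /GRing.scale/= ellF_integrandE.
have Delta : ellDelta k (acos s) = 1 - k ^+ 2 + k ^+ 2 * s ^+ 2.
  rewrite /ellDelta sin_acos; last by lra.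
  by rewrite sqr_sqrtr ?(ltW s2)//; ring.
have D0 := ellDelta_gt0 k01 (acos s).
rewrite /cn_speed /cn_pot -Delta sqrtrM ?sqr_ge0// sqrtr_sqr gtr0_norm// sqrtrM ?(ltW s2)//.
by field; rewrite !gt_eqF ?sqrtr_gt0.
Qed.

Lemma continuous_cnT_inv_comp f : continuous f -> (forall x, `|f x| <= 1) ->
  continuous (fun x => cnT_inv (f x)).
Proof.
move=> cf f1 x; apply: cvgMr.
apply: (@continuous_comp _ _ _ (fun y => acos (f y)) (fun t => ellF t k)); last exact: continuous_ellF.
have /subspace_continuousP/(_ (f x)) := continuous_within_acos.
rewrite /= in_itv/= -ler_norml => /(_ (f1 x)) ca.
have fw : f y @[y --> x] --> within `[-1, 1]%classic (nbhs (f x)).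
  move=> W HW; have HWx : nbhs x (f @^-1` (fun s => `[-1, 1]%classic s -> W s)) := cf x _ HW.
  by apply: filterS HWx => y /=; apply; rewrite in_itv/= -ler_norml.
exact: cvg_comp fw ca.
Qed.

Lemma normalized_equality f h x0 : is_primitive f h -> itv_integrable (fun x => h x ^+ 2) ->
  (forall x, `|f x| <= 1) -> (forall x, f (x + T / 2) = - f x) -> f x0 = 1 ->
  \int[mu]_(x in `[x0, x0 + T / 2]) ((h x + cn_speed (f x)) ^+ 2) = 0 ->
  forall x, f x = cnT (x - x0).
Proof.
move=> fh h2 f1 fL fx0 res0.
have cf := is_primitive_continuous fh.
pose b := x0 + T / 2.
have x0b : x0 < b by rewrite /b ltrDl divr_gt0.
have fb : f b = -1 by rewrite /b fL fx0.
have cv : continuous (fun x => cn_speed (f x)).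
  by move=> x; apply: continuous_comp; [exact: cf|exact: continuous_cn_speed].
have iv := continuous_itv_integrable cv.
have mh := itv_integrable_measurable fh.1.
have mv := itv_integrable_measurable iv.
(* A square with zero integral vanishes almost everywhere. *)
have hv : {ae mu, forall x, `[x0, b]%classic x -> h x = -1 * cn_speed (f x)}.
  have i2 : itv_integrable (fun x => (h x + cn_speed (f x)) ^+ 2).
    have ihv := itv_integrableMr_cont cv fh.1.
    have iv2 := continuous_itv_integrable (continuous_pow (n := 2) cv).
    have := itv_integrableD (itv_integrableD h2 (itv_integrableZ 2 ihv)) iv2.
    by congr itv_integrable; apply/funext => x; ring.
  have := integral_sqr_eq0 i2 (measurable_funD mh mv) res0.
  by apply: ae_mono => x H /H/eqP; rewrite addr_eq0 mulN1r => /eqP.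
have incr x y : x0 <= x -> x <= y -> y <= b -> f y - f x = - \int[mu]_(z in `[x, y]) cn_speed (f z).
  move=> x0x xy yb; rewrite fh.2// -mulN1r -itv_integralZ//.
  apply: ae_eq_itv_integral => //; first exact: measurable_funM.
  by apply: ae_mono hv => z H; rewrite /= in_itv/= => zxy; apply: H; rewrite /= in_itv/=; lra.
have mono x y : x0 <= x -> x <= y -> y <= b -> f y <= f x.
  move=> x0x xy yb; rewrite -subr_ge0 -opprB incr// opprK.
  by apply: Rintegral_ge0 => z _; exact: sqrtr_ge0.
(* The almost everywhere equation exhibits f as the integral of a continuous function, so it holds
   at every interior point. *)
have df x : x0 < x < b -> is_derive x 1 f (- cn_speed (f x)).
  move=> xb.
  have pV := primitiveP iv; set V := primitive _ in pV.
  have dV := is_deriveB (is_derive_cst (f x0 + V x0) x 1) (is_primitive_derive pV (cv x)).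
  rewrite sub0r in dV; move: dV; apply: near_eq_is_derive.
  have : x \in `]x0, b[ by rewrite in_itv.
  move=> /near_in_itvoo; apply: filterS => y; rewrite in_itv/= => /andP[yx0 yb].
  have := incr x0 y (lexx _) (ltW yx0) (ltW yb); rewrite -pV.2 ?(ltW yx0)// => E.
  rewrite [LHS](_ : _ = f x0 + V x0 - V y)//.
  by move/eqP: E; rewrite subr_eq => /eqP ->; ring.
(* f solves f' = - cn_speed f, which is degenerate where |f| = 1. In the variable H the speed is 1,
   so passing from f = 1 to f = -1 takes exactly T / 2 and f never rests at the ends. *)
pose H x := cnT_inv (f x).
have cH : continuous H by exact: continuous_cnT_inv_comp.
have dH x : x0 < x < b -> -1 < f x < 1 -> is_derive x 1 H 1.
  move=> xb fx; have E := is_derive_chain (df x xb) (is_derive_cnT_inv fx).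
  apply: (is_derive_eq E); rewrite mulrNN mulVf// gt_eqF// sqrtr_gt0.
  have k0 := kappa_gt0.
  have [kk0 kk1] : 0 < k /\ k < 1 by apply/andP.
  have k2 : k ^+ 2 < 1 by rewrite expr_lt1// ltW.
  rewrite mulr_gt0 ?exprn_gt0// mulr_gt0//; first by nra.
  by rewrite ltr_pwDl ?subr_gt0// -exprMn sqr_ge0.
have mvt x y : x0 <= x -> x <= y -> y <= b -> (forall t, x < t < y -> -1 < f t < 1) -> H y - H x = y - x.
  move=> x0x xy yb ft.
  have [||t _ ->] := @MVT_segment _ H (fun=> 1) x y xy; last by rewrite mul1r.
    move=> t; rewrite in_itv/= => txy; apply: dH; last exact: ft.
    by lra.
  exact: continuous_subspaceT.
have [y0 y0b fy0] : exists2 y, y \in `[x0, b] & f y = 0.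
  apply: IVT; [exact: ltW|exact: continuous_subspaceT|].
  by rewrite fx0 fb min_r ?max_l; lra.
rewrite in_itv/= in y0b; have [x0y0 y0b'] : x0 <= y0 /\ y0 <= b by apply/andP.
(* Around a zero y0 of f, take the last time at 1 before it and the first time at -1 after it. By
   monotonicity |f| < 1 strictly between them, where H is differentiable. *)
have [p /andP[x0p py0] [fp pmax]] := last_hit cf x0y0 fx0.
have [q /andP[y0q qb] [fq qmin]] := first_hit cf y0b' fb.
have pq : p <= q by exact: le_trans y0q.
have bnd t : p < t < q -> -1 < f t < 1.
  move=> /andP[pt tq]; have := f1 t; rewrite ler_norml => /andP[ft1 ft2].
  have [ty|yt] := leP t y0.
    have := pmax t; rewrite pt ty => /(_ isT) ftn.
    have := mono t y0 _ ty y0b'; rewrite fy0 => /(_ _) ft0.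
    by apply/andP; split; [apply: lt_le_trans (ft0 _); lra|rewrite lt_neqAle ftn].
  have := qmin t; rewrite (ltW yt) tq => /(_ isT) ftn.
  have := mono y0 t x0y0 (ltW yt); rewrite fy0 => /(_ _) ft0.
  by apply/andP; split; [rewrite lt_neqAle eq_sym ftn|apply: le_lt_trans (ft0 _) _; lra].
(* H gains T / 2 from p to q at unit speed, which uses up the whole length of [x0, b] and forces p =
   x0 and q = b. *)
have := mvt p q x0p pq qb bnd; rewrite /H fp fq cnT_inv1 cnT_invN1 subr0 => pqT.
have px0 : p = x0 by move: pqT; rewrite /b in qb; lra.
have qbE : q = b by move: pqT; rewrite /b in qb *; lra.
apply: (antiperiodic_eq _ fL _ (y := x0)); first by rewrite divr_gt0.
  by move=> z; rewrite addrAC cnT_anti.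
move=> x /andP[x0x xb].
have : H x - H x0 = x - x0.
  apply: mvt => // t tx; apply: bnd; rewrite px0 qbE /b; lra.
rewrite {2}/H fx0 cnT_inv1 subr0 => <-; rewrite cnT_invK//.
by rewrite -ler_norml.
Qed.

Theorem sharp_inequality f h : is_primitive f h -> itv_integrable (fun x => h x ^+ 2) ->
  (forall x, f (x + T / 2) = - f x) ->
  cn_lin * \int[mu]_(x in `[0, T]) (f x ^+ 2) +
  cn_coef * Num.sqrt (\int[mu]_(x in `[0, T]) (f x ^+ 4)) <= \int[mu]_(x in `[0, T]) (h x ^+ 2) /\
  (cn_lin * \int[mu]_(x in `[0, T]) (f x ^+ 2) +
  cn_coef * Num.sqrt (\int[mu]_(x in `[0, T]) (f x ^+ 4)) = \int[mu]_(x in `[0, T]) (h x ^+ 2) ->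
  exists M x0, forall x, f x = M * cnT (x - x0)).
Proof.
move=> fh h2 fL.
have cf := is_primitive_continuous fh.
have L0 : 0 < T / 2 by rewrite divr_gt0.
have i2 := continuous_itv_integrable (continuous_pow (n := 2) cf).
have i4 := continuous_itv_integrable (continuous_pow (n := 4) cf).
have [x0 x0L fmax] := antiperiodic_max L0 cf fL.
set D := \int[mu]_(x in `[0, T]) (h x ^+ 2).
set Y := \int[mu]_(x in `[0, T]) (f x ^+ 2).
set X := \int[mu]_(x in `[0, T]) (f x ^+ 4).
have D0 : 0 <= D by apply: Rintegral_ge0 => x _; exact: sqr_ge0.
(* The zero function cannot be normalized and is treated apart, with M = 0. *)
have [fx0|fx0] := eqVneq (f x0) 0.
  have f0 x : f x = 0 by apply/eqP; rewrite -normr_le0 (le_trans (fmax x))// fx0 normr0.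
  have Y0 : Y = 0.
    by rewrite /Y (eq_itv_integral (g := fun=> 0)) ?itv_integral_cst ?mul0r// ?ltW// => x _; rewrite f0 expr0n.
  have X0 : X = 0.
    by rewrite /X (eq_itv_integral (g := fun=> 0)) ?itv_integral_cst ?mul0r// ?ltW// => x _; rewrite f0 expr0n.
  rewrite X0 Y0 sqrtr0 !mulr0 addr0; split=> // _.
  by exists 0, 0 => x; rewrite f0 mul0r.
(* M keeps the sign of f x0, so that the normalized function takes the value 1, not -1, at x0. *)
set M := f x0 in fx0.
have M2 : 0 < M ^+ 2 by rewrite exprn_even_gt0.
pose g x := M^-1 * f x; pose w x := M^-1 * h x.
have gw : is_primitive g w by exact: is_primitiveZ.
have w2 : itv_integrable (fun x => w x ^+ 2).
  have := itv_integrableZ (M^-1 ^+ 2) h2.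
  by congr itv_integrable; apply/funext => x; rewrite exprMn.
have g1 x : `|g x| <= 1.
  by rewrite normrM normfV mulrC ler_pdivrMr ?normr_gt0// mul1r fmax.
have gL x : g (x + T / 2) = - g x by rewrite /g fL mulrN.
have gx0 : g x0 = 1 by rewrite /g mulVf.
have := normalized_inequality gw w2 g1 gL x0L gx0.
have -> : \int[mu]_(x in `[0, T]) (w x ^+ 2) = M^-1 ^+ 2 * D.
  by rewrite -itv_integralZ//; apply: eq_itv_integral => x _; rewrite exprMn.
have -> : \int[mu]_(x in `[0, T]) (g x ^+ 2) = M^-1 ^+ 2 * Y.
  by rewrite -itv_integralZ//; apply: eq_itv_integral => x _; rewrite exprMn.
have -> : \int[mu]_(x in `[0, T]) (g x ^+ 4) = M^-1 ^+ 4 * X.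
  by rewrite -itv_integralZ//; apply: eq_itv_integral => x _; rewrite exprMn.
have res_eq := normalized_equality gw w2 g1 gL gx0.
have X0 : 0 <= X by apply: Rintegral_ge0 => x _; exact: (@exprn_even_ge0 _ 4).
have Q0 : 0 <= cn_quartic by apply: Rintegral_ge0 => x _; exact: (@exprn_even_ge0 _ 4).
set res := Rintegral mu `[x0, x0 + T / 2] _ in res_eq *.
have res0 : 0 <= res by apply: Rintegral_ge0 => x _; exact: sqr_ge0.
move=> main.
(* AM-GM: 2 sqrt X sqrt Q <= X / M^2 + M^2 Q *)
have amgm : 2 * (Num.sqrt X * Num.sqrt cn_quartic) <= X / M ^+ 2 + M ^+ 2 * cn_quartic.
  rewrite -[in leRHS](sqr_sqrtr X0) -[in leRHS](sqr_sqrtr Q0).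
  set p := Num.sqrt X; set q := Num.sqrt cn_quartic.
  rewrite -subr_ge0 [leRHS](_ : _ = (p / M - M * q) ^+ 2) ?sqr_ge0//.
  by field.
have k2 : 0 <= kappa ^+ 2 * k ^+ 2 by rewrite -exprMn sqr_ge0.
(* The remainder bounds the deficit from below, so equality annihilates it and [normalized_equality]
   applies. *)
have key : M ^+ 2 * res <= D - (cn_lin * Y + cn_coef * Num.sqrt X).
  have : M ^+ 2 * res <= D - cn_lin * Y - kappa ^+ 2 * k ^+ 2 * (X / M ^+ 2 + M ^+ 2 * cn_quartic).
    rewrite -subr_ge0; rewrite -subr_ge0 -(pmulr_rge0 _ M2) in main.
    by apply: le_trans main _; rewrite le_eqVlt; apply/orP; left; apply/eqP; field.
  move=> /le_trans; apply; rewrite -addrA -opprD lerD2l lerN2 lerD2l /cn_coef.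
  apply: le_trans (ler_wpM2l k2 amgm).
  by rewrite le_eqVlt; apply/orP; left; apply/eqP; ring.
split; first by rewrite -subr_ge0 (le_trans _ key)// mulr_ge0// ltW.
move=> E; exists M, x0 => x.
rewrite -res_eq; first by rewrite /g mulVKf.
by apply/eqP; rewrite eq_le res0 andbT -(pmulr_rle0 _ M2) (le_trans key)// E subrr.
Qed.

End SharpInequality.

(** * Dependence on the modulus *)

Section ModulusDependence.
Variable R : realType.
Implicit Types (k l : R) (p : nat).
Local Notation mu := (@lebesgue_measure R).

Lemma weighted_integrand_ge0 k p t : 0 <= weighted_integrand k p t.
Proof.
by rewrite mulr_ge0 ?exprn_even_ge0 ?odd_double// invr_ge0 sqrtr_ge0.
Qed.

Lemma ellDelta_mono k l t : 0 < k < 1 -> 0 < l < 1 -> k <= l -> ellDelta l t <= ellDelta k t.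
Proof.
move=> /andP[k0 k1] /andP[l0 l1] kl; rewrite lerD2l lerN2 ler_wpM2r ?sqr_ge0//.
by rewrite lerXn2r// nnegrE ltW.
Qed.

Lemma ellF_integrand_mono k l t : 0 < k < 1 -> 0 < l < 1 -> k <= l ->
  ellF_integrand k t <= ellF_integrand l t.
Proof.
move=> k01 l01 kl; rewrite !ellF_integrandE lef_pV2 ?posrE ?sqrtr_gt0 ?ellDelta_gt0//.
by rewrite ler_wsqrtr// ellDelta_mono.
Qed.

Lemma itv_integrable_weighted k p : 0 < k < 1 -> itv_integrable (weighted_integrand k p).
Proof. by move=> k01; apply: continuous_itv_integrable; exact: continuous_weighted_integrand. Qed.

Lemma ellI_mono k l p : 0 < k < 1 -> 0 < l < 1 -> k <= l -> ellI k p <= ellI l p.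
Proof.
move=> k01 l01 kl; apply: le_itv_integral; try exact: itv_integrable_weighted.
move=> t _; rewrite ler_wpM2l ?exprn_even_ge0 ?odd_double//.
exact: ellF_integrand_mono.
Qed.

(** The integrand is the square of a continuous function; a zero integral would make it vanish at t
    = 0, where it is positive. *)
Lemma ellI_gt0 k p : 0 < k < 1 -> 0 < ellI k p.
Proof.
move=> k01; rewrite lt_neqAle Rintegral_ge0 ?andbT; last by move=> t _; exact: weighted_integrand_ge0.
apply/eqP => I0.
have pi20 : 0 < pi / 2 :> R by rewrite divr_gt0 ?pi_gt0.
have pos t : 0 < ellF_integrand k t by rewrite (lt_le_trans ltr01)// ellF_integrand_ge1.
have sq t : weighted_integrand k p t = (cos t ^+ p * Num.sqrt (ellF_integrand k t)) ^+ 2.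
  by rewrite exprMn sqr_sqrtr ?(ltW (pos _))// -exprM muln2.
have cs : continuous (fun t => cos t ^+ p * Num.sqrt (ellF_integrand k t)).
  move=> t; apply: cvgM; first exact: (continuous_pow (n := p) (@continuous_cos R)).
  apply: continuous_comp; [exact: (continuous_ellF_integrand k01)|exact: sqrt_continuous].
have := integral_sqr_eq0 (a := 0) (b := pi / 2) (continuous_itv_integrable (continuous_pow (n := 2) cs))
  (continuous_measurable_fun cs).
move=> /(_ _)/(continuous_ae_eq0 pi20 cs)/(_ 0).
rewrite cos0 expr1n mul1r lexx ltW// => H.
have : Num.sqrt (ellF_integrand k 0) = 0.
  by apply: H => //; rewrite [RHS]I0; apply: eq_itv_integral => t _; rewrite sq.
by apply/eqP; rewrite gt_eqF// sqrtr_gt0.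
Qed.

Lemma cos_sqr_le1 (t : R) : cos t ^+ 2 <= 1.
Proof. by have := cos2Dsin2 t; have := sqr_ge0 (sin t); lra. Qed.

(** Dominated convergence: moduli below the midpoint v of k and 1 have integrands bounded by that of
    K at v. *)
Lemma continuous_ellI k p : 0 < k < 1 -> {for k, continuous (fun l => ellI l p)}.
Proof.
move=> /andP[k0 k1].
pose v := (1 + k) / 2.
have kv : k < v by rewrite /v; lra.
have v1 : v < 1 by rewrite /v; lra.
have v01 : 0 < v < 1 by rewrite v1 (lt_trans k0).
have in01 l : `]0, v[%classic l -> 0 < l < 1.
  by rewrite /= in_itv/= => /andP[-> /lt_trans ->].
suff : {in `]0, v[%classic, continuous (fun l => \int[mu]_(t in `[0, pi / 2]) weighted_integrand l p t)}.
  by apply; rewrite inE/= in_itv/= k0.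
pose m : {measure set (measurableTypeR R) -> \bar R} := lebesgue_measure.
apply: (@continuity_under_integral R _ _ m (fun l t => weighted_integrand l p t)
  `[0, pi / 2]%classic (measurable_itv _) 0 v _ _ (ellF_integrand v)).
- by move=> l /in01 l01; exact: itv_integrable_weighted.
- apply: aeW => t _ l /set_mem/in01 l01.
  apply: cvgMr; apply: cvgV; first by rewrite gt_eqF// sqrtr_gt0 ellDelta_gt0.
  apply: (@continuous_comp _ _ _ (fun l => ellDelta l t) Num.sqrt); last exact: sqrt_continuous.
  by apply: cvgB; [exact: cvg_cst|apply: cvgMl; exact: exprn_continuous].
- exact/continuous_itv_integrable/continuous_ellF_integrand.
- move=> l lv; have l01 := in01 l lv; apply: aeW => t _.
  rewrite ger0_norm ?weighted_integrand_ge0// -[leRHS]mul1r.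
  have cos2 : cos t ^+ p.*2 <= 1.
    by rewrite -mul2n exprM exprn_ile1 ?sqr_ge0// cos_sqr_le1.
  apply: ler_pM => //.
  + by rewrite exprn_even_ge0 ?odd_double.
  + by rewrite invr_ge0 sqrtr_ge0.
  + by apply: ellF_integrand_mono => //; move: lv; rewrite /= in_itv/= => /andP[_ /ltW].
Qed.

(* [- ln (1 - k sin t)] has derivative at most twice the integrand of K. *)
Lemma ellK_ln k : 0 < k < 1 -> - ln (1 - k) / 2 <= ellK k.
Proof.
move=> k01; have [k0 k1] : 0 < k /\ k < 1 by apply/andP.
pose u t := 1 - k * sin t.
have u0 t : 0 < u t.
  by rewrite /u subr_gt0; have := sin_le1 t; have := sin_geN1 t; nra.
have du (t : R) : is_derive t 1 u (- (k * cos t)).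
  have H := is_deriveB (is_derive_cst (1 : R) t 1) (is_deriveZ k (is_derive_sin t)).
  by apply: (is_derive_eq H); rewrite sub0r.
pose g t := - 2^-1 * ln (u t).
pose g' t := 2^-1 * (k * cos t) / u t.
have dg (t : R) : is_derive t 1 g (g' t).
  have H := is_deriveZ (- 2^-1) (is_derive_chain (du t) (is_derive1_ln (u0 t))).
  by apply: (is_derive_eq H); rewrite /GRing.scale/= /g'; field; rewrite gt_eqF.
have cu := is_derive_continuous du.
have cg' : continuous g'.
  move=> t; apply: cvgM; first by apply: cvgMr; apply: cvgMr; exact: continuous_cos.
  by apply: cvgV; [rewrite gt_eqF|exact: cu].
have pi20 : 0 <= pi / 2 :> R by rewrite divr_ge0 ?pi_ge0.
have -> : - ln (1 - k) / 2 = g (pi / 2) - g 0.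
  by rewrite /g /u sin_pihalf sin0 mulr1 mulr0 subr0 ln1 mulr0 subr0 mulNr mulrC mulNr.
rewrite -(FTC2_itv pi20 cg' dg) /ellK /ellF pi20; apply: le_itv_integral.
- exact: continuous_itv_integrable.
- exact/continuous_itv_integrable/continuous_ellF_integrand.
move=> t /andP[t0 tpi].
have c0 : 0 <= cos t by apply: cos_ge0_pihalf; lra.
have s0 : 0 <= sin t by apply: sin_ge0_pi; have := pi_ge0 R; lra.
have s1 := sin_le1 t.
have := cos2Dsin2 t; have D0 := ellDelta_gt0 k01 t.
rewrite ellF_integrandE /g'.
set c := cos t in c0 *; set s := sin t in s0 s1 *; move=> cs.
have uE : u t = 1 - k * s by [].
have DE : ellDelta k t = (1 - k * s) * (1 + k * s) by rewrite /ellDelta -/s; ring.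
have sD : 0 < Num.sqrt (ellDelta k t) by rewrite sqrtr_gt0.
rewrite -[leRHS]mul1r ler_pdivrMr// mulrAC ler_pdivlMr// mul1r.
have us : 0 < 1 - k * s by rewrite -uE.
rewrite uE -(ler_pXn2r (n := 2)) ?nnegrE//; last by rewrite ltW.
  rewrite exprMn sqr_sqrtr ?(ltW D0)// DE !exprMn.
  have c2 : c ^+ 2 <= 2 * (1 - k * s) by nra.
  have k2 : k ^+ 2 * (1 + k * s) <= 2.
    have : k ^+ 2 <= 1 by rewrite exprn_ile1 ?ltW.
    by nra.
  have : (1 - k * s) * (k ^+ 2 * (1 + k * s)) * c ^+ 2 <= (1 - k * s) * 2 * (2 * (1 - k * s)).
    apply: ler_pM => //; rewrite ?sqr_ge0//.
    - by rewrite mulr_ge0 ?(ltW us)// mulr_ge0 ?sqr_ge0//; nra.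
    - by rewrite ler_wpM2l// ltW.
  by clear; nra.
by rewrite mulr_ge0 ?(ltW sD)// !mulr_ge0// ltW.
Qed.

(** The linear bound makes F small near 0, and K tends to infinity at 1 by [ellK_ln]; the
    intermediate value theorem does the rest. *)
Lemma continuous_onto01 (F : R -> R) (A B : R) : 0 < A -> 0 < B ->
  (forall k, 0 < k < 1 -> {for k, continuous F}) ->
  (forall k, 0 < k <= 1 / 2 -> F k <= A * k) ->
  (forall k, 1 / 2 <= k < 1 -> B * ellK k <= F k) ->
  forall y, 0 < y -> exists2 k, 0 < k < 1 & F k = y.
Proof.
move=> A0 B0 cF small large y y0.
(* These points satisfy A lo <= y and - ln (1 - hi) / 2 >= y / B. *)
pose lo := Num.min (1 / 2) (y / A).
pose hi := Num.max (1 / 2) (1 - expR (- (2 * y / B))).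
have lo0 : 0 < lo by rewrite lt_min; apply/andP; split; [lra|rewrite divr_gt0].
have lo2 : lo <= 1 / 2 by rewrite ge_min lexx.
have hi2 : 1 / 2 <= hi by rewrite le_max lexx.
have hi1 : hi < 1.
  by rewrite gt_max; apply/andP; split; [lra|rewrite ltrBlDr ltrDl expR_gt0].
have Flo : F lo <= y.
  apply: le_trans (small lo _) _; first by rewrite lo0.
  by rewrite mulrC -ler_pdivlMr// ge_min lexx orbT.
have Fhi : y <= F hi.
  apply: le_trans (large hi _); last by rewrite hi2.
  rewrite mulrC -ler_pdivrMr//; apply: le_trans (ellK_ln _); last by rewrite hi1 andbT; lra.
  rewrite ler_pdivlMr// lerNr -[leRHS]expRK ler_ln ?posrE ?expR_gt0 ?subr_gt0//.
  rewrite (_ : - (y / B * 2) = - (2 * y / B)); last by ring.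
  by rewrite lerBlDr -lerBlDl le_max lexx orbT.
have lohi : lo <= hi by exact: le_trans hi2.
have cw : {within `[lo, hi], continuous F}.
  apply: continuous_in_subspaceT => x; rewrite inE/= in_itv/= => xlh; apply: cF; lra.
have [|x xlh Fx] := IVT (v := y) lohi cw.
  by rewrite ge_min le_max Flo Fhi orbT.
by exists x => //; move: xlh; rewrite in_itv/=; lra.
Qed.

End ModulusDependence.

(** * The strict minimum point of an abstract envelope *)

Section Envelope.
Variable R : realType.
(** In the application a, c, n, r are [cn_lin], [cn_coef], [cn_quot], [cn_ratio]. No
    differentiability in the modulus is assumed; the hypothesis [test] takes its place. *)
Variables (a c n r : R -> R) (b m k0 : R).
Hypotheses (b_gt0 : 0 < b) (m_gt0 : 0 < m) (k0_01 : 0 < k0 < 1).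
Hypothesis ca : forall k, 0 < k < 1 -> {for k, continuous a}.
Hypothesis cc : forall k, 0 < k < 1 -> {for k, continuous c}.
Hypothesis n_gt0 : forall k, 0 < k < 1 -> 0 < n k.
Hypothesis cE : forall k, 0 < k < 1 -> c k = r k * n k.
Hypothesis r_incr : forall k l, 0 < k < 1 -> 0 < l < 1 -> k < l -> r k < r l.
Hypothesis c_incr : forall k l, 0 < k < 1 -> 0 < l < 1 -> k < l -> c k < c l.
Hypothesis test : forall k l, 0 < k < 1 -> 0 < l < 1 -> a l - a k <= (c k - c l) * n k.
Hypothesis r0 : r k0 = 2 * m * b.

Definition envelope k := 2 * m * a k + c k ^+ 2 / (2 * b).

(* At a minimum point k1, comparing with nearby k gives c k1 = 2 m b n k1, i.e. r k1 = 2 m b. *)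
Lemma envelope_step k k1 : 0 < k < 1 -> 0 < k1 < 1 -> envelope k1 <= envelope k ->
  0 <= (c k1 - c k) * (2 * m * n k1 - (c k + c k1) / (2 * b)).
Proof.
move=> k01 k101; rewrite /envelope => H.
have := ler_wpM2l (ltW (mulr_gt0 (ltr0n R 2) m_gt0)) (test k101 k01).
have -> : (c k1 - c k) * (2 * m * n k1 - (c k + c k1) / (2 * b)) =
  2 * m * ((c k1 - c k) * n k1) + (c k ^+ 2 / (2 * b) - c k1 ^+ 2 / (2 * b)).
  by field; rewrite gt_eqF.
lra.
Qed.

(** Suppose envelope k1 <= envelope k0. A minimum point z other than k0 on the segment between them
    is varied slightly towards k0; as r z lies strictly on one side of 2 m b, this contradicts the
    sign in [envelope_step]. *)
Lemma envelope_min k1 : 0 < k1 < 1 -> k1 != k0 -> envelope k0 < envelope k1.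
Proof.
move=> k101 k10; rewrite ltNge; apply/negP => ek.
have [k00 k011] : 0 < k0 /\ k0 < 1 by apply/andP.
have [k100 k111] : 0 < k1 /\ k1 < 1 by apply/andP.
have ce : forall k, 0 < k < 1 -> {for k, continuous envelope}.
  move=> k k01; apply: cvgD; first by apply: cvgMr; exact: ca.
  by apply: cvgMl; apply: (@continuous_comp _ _ _ c (fun y => y ^+ 2)); [exact: cc|exact: exprn_continuous].
(* If the minimum sits at k0, then k1 is a minimum point as well by [ek]. Landing on the endpoint k1
   is harmless, since only variations towards k0 are made. *)
have attained lo hi : lo <= hi -> 0 < lo -> hi < 1 -> (k0 = lo /\ k1 = hi) \/ (k0 = hi /\ k1 = lo) ->
    exists2 z, lo <= z <= hi & z != k0 /\ forall k, lo <= k <= hi -> envelope z <= envelope k.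
  move=> lohi lo0 hi1 ends.
  have cw : {within `[lo, hi], continuous envelope}.
    by apply: continuous_in_subspaceT => x; rewrite inE/= in_itv/= => xlh; apply: ce; lra.
  have [z zlh zmin] := EVT_min lohi cw.
  have k0lh : lo <= k0 <= hi by case: ends => -[? ?]; lra.
  have k1lh : lo <= k1 <= hi by case: ends => -[? ?]; lra.
  have [zk|zk] := eqVneq z k0; last first.
    by exists z; [move: zlh; rewrite in_itv|split=> // k klh; apply: zmin; rewrite in_itv].
  exists k1 => //; split=> // k klh; apply: (le_trans ek); rewrite -zk; apply: zmin.
  by rewrite in_itv.
have near_le z e : 0 < z < 1 -> 0 < e -> exists2 d, 0 < d & forall k, `|z - k| < d -> `|c z - c k| < e.
  move=> z01 e0; have /cvgrPdist_lt/(_ _ e0)/nbhs_ballP[d /= d0 Hd] := cc z01.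
  by exists d.
have [kk|kk] := ltP k0 k1.
- have [z /andP[z0 z1] [zk zmin]] := attained k0 k1 (ltW kk) k00 k111 (or_introl (conj erefl erefl)).
  have z01 : 0 < z < 1 by lra.
  have kz : k0 < z by rewrite lt_neqAle eq_sym zk.
  have rz := r_incr k0_01 z01 kz.
  have nz := n_gt0 z01.
  have cz : 2 * m * n z < c z / b.
    by rewrite ltr_pdivlMr// cE// mulrAC ltr_pM2r// -r0.
  (* As soon as c z - c k < e, the second factor in [envelope_step] is negative while the first is
     positive. *)
  pose e := 2 * b * (c z / b - 2 * m * n z).
  have e0 : 0 < e by rewrite !mulr_gt0 ?subr_gt0.
  have [d d0 Hd] := near_le z e z01 e0.
  pose k := Num.max k0 (z - d / 2).
  have kk0 : k0 <= k by rewrite le_max lexx.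
  have kzd : z - d / 2 <= k by rewrite le_max lexx orbT.
  have klt : k < z by rewrite gt_max kz/=; lra.
  have k01 : 0 < k < 1 by lra.
  have /Hd : `|z - k| < d by rewrite ltr_norml; lra.
  rewrite ltr_norml => /andP[_ czk].
  have := envelope_step k01 z01 (zmin k _); rewrite kk0 (le_trans (ltW klt) z1) => /(_ isT).
  rewrite pmulr_rge0 ?subr_ge0 ?subr_gt0 ?c_incr// leNgt => /negP; apply.
  rewrite ltr_pdivlMr ?mulr_gt0//.
  have -> : 2 * m * n z * (2 * b) = 2 * c z - e by rewrite /e; field; rewrite gt_eqF.
  by lra.
- have {}kk : k1 < k0 by rewrite lt_neqAle k10.
  have [z /andP[z0 z1] [zk zmin]] := attained k1 k0 (ltW kk) k100 k011 (or_intror (conj erefl erefl)).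
  have z01 : 0 < z < 1 by lra.
  have kz : z < k0 by rewrite lt_neqAle zk.
  have rz := r_incr z01 k0_01 kz.
  have nz := n_gt0 z01.
  have cz : c z / b < 2 * m * n z.
    by rewrite ltr_pdivrMr// cE// [ltRHS]mulrAC ltr_pM2r// -r0.
  pose e := 2 * b * (2 * m * n z - c z / b).
  have e0 : 0 < e by rewrite !mulr_gt0 ?subr_gt0.
  have [d d0 Hd] := near_le z e z01 e0.
  pose k := Num.min k0 (z + d / 2).
  have kk0 : k <= k0 by rewrite ge_min lexx.
  have kzd : k <= z + d / 2 by rewrite ge_min lexx orbT.
  have klt : z < k by rewrite lt_min kz/=; lra.
  have k01 : 0 < k < 1 by lra.
  have /Hd : `|z - k| < d by rewrite ltr_norml; lra.
  rewrite ltr_norml => /andP[czk _].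
  have := envelope_step k01 z01 (zmin k _); rewrite kk0 (le_trans z0 (ltW klt)) => /(_ isT).
  rewrite nmulr_rge0 ?subr_le0 ?subr_lt0 ?c_incr// leNgt => /negP; apply.
  rewrite ltr_pdivrMr ?mulr_gt0//.
  have -> : 2 * m * n z * (2 * b) = 2 * c z + e by rewrite /e; field; rewrite gt_eqF.
  by lra.
Qed.

End Envelope.

(** * Monotonicity, continuity and range of the sharp constants *)

Section SharpConstants.
Variables (R : realType) (T : R).
Hypothesis T_gt0 : 0 < T.
Implicit Types k l : R.
Local Notation mu := (@lebesgue_measure R).

Lemma period_kappa k : 0 < k < 1 -> 4 * ellK k / kappa k T = T.
Proof.
move=> k01; rewrite /kappa; field.
by rewrite !gt_eqF// ellK_gt0.
Qed.

Lemma cn_massE k : 0 < k < 1 -> cn_mass k T = 4 / kappa k T * ellI k 1.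
Proof.
move=> k01; have k0 := kappa_gt0 k01 T_gt0.
by have := integral_cn_pow k01 1 k0; rewrite period_kappa.
Qed.

Lemma cn_quarticE k : 0 < k < 1 -> cn_quartic k T = 4 / kappa k T * ellI k 2.
Proof.
move=> k01; have k0 := kappa_gt0 k01 T_gt0.
by have := integral_cn_pow k01 2 k0; rewrite period_kappa.
Qed.

Lemma cn_mass_gt0 k : 0 < k < 1 -> 0 < cn_mass k T.
Proof.
by move=> k01; rewrite cn_massE// mulr_gt0 ?ellI_gt0// divr_gt0// kappa_gt0.
Qed.

Lemma cn_quartic_gt0 k : 0 < k < 1 -> 0 < cn_quartic k T.
Proof.
by move=> k01; rewrite cn_quarticE// mulr_gt0 ?ellI_gt0// divr_gt0// kappa_gt0.
Qed.

(* A cnT with A^2 = 2 k^2 kappa^2 / b solves the Euler-Lagrange equation; it has mass m exactly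
   when cn_ratio = 2 m b. *)
Definition cn_ratio k := 2 * kappa k T ^+ 2 * k ^+ 2 * cn_mass k T.

(** With kappa eliminated, only K, k^2 and [ellI] depend on the modulus, each of them monotone and
    continuous. *)
Lemma cn_ratioE k : 0 < k < 1 -> cn_ratio k = 32 / T * (ellK k * k ^+ 2 * ellI k 1).
Proof.
move=> k01; rewrite /cn_ratio cn_massE// /kappa; field.
by rewrite !gt_eqF ?ellK_gt0.
Qed.

(** Squaring removes the root of [cn_quartic]; monotonicity, continuity and range of [cn_coef] are
    read off from this form. *)
Lemma cn_coef_sqr k : 0 < k < 1 ->
  cn_coef k T ^+ 2 = 4 ^+ 5 / T ^+ 3 * (ellK k ^+ 3 * k ^+ 4 * ellI k 2).
Proof.
move=> k01; rewrite /cn_coef exprMn sqr_sqrtr ?(ltW (cn_quartic_gt0 k01))//.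
rewrite cn_quarticE// /kappa; field.
by rewrite !gt_eqF ?ellK_gt0.
Qed.

Lemma cn_coef_gt0 k : 0 < k < 1 -> 0 < cn_coef k T.
Proof.
move=> k01; have [k0 _] : 0 < k /\ k < 1 by apply/andP.
have kp0 := kappa_gt0 k01 T_gt0.
by rewrite /cn_coef mulr_gt0 ?sqrtr_gt0 ?cn_quartic_gt0// mulr_gt0 ?exprn_gt0// mulr_gt0 ?exprn_gt0.
Qed.

Lemma ellK_mono k l : 0 < k < 1 -> 0 < l < 1 -> k <= l -> ellK k <= ellK l.
Proof. by move=> k01 l01 kl; rewrite !ellKE ellI_mono. Qed.

Lemma cn_ratio_incr k l : 0 < k < 1 -> 0 < l < 1 -> k < l -> cn_ratio k < cn_ratio l.
Proof.
move=> k01 l01 kl; rewrite !cn_ratioE// ltr_pM2l ?divr_gt0//.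
have K0 := ellK_gt0 k01; have I0 := ellI_gt0 1 k01.
have [k0 _] : 0 < k /\ k < 1 by apply/andP.
apply: (@lt_le_trans _ _ (ellK k * l ^+ 2 * ellI k 1)).
  by rewrite ltr_pM2r// ltr_pM2l// ltrXn2r// ?nnegrE ltW// (lt_trans k0).
apply: ler_pM; rewrite ?(ltW I0)//.
- by rewrite mulr_ge0 ?sqr_ge0// ltW.
- by rewrite ler_wpM2r ?sqr_ge0// ellK_mono// ltW.
- by rewrite ellI_mono// ltW.
Qed.

Lemma cn_coef_incr k l : 0 < k < 1 -> 0 < l < 1 -> k < l -> cn_coef k T < cn_coef l T.
Proof.
move=> k01 l01 kl; rewrite -(ltr_pXn2r (n := 2)) ?nnegrE ?(ltW (cn_coef_gt0 _))//.
have c0 : 0 < 4 ^+ 5 / T ^+ 3 by rewrite divr_gt0 ?exprn_gt0.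
have lt_eq2 (x y x' y' : R) : x = x' -> y = y' -> x' < y' -> x < y by move=> -> ->.
apply: (lt_eq2 _ _ _ _ (cn_coef_sqr k01) (cn_coef_sqr l01)); rewrite (ltr_pM2l c0).
have K0 := ellK_gt0 k01; have I0 := ellI_gt0 2 k01.
have [k0 _] : 0 < k /\ k < 1 by apply/andP.
apply: (@lt_le_trans _ _ (ellK k ^+ 3 * l ^+ 4 * ellI k 2)).
  by rewrite ltr_pM2r// ltr_pM2l ?exprn_gt0// ltrXn2r// ?nnegrE ltW// (lt_trans k0).
apply: ler_pM; rewrite ?(ltW I0)//.
- by rewrite mulr_ge0 ?exprn_ge0// ltW// (lt_trans k0).
- rewrite ler_wpM2r ?exprn_ge0 ?(ltW (lt_trans k0 kl))//.
  by rewrite lerXn2r ?nnegrE ?(ltW K0) ?(ltW (ellK_gt0 l01))// ellK_mono// ltW.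
- by rewrite ellI_mono// ltW.
Qed.

Lemma continuous_ellK k : 0 < k < 1 -> {for k, continuous (@ellK R)}.
Proof.
move=> k01; have := continuous_ellI (p := 0) k01.
by rewrite (_ : (fun l => ellI l 0) = @ellK R)//; apply/funext => l; rewrite ellKE.
Qed.

Lemma continuous_expr_at (f : R -> R) (n : nat) k : {for k, continuous f} ->
  {for k, continuous (fun l => f l ^+ n)}.
Proof.
by move=> cf; apply: (@continuous_comp _ _ _ f (fun y => y ^+ n)); [exact: cf|exact: exprn_continuous].
Qed.

Lemma near_continuous_eq01 (f g : R -> R) k : 0 < k < 1 ->
  (forall l, 0 < l < 1 -> f l = g l) -> {for k, continuous g} -> {for k, continuous f}.
Proof.
move=> k01 fg cg; rewrite /prop_for /continuous_at fg//.
apply: cvg_trans cg; apply: near_eq_cvg.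
have : k \in `]0, 1[ by rewrite in_itv.
by move=> /near_in_itvoo; apply: filterS => l; rewrite in_itv/= => /fg ->.
Qed.

Lemma continuous_cn_ratio k : 0 < k < 1 -> {for k, continuous cn_ratio}.
Proof.
move=> k01; apply: (near_continuous_eq01 k01 cn_ratioE).
apply: cvgMr; apply: cvgM; last exact: continuous_ellI.
by apply: cvgM; [exact: continuous_ellK|exact: exprn_continuous].
Qed.

Lemma continuous_cn_coef_sqr k : 0 < k < 1 -> {for k, continuous (fun l => cn_coef l T ^+ 2)}.
Proof.
move=> k01; apply: (near_continuous_eq01 k01 cn_coef_sqr).
apply: cvgMr; apply: cvgM; last exact: continuous_ellI.
apply: cvgM; last exact: exprn_continuous.
exact: continuous_expr_at (continuous_ellK k01).
Qed.

Lemma continuous_cn_coef k : 0 < k < 1 -> {for k, continuous (fun l => cn_coef l T)}.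
Proof.
move=> k01; apply: (near_continuous_eq01 (g := fun l => Num.sqrt (cn_coef l T ^+ 2)) k01).
  by move=> l l01; rewrite sqrtr_sqr gtr0_norm// cn_coef_gt0.
apply: (@continuous_comp _ _ _ (fun l => cn_coef l T ^+ 2) Num.sqrt).
  exact: continuous_cn_coef_sqr.
exact: sqrt_continuous.
Qed.

Lemma continuous_cn_lin k : 0 < k < 1 -> {for k, continuous (fun l => cn_lin l T)}.
Proof.
move=> k01; apply: cvgM.
  apply: (continuous_expr_at (f := fun l => kappa l T)).
  by apply: cvgMl; apply: cvgMr; exact: continuous_ellK.
by apply: cvgB; [exact: cvg_cst|apply: cvgMr; exact: exprn_continuous].
Qed.

Lemma half01 : 0 < (1 / 2 : R) < 1.
Proof. lra. Qed.

Lemma cn_ratio_onto y : 0 < y -> exists2 k, 0 < k < 1 & cn_ratio k = y.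
Proof.
pose c := 32 / T; have c0 : 0 < c by rewrite divr_gt0.
have K0 := ellK_gt0 half01; have I0 := ellI_gt0 1 half01.
(* Below 1/2, K and [ellI] are at most their values at 1/2 and k^2 <= k. Above 1/2, k^2 >= 1/4 and
   [ellI] is at least its value at 1/2, while K is kept for growth. *)
apply: (@continuous_onto01 R cn_ratio (c * (ellK (1 / 2) * ellI (1 / 2) 1)) (c * (1 / 4 * ellI (1 / 2) 1))).
- by rewrite mulr_gt0// mulr_gt0.
- by rewrite mulr_gt0// mulr_gt0// divr_gt0.
- exact: continuous_cn_ratio.
- move=> k /andP[k0 k2]; have k01 : 0 < k < 1 by lra.
  rewrite cn_ratioE// -/c -[leRHS]mulrA ler_pM2l// [leLHS]mulrAC.
  have Kk := ellK_mono k01 half01 k2; have Ik := ellI_mono 1 k01 half01 k2.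
  have KK := ellK_gt0 k01; have II := ellI_gt0 1 k01.
  apply: ler_pM; rewrite ?mulr_ge0 ?sqr_ge0 ?(ltW KK) ?(ltW II) ?(ltW k0)//.
    by apply: ler_pM => //; exact: ltW.
  by rewrite expr2 ler_piMr// ltW//; lra.
- move=> k /andP[k2 k1]; have k01 : 0 < k < 1 by lra.
  rewrite cn_ratioE// -/c -[leLHS]mulrA ler_pM2l// [leLHS]mulrC -[leRHS]mulrA ler_pM2l ?ellK_gt0//.
  apply: ler_pM; [by rewrite divr_ge0|exact: ltW| |exact: ellI_mono half01 k01 k2].
  by nra.
Qed.

Lemma ellK_ge1 k : 0 < k < 1 -> 1 <= ellK k.
Proof. by move=> k01; apply: le_trans (ellK_ge k01); have := pi_ge2 R; lra. Qed.

(** Supplies the modulus adapted to a given quartic integral in [energy_lower_bound]. *)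
Lemma cn_coef_onto y : 0 < y -> exists2 k, 0 < k < 1 & cn_coef k T = y.
Proof.
move=> y0; have y20 : 0 < y ^+ 2 by rewrite exprn_gt0.
suff [k k01 E] : exists2 k, 0 < k < 1 & cn_coef k T ^+ 2 = y ^+ 2.
  exists k => //; apply/eqP.
  by rewrite -(eqrXn2 (n := 2)) ?E// ltW// cn_coef_gt0.
pose c := 4 ^+ 5 / T ^+ 3; have c0 : 0 < c by rewrite divr_gt0// exprn_gt0.
have K0 := ellK_gt0 half01; have I0 := ellI_gt0 2 half01.
(* The constants come from k^4 <= k below 1/2, and from k^4 >= 1/16 and K^3 >= K above; the last
   uses K >= 1. *)
move: y20; apply: (@continuous_onto01 R (fun k => cn_coef k T ^+ 2)
  (c * (ellK (1 / 2) ^+ 3 * ellI (1 / 2) 2)) (c * (1 / 16 * ellI (1 / 2) 2))).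
- by rewrite mulr_gt0// mulr_gt0// exprn_gt0.
- by rewrite mulr_gt0// mulr_gt0// divr_gt0.
- exact: continuous_cn_coef_sqr.
- move=> k /andP[k0 k2]; have k01 : 0 < k < 1 by lra.
  rewrite cn_coef_sqr// -/c -[leRHS]mulrA ler_pM2l// [leLHS]mulrAC.
  have Kk := ellK_mono k01 half01 k2; have Ik := ellI_mono 2 k01 half01 k2.
  have KK := ellK_gt0 k01; have II := ellI_gt0 2 k01.
  apply: ler_pM; rewrite ?mulr_ge0 ?exprn_ge0 ?(ltW KK) ?(ltW II) ?(ltW k0)//.
    apply: ler_pM => //; rewrite ?exprn_ge0 ?(ltW KK) ?(ltW II)//.
    by rewrite lerXn2r// nnegrE ltW.
  by rewrite exprS ler_piMr ?exprn_ile1 ?(ltW k0)//; lra.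
- move=> k /andP[k2 k1]; have k01 : 0 < k < 1 by lra.
  have KK := ellK_gt0 k01.
  rewrite cn_coef_sqr// -/c -[leLHS]mulrA ler_pM2l// [leLHS]mulrC.
  rewrite -[leRHS]mulrA; apply: ler_pM.
  + exact: ltW.
  + by rewrite mulr_ge0 ?(ltW I0)// divr_ge0.
  + by rewrite exprS ler_peMr ?(ltW KK)// exprn_ege1// ellK_ge1.
  apply: ler_pM; [by rewrite divr_ge0|exact: ltW| |exact: ellI_mono half01 k01 k2].
  have : (1 / 2) ^+ 4 <= k ^+ 4 by rewrite lerXn2r ?nnegrE//; lra.
  by apply: le_trans; rewrite le_eqVlt; apply/orP; left; apply/eqP; field.
Qed.

(** A multiple of cnT with integral of the square 2 m has 2 m [cn_quot] as root of its quartic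
    integral. So [cn_ratio] = 2 m b says that [cn_coef] equals b times that root, the stationarity
    condition of the envelope. *)
Definition cn_quot k := Num.sqrt (cn_quartic k T) / cn_mass k T.

Lemma cn_quot_gt0 k : 0 < k < 1 -> 0 < cn_quot k.
Proof. by move=> k01; rewrite divr_gt0 ?sqrtr_gt0 ?cn_quartic_gt0 ?cn_mass_gt0. Qed.

Lemma cn_coefE k : 0 < k < 1 -> cn_coef k T = cn_ratio k * cn_quot k.
Proof.
by move=> k01; rewrite /cn_coef /cn_ratio /cn_quot; field; rewrite gt_eqF ?cn_mass_gt0.
Qed.

Lemma cn_coef_test k l : 0 < k < 1 -> 0 < l < 1 ->
  cn_lin l T - cn_lin k T <= (cn_coef k T - cn_coef l T) * cn_quot k.
Proof.
move=> k01 l01.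
have [H _] := sharp_inequality l01 T_gt0 (is_primitive_cnT T k01) (itv_integrable_cnT'_sqr T k01)
  (cnT_anti k01 T_gt0).
have M0 := cn_mass_gt0 k01; have Q0 := cn_quartic_gt0 k01.
rewrite cnT_virial// -/(cn_mass k T) -/(cn_quartic k T) in H.
rewrite mulrA ler_pdivlMr// mulrBl mulrBl lerBlDr -addrA [X in _ <= _ + X]addrC addrA lerBrDr.
apply: (le_trans H); rewrite [leRHS]addrC lerD2l /cn_coef -[leRHS]mulrA -expr2.
by rewrite sqr_sqrtr// ltW.
Qed.

Lemma envelope_cn_min b m k0 k : 0 < b -> 0 < m -> 0 < k0 < 1 -> cn_ratio k0 = 2 * m * b ->
  0 < k < 1 -> k != k0 ->
  envelope (fun l => cn_lin l T) (fun l => cn_coef l T) b m k0 < envelope (fun l => cn_lin l T) (fun l => cn_coef l T) b m k.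
Proof.
move=> b0 m0 k001 r0 k01.
apply: (envelope_min (n := cn_quot) (r := cn_ratio)) => //.
- exact: continuous_cn_lin.
- exact: continuous_cn_coef.
- exact: cn_quot_gt0.
- exact: cn_coefE.
- exact: cn_ratio_incr.
- exact: cn_coef_incr.
- exact: cn_coef_test.
Qed.

End SharpConstants.

(** * The sharp inequality for complex functions *)

Section ComplexInequality.
Variables (R : realType) (k T : R).
Hypothesis k01 : 0 < k < 1.
Hypothesis T_gt0 : 0 < T.
Implicit Types (f g h w F G : R -> R) (x y : R).
Local Notation mu := (@lebesgue_measure R).
Local Notation I f := (\int[mu]_(x in `[0, T]) f x).

Lemma continuous_integral_sqr_eq0 f : continuous f ->
  \int[mu]_(x in `[0, T]) (f x ^+ 2) = 0 -> forall x, 0 <= x <= T -> f x = 0.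
Proof.
move=> cf f0; apply: (continuous_ae_eq0 T_gt0 cf).
apply: integral_sqr_eq0 => //; last exact: continuous_measurable_fun.
exact/continuous_itv_integrable/continuous_pow.
Qed.

Lemma integral_pow4_ge0 f : 0 <= \int[mu]_(x in `[0, T]) (f x ^+ 4).
Proof. by apply: Rintegral_ge0 => x _; exact: (@exprn_even_ge0 _ 4). Qed.

Lemma continuous_integral_pow4_eq0 f : continuous f ->
  \int[mu]_(x in `[0, T]) (f x ^+ 4) = 0 -> forall x, 0 <= x <= T -> f x = 0.
Proof.
move=> cf f0 x xT; apply/eqP; rewrite -sqrf_eq0; apply/eqP.
apply: (continuous_integral_sqr_eq0 (f := fun x => f x ^+ 2)) => //; first exact: continuous_pow.
by rewrite -[RHS]f0; apply: eq_itv_integral => z _; rewrite -exprM.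
Qed.

(* Minkowski in L^2 for F^2 and G^2; equality would make them proportional, which x1 forbids. *)
Lemma minkowski_quartic F G x1 : continuous F -> continuous G -> 0 <= x1 <= T ->
  F x1 != 0 -> G x1 = 0 ->
  let s := Num.sqrt (\int[mu]_(x in `[0, T]) (F x ^+ 4)) +
           Num.sqrt (\int[mu]_(x in `[0, T]) (G x ^+ 4)) in
  Num.sqrt (\int[mu]_(x in `[0, T]) ((F x ^+ 2 + G x ^+ 2) ^+ 2)) <= s /\
  (Num.sqrt (\int[mu]_(x in `[0, T]) ((F x ^+ 2 + G x ^+ 2) ^+ 2)) = s ->
   forall x, 0 <= x <= T -> G x = 0).
Proof.
move=> cF cG x1T Fx1 Gx1 /=.
have cFG : continuous (fun x => F x ^+ 2 * G x ^+ 2).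
  by move=> x; apply: cvgM; apply: continuous_pow.
have iF := continuous_itv_integrable (continuous_pow (n := 4) cF).
have iG := continuous_itv_integrable (continuous_pow (n := 4) cG).
have iFG := continuous_itv_integrable cFG.
set XF := \int[mu]_(x in `[0, T]) (F x ^+ 4).
set XG := \int[mu]_(x in `[0, T]) (G x ^+ 4).
have XF0 : 0 <= XF := integral_pow4_ge0 F.
have XG0 : 0 <= XG := integral_pow4_ge0 G.
pose Z := \int[mu]_(x in `[0, T]) (F x ^+ 2 * G x ^+ 2).
have XE : \int[mu]_(x in `[0, T]) ((F x ^+ 2 + G x ^+ 2) ^+ 2) = XF + 2 * Z + XG.
  rewrite -itv_integralZ// -itv_integralD//; last exact: itv_integrableZ.
  rewrite -itv_integralD//; last by apply: itv_integrableD => //; exact: itv_integrableZ.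
  by apply: eq_itv_integral => x _; ring.
have [XG00|XGn0] := eqVneq XG 0.
  have G0 := continuous_integral_pow4_eq0 cG XG00.
  have Z0 : Z = 0.
    rewrite /Z (eq_itv_integral (g := fun=> 0)) ?itv_integral_cst ?mul0r ?(ltW T_gt0)//.
    by move=> x xT; rewrite G0// expr0n mulr0.
  by rewrite XE Z0 XG00 mulr0 !addr0 sqrtr0 addr0.
have q0 : 0 < Num.sqrt XG by rewrite sqrtr_gt0 lt_neqAle eq_sym XGn0.
have p0 : 0 < Num.sqrt XF.
  rewrite sqrtr_gt0 lt_neqAle XF0 andbT; apply/eqP => /esym XF00.
  by move/eqP: Fx1; apply; exact: (continuous_integral_pow4_eq0 cF XF00).
set p := Num.sqrt XF in p0 *; set q := Num.sqrt XG in q0 *.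
have pE : p ^+ 2 = XF by rewrite sqr_sqrtr.
have qE : q ^+ 2 = XG by rewrite sqr_sqrtr.
(* The square of this function integrates to 2 p q (p q - Z), which is the deficit in the
   Cauchy-Schwarz inequality Z <= p q. *)
have cd : continuous (fun x => q * F x ^+ 2 - p * G x ^+ 2).
  by move=> x; apply: cvgB; apply: cvgMr; apply: continuous_pow.
have dE : \int[mu]_(x in `[0, T]) ((q * F x ^+ 2 - p * G x ^+ 2) ^+ 2) = 2 * (p * q) * (p * q - Z).
  rewrite (_ : 2 * (p * q) * (p * q - Z) = q ^+ 2 * XF + p ^+ 2 * XG - 2 * (p * q) * Z).
    rewrite -!itv_integralZ// -itv_integralD; try exact: itv_integrableZ.
    rewrite -itv_integralB; [|apply: itv_integrableD; exact: itv_integrableZ|exact: itv_integrableZ].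
    by apply: eq_itv_integral => x _; ring.
  by rewrite -pE -qE; ring.
have pq0 : 0 < 2 * (p * q) by rewrite !mulr_gt0.
have Zpq : Z <= p * q.
  rewrite -subr_ge0 -(pmulr_rge0 _ pq0) -dE.
  by apply: Rintegral_ge0 => x _; exact: sqr_ge0.
have XE' : XF + 2 * Z + XG = (p + q) ^+ 2 - 2 * (p * q - Z) by rewrite -pE -qE; ring.
rewrite XE; split.
  have pq : 0 <= p + q by rewrite addr_ge0// ltW.
  rewrite -(ger0_norm pq) -sqrtr_sqr; apply: ler_wsqrtr; rewrite XE'.
  by rewrite lerBlDr lerDl mulr_ge0// subr_ge0.
move=> E; exfalso.
have X0 : 0 <= XF + 2 * Z + XG.
  by rewrite -XE; apply: Rintegral_ge0 => x _; exact: sqr_ge0.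
have Z0 : p * q - Z = 0.
  have : Num.sqrt (XF + 2 * Z + XG) ^+ 2 = (p + q) ^+ 2 by rewrite E.
  rewrite sqr_sqrtr// XE' => E2.
  have /eqP : 2 * (p * q - Z) = 0 by rewrite -[RHS](subrr ((p + q) ^+ 2)) -{2}E2; ring.
  by rewrite mulf_eq0 pnatr_eq0/= => /eqP.
have := continuous_integral_sqr_eq0 cd; rewrite dE Z0 mulr0 => /(_ erefl x1 x1T)/eqP.
by rewrite Gx1 expr0n/= mulr0 subr0 mulf_eq0 gt_eqF//= sqrf_eq0 (negbTE Fx1).
Qed.

(* After a rotation of (f, g) into (F, G), G vanishes at a point x1 where F does not. *)
Theorem complex_sharp_inequality f g h w : is_primitive f h -> is_primitive g w ->
  itv_integrable (fun x => h x ^+ 2) -> itv_integrable (fun x => w x ^+ 2) ->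
  (forall x, f (x + T / 2) = - f x) -> (forall x, g (x + T / 2) = - g x) ->
  cn_lin k T * \int[mu]_(x in `[0, T]) (f x ^+ 2 + g x ^+ 2) +
  cn_coef k T * Num.sqrt (\int[mu]_(x in `[0, T]) ((f x ^+ 2 + g x ^+ 2) ^+ 2)) <=
  \int[mu]_(x in `[0, T]) (h x ^+ 2 + w x ^+ 2) /\
  (cn_lin k T * \int[mu]_(x in `[0, T]) (f x ^+ 2 + g x ^+ 2) +
  cn_coef k T * Num.sqrt (\int[mu]_(x in `[0, T]) ((f x ^+ 2 + g x ^+ 2) ^+ 2)) =
  \int[mu]_(x in `[0, T]) (h x ^+ 2 + w x ^+ 2) ->
  exists A B x0, forall x, f x = A * cnT k T (x - x0) /\ g x = B * cnT k T (x - x0)).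
Proof.
move=> fh gw h2 w2 fL gL.
have L0 : 0 < T / 2 by rewrite divr_gt0.
have LT : T / 2 <= T by rewrite -[leRHS]half_period_double lerDl ltW.
(* The rotation needs a point where (f, g) is nonzero. If there is none on a half-period,
   anti-periodicity makes f and g vanish identically. *)
have [[x1 x1L x1n]|H] := pselect (exists2 x, 0 <= x <= T / 2 & f x ^+ 2 + g x ^+ 2 != 0); last first.
  have fg0 x : 0 <= x <= T / 2 -> f x ^+ 2 + g x ^+ 2 = 0.
    by move=> xL; apply/eqP/negPn/negP => xn; apply: H; exists x.
  have f0 x : f x = 0.
    have [z zL E] := antiperiodic_reduce L0 x 0 fL.
    apply/eqP; rewrite -normr_eq0 E normr_eq0 -sqrf_eq0.
    by have := fg0 z; rewrite -[X in _ <= _ <= X]add0r => /(_ zL)/eqP; rewrite paddr_eq0 ?sqr_ge0// => /andP[].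
  have g0 x : g x = 0.
    have [z zL E] := antiperiodic_reduce L0 x 0 gL.
    apply/eqP; rewrite -normr_eq0 E normr_eq0 -sqrf_eq0.
    by have := fg0 z; rewrite -[X in _ <= _ <= X]add0r => /(_ zL)/eqP; rewrite paddr_eq0 ?sqr_ge0// => /andP[].
  rewrite (eq_itv_integral (f := fun x => f x ^+ 2 + g x ^+ 2) (g := fun=> 0)); last first.
    by move=> x _; rewrite f0 g0 expr0n addr0.
  rewrite (eq_itv_integral (f := fun x => (f x ^+ 2 + g x ^+ 2) ^+ 2) (g := fun=> 0)); last first.
    by move=> x _; rewrite f0 g0 expr0n addr0 expr0n.
  rewrite itv_integral_cst ?(ltW T_gt0)// mul0r sqrtr0 !mulr0 addr0; split.
    by apply: Rintegral_ge0 => x _; rewrite addr_ge0 ?sqr_ge0.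
  by move=> _; exists 0, 0, 0 => x; rewrite f0 g0 !mul0r.
have r0 : 0 < f x1 ^+ 2 + g x1 ^+ 2 by rewrite lt_neqAle eq_sym x1n addr_ge0 ?sqr_ge0.
pose r := Num.sqrt (f x1 ^+ 2 + g x1 ^+ 2).
have rE : r ^+ 2 = f x1 ^+ 2 + g x1 ^+ 2 by rewrite sqr_sqrtr// ltW.
have rn0 : r != 0 by rewrite gt_eqF// sqrtr_gt0.
(* Cosine and sine of the argument of f + i g at x1. *)
pose cs := f x1 / r; pose sn := g x1 / r.
have cs2 : cs ^+ 2 + sn ^+ 2 = 1.
  by rewrite !expr_div_n -mulrDl -rE divff// sqrf_eq0.
pose F x := cs * f x + sn * g x; pose G x := cs * g x + - sn * f x.
pose H x := cs * h x + sn * w x; pose W x := cs * w x + - sn * h x.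
have FH : is_primitive F H := is_primitiveD (is_primitiveZ cs fh) (is_primitiveZ sn gw).
have GW : is_primitive G W := is_primitiveD (is_primitiveZ cs gw) (is_primitiveZ (- sn) fh).
have cF := is_primitive_continuous FH; have cG := is_primitive_continuous GW.
have mh := itv_integrable_measurable fh.1; have mw := itv_integrable_measurable gw.1.
have hw := itv_integrableM_sqr mh mw h2 w2.
have H2 : itv_integrable (fun x => H x ^+ 2).
  have := itv_integrableD (itv_integrableD (itv_integrableZ (cs ^+ 2) h2)
    (itv_integrableZ (sn ^+ 2) w2)) (itv_integrableZ (2 * cs * sn) hw).
  by congr itv_integrable; apply/funext => x; rewrite /H; ring.
have W2 : itv_integrable (fun x => W x ^+ 2).
  have := itv_integrableD (itv_integrableD (itv_integrableZ (cs ^+ 2) w2)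
    (itv_integrableZ (sn ^+ 2) h2)) (itv_integrableZ (- (2 * cs * sn)) hw).
  by congr itv_integrable; apply/funext => x; rewrite /W; ring.
have FL x : F (x + T / 2) = - F x by rewrite /F fL gL; ring.
have GL x : G (x + T / 2) = - G x by rewrite /G fL gL; ring.
have Fx1 : F x1 != 0.
  have -> : F x1 = r by rewrite /F /cs /sn mulrAC [X in _ + X]mulrAC -mulrDl -!expr2 -rE expr2 mulfK.
  by [].
have Gx1 : G x1 = 0 by rewrite /G /cs /sn; ring.
have rot a c : (cs * a + sn * c) ^+ 2 + (cs * c + - sn * a) ^+ 2 = a ^+ 2 + c ^+ 2.
  by rewrite -[RHS]mul1r -cs2; ring.
have x1T : 0 <= x1 <= T by case/andP: x1L => -> /le_trans ->.
have iF2 := continuous_itv_integrable (continuous_pow (n := 2) cF).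
have iG2 := continuous_itv_integrable (continuous_pow (n := 2) cG).
have -> : \int[mu]_(x in `[0, T]) (f x ^+ 2 + g x ^+ 2) =
    \int[mu]_(x in `[0, T]) (F x ^+ 2) + \int[mu]_(x in `[0, T]) (G x ^+ 2).
  by rewrite -itv_integralD//; apply: eq_itv_integral => x _; rewrite rot.
have -> : \int[mu]_(x in `[0, T]) (h x ^+ 2 + w x ^+ 2) =
    \int[mu]_(x in `[0, T]) (H x ^+ 2) + \int[mu]_(x in `[0, T]) (W x ^+ 2).
  by rewrite -itv_integralD//; apply: eq_itv_integral => x _; rewrite rot.
have -> : \int[mu]_(x in `[0, T]) ((f x ^+ 2 + g x ^+ 2) ^+ 2) =
    \int[mu]_(x in `[0, T]) ((F x ^+ 2 + G x ^+ 2) ^+ 2).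
  by apply: eq_itv_integral => x _; rewrite rot.
have [mink mink_eq] := minkowski_quartic cF cG x1T Fx1 Gx1.
have [sF sF_eq] := sharp_inequality k01 T_gt0 FH H2 FL.
have [sG _] := sharp_inequality k01 T_gt0 GW W2 GL.
have c0 := cn_coef_gt0 T_gt0 k01.
set X := Num.sqrt _ in mink mink_eq *.
set XF := Num.sqrt _ in mink mink_eq sF sF_eq.
set XG := Num.sqrt _ in mink mink_eq sG.
set DF := Rintegral mu _ (fun x => H x ^+ 2) in sF sF_eq *.
set DG := Rintegral mu _ (fun x => W x ^+ 2) in sG *.
set YF := Rintegral mu _ (fun x => F x ^+ 2) in sF sF_eq *.
set YG := Rintegral mu _ (fun x => G x ^+ 2) in sG *.
move: (ler_wpM2l (ltW c0) mink); rewrite mulrDr => cmink.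
have chain : cn_lin k T * (YF + YG) + cn_coef k T * X <= DF + DG.
  rewrite mulrDr -addrA; apply: le_trans (lerD sF sG).
  by rewrite [leRHS]addrACA addrA lerD2l.
split => // E.
(* Equality of the sums forces equality in the bound for F and in Minkowski's inequality; the latter
   gives G = 0 on [0, T]. *)
have arith (a1 a2 b1 b2 b d1 d2 : R) : a1 + b1 <= d1 -> a2 + b2 <= d2 -> b <= b1 + b2 ->
    a1 + a2 + b = d1 + d2 -> a1 + b1 = d1 /\ b = b1 + b2.
  by move=> *; split; lra.
rewrite mulrDr in E; have [EF EX'] := arith _ _ _ _ _ _ _ sF sG cmink E.
have EX : X = XF + XG by apply: (mulfI (lt0r_neq0 c0)); rewrite mulrDr.
have G0 := mink_eq EX.
have [M [x0 FE]] := sF_eq EF.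
have Gz x : G x = 0.
  have [z zL Ez] := antiperiodic_reduce L0 x 0 GL.
  apply/eqP; rewrite -normr_eq0 Ez normr_eq0 G0//.
  by move: zL; rewrite add0r => /andP[-> /le_trans ->].
exists (cs * M), (sn * M), x0 => x.
have fE : cs * F x - sn * G x = f x.
  by transitivity ((cs ^+ 2 + sn ^+ 2) * f x); [rewrite /F /G; ring|rewrite cs2 mul1r].
have gE : sn * F x + cs * G x = g x.
  by transitivity ((cs ^+ 2 + sn ^+ 2) * g x); [rewrite /F /G; ring|rewrite cs2 mul1r].
rewrite Gz mulr0 subr0 in fE; rewrite Gz mulr0 addr0 in gE.
by split; rewrite -mulrA -FE.
Qed.

End ComplexInequality.

(** * Mass, energy and momentum of H1 functions *)

Section H1Representation.
Variable R : realType.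
Implicit Types (u v : R -> R[i]) (f g h w : R -> R) (T m x y : R).
Local Notation mu := (@lebesgue_measure R).
Local Notation normc := ComplexField.Normc.normc.
Local Notation Re := complex.Re.
Local Notation Im := complex.Im.

Lemma normc_sqrE (z : R[i]) : normc z ^+ 2 = Re z ^+ 2 + Im z ^+ 2.
Proof. by case: z => a b /=; rewrite sqr_sqrtr// addr_ge0 ?sqr_ge0. Qed.

Lemma L2locP u : L2loc u <->
  [/\ measurable_fun setT (fun x => Re (u x)), measurable_fun setT (fun x => Im (u x)),
      itv_integrable (fun x => Re (u x) ^+ 2) & itv_integrable (fun x => Im (u x) ^+ 2)].
Proof.
have E : (fun x => normc (u x) ^+ 2) = (fun x => Re (u x) ^+ 2 + Im (u x) ^+ 2).
  by apply/funext => x; rewrite normc_sqrE.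
split=> [[mR mI [_ _ H]]|[mR mI iR iI]].
  have iN : itv_integrable (fun x => normc (u x) ^+ 2).
    move=> a b; apply/integrableP; split.
      apply/measurable_EFinP; rewrite E.
      by apply: measurable_funS (measurable_funD (measurable_funX 2 mR) (measurable_funX 2 mI)).
    by apply: H => //; exact: segment_compact.
  split=> //.
  - apply: (le_itv_integrable _ iN); first exact: measurable_funX.
    by move=> x; rewrite ger0_norm ?sqr_ge0// normc_sqrE lerDl sqr_ge0.
  - apply: (le_itv_integrable _ iN); first exact: measurable_funX.
    by move=> x; rewrite ger0_norm ?sqr_ge0// normc_sqrE lerDr sqr_ge0.
split=> //; apply: itv_integrable_locally.
by rewrite E; exact: itv_integrableD.
Qed.

(** f and g are the continuous representatives of the real and imaginary parts, tied to the chosen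
    weak derivative [wderiv]. *)
Definition H1rep u f g :=
  [/\ is_primitive f (fun x => Re (wderiv u x)), is_primitive g (fun x => Im (wderiv u x)),
      L2loc (wderiv u) & {ae mu, forall x, u x = f x +i* g x}].

Lemma cintegral_real_mul u (phi : R -> R) :
  cintegral setT (fun x => u x * (phi x)%:C) =
  (\int[mu]_x (Re (u x) * phi x)) +i* (\int[mu]_x (Im (u x) * phi x)).
Proof.
rewrite /cintegral; congr (_ +i* _); apply: eq_Rintegral => x _.
- by case: (u x) => a b /=; rewrite mulr0 subr0.
- by case: (u x) => a b /=; rewrite mulr0 add0r.
Qed.

Lemma weak_derivatives_rep u v : L2loc u -> weak_derivatives u v ->
  exists f g, [/\ is_primitive f (fun x => Re (v x)), is_primitive g (fun x => Im (v x)) &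
    {ae mu, forall x, u x = f x +i* g x}].
Proof.
move=> /L2locP[uR uI iR iI] [/L2locP[vR vI jR jI] H].
have Hc phi : test_fun phi ->
    \int[mu]_x (Re (u x) * derive1 phi x) = - (\int[mu]_x (Re (v x) * phi x)) /\
    \int[mu]_x (Im (u x) * derive1 phi x) = - (\int[mu]_x (Im (v x) * phi x)).
  by move=> /H; rewrite !cintegral_real_mul => -[-> ->].
have [f fP fu] := weak_derivative_primitive (itv_integrable_of_sqr uR iR)
  (itv_integrable_of_sqr vR jR) (fun phi tp => (Hc phi tp).1).
have [g gP gu] := weak_derivative_primitive (itv_integrable_of_sqr uI iI)
  (itv_integrable_of_sqr vI jI) (fun phi tp => (Hc phi tp).2).
exists f, g; split=> //; apply: ae_mono (ae_and fu gu) => x [<- <-].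
by case: (u x).
Qed.

Lemma wderivP u : H1loc u -> weak_derivatives u (wderiv u).
Proof. by move=> [_ H]; exact: xgetPex. Qed.

Lemma H1loc_rep u : H1loc u -> exists f g, H1rep u f g.
Proof.
move=> H; have W := wderivP H.
have [f [g [fP gP fg]]] := weak_derivatives_rep H.1 W.
by exists f, g; split=> //; case: W.
Qed.

Lemma primitive_H1loc f g h w : is_primitive f h -> is_primitive g w ->
  itv_integrable (fun x => h x ^+ 2) -> itv_integrable (fun x => w x ^+ 2) ->
  H1loc (fun x => f x +i* g x).
Proof.
move=> fh gw h2 w2.
have cf := is_primitive_continuous fh; have cg := is_primitive_continuous gw.
split.
  apply/L2locP; split=> /=; [exact: continuous_measurable_fun|exact: continuous_measurable_fun| |];
    exact/continuous_itv_integrable/continuous_pow.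
exists (fun x => h x +i* w x); split.
  apply/L2locP; split=> //=; [exact: itv_integrable_measurable fh.1|exact: itv_integrable_measurable gw.1].
move=> phi tphi; rewrite !cintegral_real_mul/=.
by rewrite (integration_by_parts_test fh tphi) (integration_by_parts_test gw tphi).
Qed.

Lemma H1rep_unique u f g f' g' : H1rep u f g -> continuous f' -> continuous g' ->
  {ae mu, forall x, u x = f' x +i* g' x} -> (forall x, f x = f' x) /\ (forall x, g x = g' x).
Proof.
move=> [fP gP _ fg] cf' cg' fg'.
have cf := is_primitive_continuous fP; have cg := is_primitive_continuous gP.
by split; apply: continuous_ae_eq => //; apply: ae_mono (ae_and fg fg') => x [-> []].
Qed.

Lemma half_antiperiodic_rep T u f g : H1rep u f g ->
  {ae mu, forall x, u (x + T / 2) = - u x} ->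
  (forall x, f (x + T / 2) = - f x) /\ (forall x, g (x + T / 2) = - g x).
Proof.
move=> [fP gP _ fg] anti.
have cf := is_primitive_continuous fP; have cg := is_primitive_continuous gP.
have cs : continuous (fun x => x + T / 2) by move=> x; apply: cvgD; [exact: cvg_id|exact: cvg_cst].
have H := ae_and (null_translate (T / 2) fg) (ae_and fg anti).
split; apply: continuous_ae_eq.
- by move=> x; apply: (@continuous_comp _ _ _ (fun x => x + T / 2) f); [exact: cs|exact: cf].
- by move=> x; apply: cvgN; exact: cf.
- by apply: ae_mono H => x [E1 [E2 E3]]; move: E3; rewrite E1 E2 => -[].
- by move=> x; apply: (@continuous_comp _ _ _ (fun x => x + T / 2) g); [exact: cs|exact: cg].
- by move=> x; apply: cvgN; exact: cg.
- by apply: ae_mono H => x [E1 [E2 E3]]; move: E3; rewrite E1 E2 => -[].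
Qed.

Section Functionals.
Variables (u : R -> R[i]) (f g : R -> R) (T : R).
Hypothesis uL2 : L2loc u.
Hypothesis ufg : H1rep u f g.
Local Notation h := (fun x => Re (wderiv u x)).
Local Notation w := (fun x => Im (wderiv u x)).

Lemma integral_normc_pow (n : nat) :
  \int[mu]_(x in `[0, T]) (normc (u x) ^+ n.*2) =
  \int[mu]_(x in `[0, T]) ((f x ^+ 2 + g x ^+ 2) ^+ n).
Proof.
have [fP gP _ fg] := ufg; have /L2locP[mR mI _ _] := uL2.
have cf := is_primitive_continuous fP; have cg := is_primitive_continuous gP.
under eq_Rintegral do rewrite -mul2n exprM normc_sqrE.
apply: ae_eq_itv_integral.
- by apply: measurable_funX; apply: measurable_funD; exact: measurable_funX.
- by apply: measurable_funX; apply: measurable_funD; apply: measurable_funX; exact: continuous_measurable_fun.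
- by apply: ae_mono fg => x -> _.
Qed.

Lemma massE : mass T u = 2^-1 * \int[mu]_(x in `[0, T]) (f x ^+ 2 + g x ^+ 2).
Proof. by rewrite /mass (integral_normc_pow 1). Qed.

Lemma energyE b : energy b T u = 2^-1 * \int[mu]_(x in `[0, T]) (h x ^+ 2 + w x ^+ 2)
  - b / 4 * \int[mu]_(x in `[0, T]) ((f x ^+ 2 + g x ^+ 2) ^+ 2).
Proof.
rewrite /energy (integral_normc_pow 2); congr (_ * _ - _).
by apply: eq_Rintegral => x _; rewrite normc_sqrE.
Qed.

Lemma momentumE : momentum T u = 2^-1 * \int[mu]_(x in `[0, T]) (g x * h x - f x * w x).
Proof.
have [fP gP /L2locP[mh mw _ _] fg] := ufg; have /L2locP[mR mI _ _] := uL2.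
have cf := is_primitive_continuous fP; have cg := is_primitive_continuous gP.
have mf := continuous_measurable_fun cf; have mg := continuous_measurable_fun cg.
rewrite /momentum/=; congr (_ * _).
under eq_Rintegral.
  move=> x _.
  have -> : Im (u x * Num.conj (wderiv u x)) = Im (u x) * h x - Re (u x) * w x.
    by case: (u x) => a b; case: (wderiv u x) => c d /=; ring.
  over.
apply: ae_eq_itv_integral.
- by apply: measurable_funB; exact: measurable_funM.
- by apply: measurable_funB; exact: measurable_funM.
- by apply: ae_mono fg => x -> _.
Qed.

End Functionals.

End H1Representation.

(** * Minimizers *)

(* cn (z x, l) satisfies p'^2 = z^2 (1 - p^2) (1 - l^2 + l^2 p^2). *)
Lemma first_integral_inj (R : realType) (l k z w : R) : 0 < l < 1 -> 0 < k < 1 -> 0 < z -> 0 < w ->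
  (forall s, -1 <= s <= 1 ->
    (1 - s ^+ 2) * (1 - l ^+ 2 + l ^+ 2 * s ^+ 2) * z ^+ 2 =
    (1 - s ^+ 2) * (1 - k ^+ 2 + k ^+ 2 * s ^+ 2) * w ^+ 2) ->
  z = w /\ l = k.
Proof.
move=> /andP[l0 _] /andP[k0 _] z0 w0 E.
(* The value s = 0 compares (1 - l^2) z^2; a second value inside (0, 1) then isolates l^2 z^2, and
   the two add up to z^2. *)
have E0 : (1 - l ^+ 2) * z ^+ 2 = (1 - k ^+ 2) * w ^+ 2 by have := E 0 ltac:(lra); lra.
have E1 := E 2^-1 ltac:(lra).
have zw2 : z ^+ 2 = w ^+ 2 by lra.
have zw : z = w by apply/eqP; rewrite -(eqrXn2 (n := 2)) ?zw2// ltW.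
have lk2 : l ^+ 2 = k ^+ 2.
  apply: (mulIf (expf_neq0 2 (lt0r_neq0 z0))).
  by move: E0; rewrite zw2; lra.
by split=> //; apply/eqP; rewrite -(eqrXn2 (n := 2)) ?lk2// ltW.
Qed.

Section Minimizers.
Variables (R : realType) (b T m k : R).
Hypotheses (b_gt0 : 0 < b) (T_gt0 : 0 < T) (m_gt0 : 0 < m) (k01 : 0 < k < 1).
Hypothesis ratio_k : cn_ratio T k = 2 * m * b.
Implicit Types (u v : R -> R[i]) (x y theta : R).
Local Notation mu := (@lebesgue_measure R).
Local Notation level := (envelope (fun l => cn_lin l T) (fun l => cn_coef l T) b m).
Local Notation q := (cnT k T).
Local Notation kap := (kappa k T).

Lemma energy_lower_bound u : admissible T m u ->
  level k <= 2 * energy b T u /\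
  (2 * energy b T u = level k -> exists A B x0,
     H1rep u (fun x => A * q (x - x0)) (fun x => B * q (x - x0))).
Proof.
move=> [uH [uL2 uA] um]; have [f [g rep]] := H1loc_rep uH.
have [fA gA] := half_antiperiodic_rep rep uA.
have [fP gP /L2locP[_ _ h2 w2] _] := rep.
have cf := is_primitive_continuous fP; have cg := is_primitive_continuous gP.
have cfg : continuous (fun x => f x ^+ 2 + g x ^+ 2).
  by move=> x; apply: cvgD; exact: continuous_pow.
have M2 : \int[mu]_(x in `[0, T]) (f x ^+ 2 + g x ^+ 2) = 2 * m.
  by rewrite -um (massE T uL2 rep) mulVKf.
(* A vanishing quartic integral would force zero mass; positivity is what lets a modulus l be
   selected below. *)
have X0 : 0 < \int[mu]_(x in `[0, T]) ((f x ^+ 2 + g x ^+ 2) ^+ 2).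
  rewrite lt_neqAle Rintegral_ge0 ?andbT; last by move=> x _; exact: sqr_ge0.
  apply/eqP => /esym/(continuous_integral_sqr_eq0 T_gt0 cfg) fg0.
  have : 2 * m = 0.
    by rewrite -M2 (eq_itv_integral (g := fun=> 0)) ?itv_integral_cst ?mul0r// ltW.
  by move=> H; move: m_gt0; lra.
have EE := energyE T uL2 rep b.
move: X0 EE; have IX := complex_sharp_inequality _ T_gt0 fP gP h2 w2 fA gA.
move: IX; rewrite M2.
set X := \int[mu]_(x in `[0, T]) ((f x ^+ 2 + g x ^+ 2) ^+ 2).
set D := \int[mu]_(x in `[0, T]) (_ ^+ 2 + _ ^+ 2).
move=> IX X0 EE.
have cX : 0 < b * Num.sqrt X by rewrite mulr_gt0// sqrtr_gt0.
have [l l01 lE] := cn_coef_onto T_gt0 cX.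
have [H1 H2] := IX l l01.
have sX : Num.sqrt X * Num.sqrt X = X by rewrite -expr2 sqr_sqrtr// ltW.
have E2 : 2 * energy b T u = D - b / 2 * X by rewrite EE; field.
have Ll : level l = 2 * m * cn_lin l T + b / 2 * X.
  rewrite /envelope lE exprMn sqr_sqrtr ?(ltW X0)//; field; exact: lt0r_neq0.
have lin_l : cn_lin l T * (2 * m) + cn_coef l T * Num.sqrt X = level l + b / 2 * X.
  by rewrite Ll lE -mulrA sX; field.
rewrite lin_l in H1 H2.
have kl : level k <= level l.
  have [->//|lk] := eqVneq l k.
  by apply: ltW; exact: envelope_cn_min ratio_k _ lk.
split.
  by rewrite E2 lerBrDr; apply: le_trans H1; apply: lerD kl (lexx _).
move=> E.
(* Since 2 E(u) >= [level l] >= [level k], equality at the ends identifies l with k by strict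
   minimality and activates the equality case at modulus k. *)
have ll : level l <= level k by rewrite -E E2 lerBrDr.
have lk : l = k.
  apply/eqP; apply: contraT => lk.
  by have := envelope_cn_min T_gt0 b_gt0 m_gt0 k01 ratio_k l01 lk; rewrite ltNge ll.
have [|A [B [x0 fgE]]] := H2.
  by rewrite lk -E E2 subrK.
exists A, B, x0; rewrite lk in fgE.
have -> : (fun x => A * q (x - x0)) = f by apply/funext => x; rewrite (fgE x).1.
have -> : (fun x => B * q (x - x0)) = g by apply/funext => x; rewrite (fgE x).2.
exact: rep.
Qed.

Definition cn_amp := Num.sqrt (2 * k ^+ 2 * kap ^+ 2 / b).
Definition cn_profile x : R[i] := (cn_amp * q x)%:C.

Lemma cn_amp_gt0 : 0 < cn_amp.
Proof.
have [k0 _] : 0 < k /\ k < 1 by apply/andP.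
rewrite sqrtr_gt0 divr_gt0//; apply: mulr_gt0; last exact/exprn_gt0/kappa_gt0.
by apply: mulr_gt0 => //; exact: exprn_gt0.
Qed.

Lemma cn_amp_sqr : cn_amp ^+ 2 = 2 * k ^+ 2 * kap ^+ 2 / b.
Proof.
rewrite sqr_sqrtr// divr_ge0 ?(ltW b_gt0)//.
by apply: mulr_ge0; [apply: mulr_ge0 => //|]; exact: sqr_ge0.
Qed.

Lemma cn_amp_mass : cn_amp ^+ 2 * cn_mass k T = 2 * m.
Proof.
have := ratio_k; rewrite cn_amp_sqr /cn_ratio => E.
rewrite mulrAC (_ : _ * cn_mass k T = 2 * m * b) ?mulfK ?gt_eqF// -E; ring.
Qed.

Lemma is_primitive_shift_cn A x0 :
  is_primitive (fun x => A * q (x - x0)) (fun x => A * cnT' k T (x - x0)).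
Proof.
apply: derive_is_primitive => x.
  apply: cvgMr; apply: (@continuous_comp _ _ _ (fun x => x - x0) (cnT' k T)).
    by apply: cvgB; [exact: cvg_id|exact: cvg_cst].
  exact: continuous_cnT'.
have dx : is_derive x 1 (fun x : R => x - x0) (1 - 0).
  exact: is_deriveB (is_derive_id x 1) (is_derive_cst x0 x 1).
have := is_deriveZ A (is_derive_chain dx (is_derive_cnT T k01 (x - x0))).
by rewrite /GRing.scale/= subr0 mulr1.
Qed.

(** [wderiv] is an arbitrary choice among the weak derivatives, so it is computed only up to a null
    set, from the uniqueness of derivatives of primitives. *)
Lemma H1rep_shift_wderiv u A B x0 :
  H1rep u (fun x => A * q (x - x0)) (fun x => B * q (x - x0)) ->
  {ae mu, forall x, wderiv u x = (A * cnT' k T (x - x0)) +i* (B * cnT' k T (x - x0))}.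
Proof.
move=> [fP gP _ _].
have a1 := is_primitive_unique fP (is_primitive_shift_cn A x0).
have a2 := is_primitive_unique gP (is_primitive_shift_cn B x0).
apply: ae_mono (ae_and a1 a2) => x [].
by case: (wderiv u x) => c d /= -> ->.
Qed.

Lemma cn_profile_H1loc : H1loc cn_profile.
Proof.
have -> : cn_profile = (fun x => (cn_amp * q (x - 0)) +i* (0 * q (x - 0))).
  by apply/funext => x; rewrite mul0r subr0.
have i2 A : itv_integrable (fun x => (A * cnT' k T (x - 0)) ^+ 2).
  apply: continuous_itv_integrable; apply: continuous_pow => x; apply: cvgMr.
  under eq_fun do rewrite subr0; rewrite subr0; exact: continuous_cnT'.
exact: primitive_H1loc (is_primitive_shift_cn cn_amp 0) (is_primitive_shift_cn 0 0) (i2 _) (i2 _).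
Qed.

Lemma cn_profile_H1rep : H1rep cn_profile (fun x => cn_amp * q (x - 0)) (fun x => 0 * q (x - 0)).
Proof.
have [f [g rep]] := H1loc_rep cn_profile_H1loc.
have cs A : continuous (fun x => A * q (x - 0)) := is_primitive_continuous (is_primitive_shift_cn A 0).
have [fE gE] : (forall x, f x = cn_amp * q (x - 0)) /\ (forall x, g x = 0 * q (x - 0)).
  by apply: H1rep_unique rep (cs _) (cs _) _; apply: aeW => x; rewrite mul0r subr0.
have -> : (fun x => cn_amp * q (x - 0)) = f by apply/funext => x.
have -> : (fun x => 0 * q (x - 0)) = g by apply/funext => x.
exact: rep.
Qed.

Lemma cn_profile_mass : mass T cn_profile = m.
Proof.
rewrite (massE T cn_profile_H1loc.1 cn_profile_H1rep).
rewrite (eq_itv_integral (g := fun x => cn_amp ^+ 2 * q x ^+ 2)); last first.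
  by move=> x _; rewrite subr0; ring.
rewrite itv_integralZ; last exact/continuous_itv_integrable/continuous_pow/continuous_cnT.
by rewrite -/(cn_mass k T) cn_amp_mass mulKf.
Qed.

Lemma cn_profile_admissible : admissible T m cn_profile.
Proof.
split; [exact: cn_profile_H1loc| |exact: cn_profile_mass].
split; first exact: cn_profile_H1loc.1.
apply: aeW => x; rewrite /cn_profile cnT_anti// mulrN.
by rewrite rmorphN.
Qed.

Lemma cn_profile_energy : 2 * energy b T cn_profile = level k.
Proof.
have rep := cn_profile_H1rep.
have wE := H1rep_shift_wderiv rep.
rewrite (energyE T cn_profile_H1loc.1 rep).
have [_ _ /L2locP[mh mw _ _] _] := rep.
rewrite (ae_eq_itv_integral (g := fun x => cn_amp ^+ 2 * cnT' k T x ^+ 2)); first last.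
- by apply: ae_mono wE => x -> _ /=; rewrite subr0; ring.
- apply: measurable_funM; first exact: measurable_cst.
  apply: measurable_funX; apply: continuous_measurable_fun; exact: continuous_cnT'.
- by apply: measurable_funD; exact: measurable_funX.
rewrite itv_integralZ; last exact: itv_integrable_cnT'_sqr.
rewrite cnT_virial//.
rewrite (eq_itv_integral (g := fun x => cn_amp ^+ 4 * q x ^+ 4)); last first.
  by move=> x _; rewrite subr0; ring.
rewrite itv_integralZ; last exact/continuous_itv_integrable/continuous_pow/continuous_cnT.
have QE : cn_coef k T ^+ 2 = (2 * kap ^+ 2 * k ^+ 2) ^+ 2 * cn_quartic k T.
  by rewrite /cn_coef [LHS]exprMn sqr_sqrtr ?(ltW (cn_quartic_gt0 _ _)).
rewrite -/(cn_quartic k T) /envelope QE -cn_amp_mass (exprM cn_amp 2 2) cn_amp_sqr.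
move: (cn_lin k T) (cn_mass k T) (cn_quartic k T) kap => A M Q z.
by field; rewrite gt_eqF.
Qed.

Lemma cn_profile_minimizer : minimizers (energy b T) (admissible T m) cn_profile.
Proof.
split; first exact: cn_profile_admissible.
move=> v /energy_lower_bound[H _].
by rewrite -(ler_pM2l (_ : 0 < 2))// cn_profile_energy.
Qed.

Lemma minimizer_rep u : minimizers (energy b T) (admissible T m) u -> exists A B x0,
  H1rep u (fun x => A * q (x - x0)) (fun x => B * q (x - x0)).
Proof.
move=> [uadm umin]; have [H1 H2] := energy_lower_bound uadm; apply: H2.
apply/eqP; rewrite eq_le H1 andbT -cn_profile_energy ler_pM2l//.
exact/umin/cn_profile_admissible.
Qed.

(** A minimizer is a fixed complex number times a real function, so the momentum density cancels
    almost everywhere. *)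
Lemma minimizer_momentum u : minimizers (energy b T) (admissible T m) u -> momentum T u = 0.
Proof.
move=> umin; have [A [B [x0 rep]]] := minimizer_rep umin.
have [[uH [uL2 _] _] _] := umin.
have wE := H1rep_shift_wderiv rep.
have [_ _ /L2locP[mh mw _ _] _] := rep.
have mq C : measurable_fun setT (fun x => C * q (x - x0)).
  by apply: continuous_measurable_fun; exact: is_primitive_continuous (is_primitive_shift_cn C x0).
rewrite (momentumE T uL2 rep) (ae_eq_itv_integral (g := fun=> 0)).
- by rewrite itv_integral_cst ?mul0r ?mulr0// ltW.
- by apply: measurable_funB; exact: measurable_funM.
- exact: measurable_cst.
- by apply: ae_mono wE => x -> _ /=; ring.
Qed.

(** [cn_profile] minimizes over the larger set and belongs to the smaller one, so both minimal
    values agree. *)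
Lemma minimizers_admissible0 :
  minimizers (energy b T) (admissible T m) = minimizers (energy b T) (admissible0 T m).
Proof.
apply/seteqP; split=> u umin.
  split; first by split; [exact: umin.1|exact: minimizer_momentum].
  by move=> v [vadm _]; exact: umin.2.
split; first exact: umin.1.1.
move=> v /cn_profile_minimizer.2; apply: le_trans; apply: umin.2.
split; first exact: cn_profile_admissible.
exact/minimizer_momentum/cn_profile_minimizer.
Qed.

Lemma circle_angle (A B r : R) : 0 < r -> A ^+ 2 + B ^+ 2 = r ^+ 2 ->
  exists theta, A = r * cos theta /\ B = r * sin theta.
Proof.
move=> r0 AB; pose c := A / r; pose s := B / r.
have cs : c ^+ 2 + s ^+ 2 = 1.
  by rewrite /c /s !expr_div_n -mulrDl AB divff// expf_neq0// gt_eqF.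
have c1 : -1 <= c <= 1 by have := sqr_ge0 s; nra.
have Ac : A = r * c by rewrite mulrC divfK// gt_eqF.
have Bs : B = r * s by rewrite mulrC divfK// gt_eqF.
have sE : sin (acos c) = `|s|.
  by rewrite sin_acos// (_ : 1 - c ^+ 2 = s ^+ 2) ?sqrtr_sqr//; rewrite -cs; ring.
have [s0|s0] := leP 0 s.
  by exists (acos c); rewrite acosK ?in_itv// sE ger0_norm.
by exists (- acos c); rewrite cosN sinN acosK ?in_itv// sE ltr0_norm// opprK.
Qed.

Lemma shift_cn_mass x0 : \int[mu]_(x in `[0, T]) (q (x - x0) ^+ 2) = cn_mass k T.
Proof.
have cq2 : continuous (fun x => q x ^+ 2) by exact/continuous_pow/continuous_cnT.
pose P := primitive (fun x => q x ^+ 2).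
have dP x : is_derive x 1 P (q x ^+ 2).
  by apply: (is_primitive_derive (h := fun x => q x ^+ 2)); [|exact: cq2]; exact/primitiveP/continuous_itv_integrable.
have dS (a : R) (x : R) : is_derive x 1 (fun x => P (x + a)) (q (x + a) ^+ 2).
  have dx : is_derive x 1 (fun x : R => x + a) (1 + 0).
    exact: is_deriveD (is_derive_id x 1) (is_derive_cst a x 1).
  by have := is_derive_chain dx (dP (x + a)); rewrite addr0 mulr1.
have qT x : q (x + T) ^+ 2 = q x ^+ 2.
  by rewrite -[X in x + X]half_period_double addrA !cnT_anti// opprK.
have PT x : P (x + T) - P x = P (0 + T) - P 0.
  apply: (@is_derive_0_is_cst _ (fun x => P (x + T) - P x)) => y.
  by have := is_deriveB (dS T y) (dP y); rewrite qT subrr.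
have T0 := ltW T_gt0.
rewrite (FTC2_itv T0 _ (dS (- x0))); last first.
  move=> x; apply: (@continuous_comp _ _ _ (fun x => x - x0) (fun x => q x ^+ 2)); last exact: cq2.
  by apply: cvgB; [exact: cvg_id|exact: cvg_cst].
rewrite /cn_mass (FTC2_itv T0 cq2 dP).
by have := PT (- x0); rewrite !add0r [- x0 + T]addrC.
Qed.

(** The mass constraint fixes |A + i B| to be [cn_amp], and the argument of A + i B is the phase. *)
Lemma minimizer_translate_phase u : minimizers (energy b T) (admissible T m) u ->
  exists y theta, {ae mu, forall x, u x = translate_phase y theta cn_profile x}.
Proof.
move=> umin; have [A [B [x0 rep]]] := minimizer_rep umin.
have [[uH [uL2 _] um] _] := umin; have := massE T uL2 rep; rewrite um.
rewrite (eq_itv_integral (g := fun x => (A ^+ 2 + B ^+ 2) * q (x - x0) ^+ 2)); last first.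
  by move=> x _; ring.
rewrite itv_integralZ; last first.
  apply/continuous_itv_integrable/continuous_pow => x.
  apply: (@continuous_comp _ _ _ (fun x => x - x0) q); last exact: continuous_cnT.
  by apply: cvgB; [exact: cvg_id|exact: cvg_cst].
rewrite shift_cn_mass => mE.
have AB : A ^+ 2 + B ^+ 2 = cn_amp ^+ 2.
  apply: (mulIf (lt0r_neq0 (cn_mass_gt0 T_gt0 k01))).
  by rewrite cn_amp_mass; move: mE; set X := _ * cn_mass k T; lra.
have [theta [AE BE]] := circle_angle cn_amp_gt0 AB.
exists (- x0), theta; have [_ _ _ uE] := rep.
apply: ae_mono uE => x ->; rewrite AE BE /translate_phase /cn_profile.
by apply/eqP; rewrite eq_complex/=; apply/andP; split; apply/eqP; ring.
Qed.

Lemma cn_profile_unique : unique_minimizer (energy b T) (admissible T m) cn_profile.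
Proof. by split; [exact: cn_profile_minimizer|exact: minimizer_translate_phase]. Qed.

Lemma cn_rescaled_profile : cn_rescaled cn_amp^-1 kap^-1 k = cn_profile.
Proof. by apply/funext => x; rewrite /cn_rescaled /cn_profile !invrK [x * _]mulrC. Qed.

(** A period S returns the profile to its value at 0, so cn (kappa S) = 1 and [cn_eq1] gives kappa S
    >= 4 K = kappa T. *)
Lemma cn_profile_period : fundamental_period cn_profile T.
Proof.
split=> // [x|S S0 H].
  by rewrite -[X in x + X]half_period_double addrA /cn_profile !cnT_anti// opprK.
have := H 0; rewrite add0r => -[/(mulfI (lt0r_neq0 cn_amp_gt0))].
rewrite cnT_0// => /(cn_eq1 k01); rewrite pmulr_rgt0 ?kappa_gt0// => /(_ S0).
by rewrite -(_ : kap * T = 4 * ellK k) ?ler_pM2l ?kappa_gt0// divfK// gt_eqF.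
Qed.

(** Such a minimizer is a translate of the profile up to phase. Comparing maxima of the modulus
    gives alpha; comparing the first integrals satisfied by both functions gives beta and l. *)
Lemma cn_rescaled_unique alpha beta l : 0 < alpha -> 0 < beta -> 0 < l < 1 ->
  minimizers (energy b T) (admissible T m) (cn_rescaled alpha beta l) ->
  [/\ alpha = cn_amp^-1, beta = kap^-1 & l = k].
Proof.
move=> a0 b0 l01 /minimizer_translate_phase[y [theta E]].
(* The period of the rescaled function, chosen so that the function is a multiple of [cnT l S]. *)
pose S := 4 * ellK l * beta.
have S0 : 0 < S by rewrite !mulr_gt0// ellK_gt0.
have bE : kappa l S = beta^-1.
  by rewrite /kappa /S invfM mulrA mulfV ?mul1r// gt_eqF// mulr_gt0// ellK_gt0.
have cs (r : R) : continuous (fun x => r * q (x + y)).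
  move=> x; apply: cvgMr; apply: (@continuous_comp _ _ _ (fun x => x + y) q).
    by apply: cvgD; [exact: cvg_id|exact: cvg_cst].
  exact: continuous_cnT.
have uE x : cn_rescaled alpha beta l x = (alpha^-1 * cnT l S x)%:C.
  by rewrite /cn_rescaled /cnT bE [x / _]mulrC.
have Ere : forall x, alpha^-1 * cnT l S x = cos theta * cn_amp * q (x + y).
  apply: continuous_ae_eq; [|exact: cs|].
    by move=> z; apply: cvgMr; exact: continuous_cnT.
  apply: ae_mono E => z; rewrite uE => /(congr1 (@complex.Re R)).
  by rewrite /= mulr0 subr0 mulrA.
have Eim : forall x, 0 = sin theta * cn_amp * q (x + y).
  apply: continuous_ae_eq; [by move=> z; exact: cvg_cst|exact: cs|].
  apply: ae_mono E => z; rewrite uE => /(congr1 (@complex.Im R)).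
  by rewrite /= mulr0 add0r mulrA.
have amp0 := cn_amp_gt0.
have sin0 : sin theta = 0.
  have := Eim (- y); rewrite addNr cnT_0// mulr1 => /esym/eqP.
  by rewrite mulf_eq0 [cn_amp == 0]gt_eqF// orbF => /eqP.
have cos2 : cos theta ^+ 2 = 1 by have := cos2Dsin2 theta; rewrite sin0; lra.
have cosN : `|cos theta| = 1.
  by apply/eqP; rewrite -(eqrXn2 (n := 2))// real_normK ?num_real// cos2 expr1n.
(* The left side has its largest modulus at 0 and the right side at - y; evaluating at these points
   gives the two inequalities. *)
have aE : alpha^-1 = cn_amp.
  have ai : 0 < alpha^-1 by rewrite invr_gt0.
  apply/eqP; rewrite eq_le; apply/andP; split.
    have /(congr1 Num.norm) := Ere 0; rewrite cnT_0// mulr1 !normrM cosN mul1r (gtr0_norm ai) (gtr0_norm amp0) => ->.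
    by rewrite ler_piMr ?cnT_bound// ltW.
  have /(congr1 Num.norm) := Ere (- y); rewrite addNr cnT_0// mulr1 !normrM cosN mul1r (gtr0_norm ai) (gtr0_norm amp0) => <-.
  by rewrite ler_piMr ?cnT_bound// ltW.
have pq : cnT l S = (fun x => cos theta * q (x + y)).
  apply/funext => x; have := Ere x; rewrite aE mulrAC mulrC => /(mulIf (lt0r_neq0 amp0)) ->.
  by [].
have pq' x : cnT' l S x = cos theta * cnT' k T (x + y).
  have dx : is_derive x 1 (fun x : R => x + y) (1 + 0).
    exact: is_deriveD (is_derive_id x 1) (is_derive_cst y x 1).
  have d1 := is_deriveZ (cos theta) (is_derive_chain dx (is_derive_cnT T k01 (x + y))).
  have := is_derive_cnT S l01 x; rewrite pq => d2.
  have [_ <-] := d2; have [_] := d1.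
  by rewrite addr0 mulr1.
(* Compare the squared derivatives where the profile of modulus k equals s; [cnT_inv] provides such
   a point, and the sign of cos theta disappears in the squares. *)
have pot s : -1 <= s <= 1 ->
    (1 - s ^+ 2) * (1 - l ^+ 2 + l ^+ 2 * s ^+ 2) * (beta^-1) ^+ 2 =
    (1 - s ^+ 2) * (1 - k ^+ 2 + k ^+ 2 * s ^+ 2) * kap ^+ 2.
  move=> /(cnT_invK k01 T_gt0) H.
  have := cnT'_sqr S l01 (cnT_inv k T s - y); rewrite pq' pq subrK exprMn cos2 mul1r.
  have c2 : (cos theta * s) ^+ 2 = s ^+ 2 by rewrite exprMn cos2 mul1r.
  rewrite (cnT'_sqr T k01) H /cn_pot bE c2 => E'.
  by rewrite mulrC -E' mulrC.
have kp := kappa_gt0 k01 T_gt0; have bi : 0 < beta^-1 by rewrite invr_gt0.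
have [bk lk] := first_integral_inj l01 k01 bi kp pot.
by split; [rewrite -aE invrK|rewrite -bk invrK|].
Qed.

End Minimizers.

Section MainTheorem.
Variable R : realType.
Implicit Types b T m k : R.
Local Notation mu := (@lebesgue_measure R).

(** Pointwise [ellDelta] - (1 - k^2) = k^2 cos^2; divide by the root of [ellDelta] and integrate. *)
Lemma ellE_ellK k : 0 < k < 1 -> ellE k - (1 - k ^+ 2) * ellK k = k ^+ 2 * ellI k 1.
Proof.
move=> k01; rewrite ellKE /ellI.
have cs : continuous (fun t => Num.sqrt (ellDelta k t)).
  by move=> t; apply: continuous_comp; [exact: continuous_ellDelta|exact: sqrt_continuous].
have iw p := itv_integrable_weighted p k01.
rewrite -!itv_integralZ// -itv_integralB; last exact: itv_integrableZ.
  apply: eq_itv_integral => t _; rewrite /weighted_integrand expr0 mul1r ellF_integrandE.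
  have D0 := ellDelta_gt0 k01 t.
  have s0 : 0 < Num.sqrt (ellDelta k t) by rewrite sqrtr_gt0.
  have s2 : Num.sqrt (ellDelta k t) ^+ 2 = ellDelta k t by rewrite sqr_sqrtr// ltW.
  rewrite -/(ellDelta k t); apply: (mulIf (lt0r_neq0 s0)).
  rewrite mulrBl -!mulrA mulVf ?lt0r_neq0// !mulr1 -expr2 s2 /ellDelta.
  have -> : sin t ^+ 2 = 1 - cos t ^+ 2 by rewrite -(cos2Dsin2 t); ring.
  ring.
exact: continuous_itv_integrable.
Qed.

End MainTheorem.

Theorem theorem1p1 (R : realType) (b T : R) (b_gt0 : 0 < b) (T_gt0 : 0 < T) :
  [/\ (* (i) *)
      forall m : R, 0 < m ->
        minimizers (energy b T) (admissible T m) =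
        minimizers (energy b T) (admissible0 T m),
      (* (ii) *)
      exists alpha beta k : R -> R,
        [/\ forall m : R, 0 < m ->
              [/\ [/\ 0 < alpha m, 0 < beta m & 0 < k m < 1],
                  unique_minimizer (energy b T) (admissible T m)
                    (cn_rescaled (alpha m) (beta m) (k m)),
                  forall alpha' beta' k' : R,
                    0 < alpha' -> 0 < beta' -> 0 < k' < 1 ->
                    minimizers (energy b T) (admissible T m)
                      (cn_rescaled alpha' beta' k') ->
                    [/\ alpha' = alpha m, beta' = beta m & k' = k m] &
                  fundamental_period
                    (cn_rescaled (alpha m) (beta m) (k m)) T],
            set_bij `]0, +oo[ `]0, 1[ k &
            {in `]0, +oo[ &, {homo k : m1 m2 / m1 < m2}}] &
      (* (iii) *)
      forall k : R, 0 < k < 1 -> b = 2 * k ^+ 2 -> T = 4 * ellK k ->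
        let u : R -> R[i] := fun x => (cn x k)%:C in
        mass T u = 2 * (ellE k - (1 - k ^+ 2) * ellK k) / k ^+ 2 /\
        unique_minimizer (energy b T) (admissible T (mass T u)) u].
Proof.
have level_gt0 m : 0 < m -> 0 < 2 * m * b by move=> m0; rewrite !mulr_gt0.
split.
- move=> m m0; have [k k01 kE] := cn_ratio_onto T_gt0 (level_gt0 m m0).
  exact: minimizers_admissible0 kE.
(* For m <= 0 the value 0 is an arbitrary default. *)
- have /choice[kf kfP] m : exists k : R, 0 < m -> 0 < k < 1 /\ cn_ratio T k = 2 * m * b.
    have [m0|m0] := ltP 0 m; last by exists 0.
    by have [k k01 kE] := cn_ratio_onto T_gt0 (level_gt0 m m0); exists k.
  have kf_incr m1 m2 : 0 < m1 -> 0 < m2 -> m1 < m2 -> kf m1 < kf m2.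
    move=> m10 m20 m12; have [k1 r1] := kfP m1 m10; have [k2 r2] := kfP m2 m20.
    rewrite ltNge le_eqVlt; apply/negP => /predU1P[E|lt21].
      by move: r1; rewrite -E r2 => /(mulIf (lt0r_neq0 b_gt0)); lra.
    have := cn_ratio_incr T_gt0 k2 k1 lt21.
    by rewrite r1 r2 ltr_pM2r// ltr_pM2l// ltNge (ltW m12).
  exists (fun m => (cn_amp b T (kf m))^-1), (fun m => (kappa (kf m) T)^-1), kf; split.
  + move=> m m0; have [k01 kE] := kfP m m0.
    split.
    * by split; rewrite ?invr_gt0 ?cn_amp_gt0 ?kappa_gt0.
    * by rewrite cn_rescaled_profile; exact: cn_profile_unique kE.
    * by move=> *; exact: (cn_rescaled_unique b_gt0 T_gt0 m0 k01 kE).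
    * by rewrite cn_rescaled_profile; exact: cn_profile_period.
  + split.
    * move=> m; rewrite /= !in_itv/= andbT => m0.
      by have [] := kfP m m0.
    * move=> m1 m2; rewrite !inE/= !in_itv/= !andbT => m10 m20 E.
      by have [||//] := ltgtP m1 m2; [move/(kf_incr _ _ m10 m20)|move/(kf_incr _ _ m20 m10)]; rewrite E ltxx.
    * move=> k /=; rewrite in_itv/= => k01.
      have kr : 0 < cn_ratio T k.
        have [k0 _] : 0 < k /\ k < 1 by apply/andP.
        apply: mulr_gt0; last exact: cn_mass_gt0.
        by apply: mulr_gt0; [apply: mulr_gt0 => //; exact/exprn_gt0/kappa_gt0|exact: exprn_gt0].
      (* The mass at which k solves [cn_ratio] = 2 m b; strict monotonicity of [cn_ratio] then
         identifies kf m with k. *)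
      pose m := cn_ratio T k / (2 * b).
      have m0 : 0 < m by rewrite divr_gt0// mulr_gt0.
      have rE : cn_ratio T k = 2 * m * b.
        by rewrite /m; field; rewrite gt_eqF.
      exists m; first by rewrite /= in_itv/= m0.
      have [l01 lE] := kfP m m0.
      have [/(cn_ratio_incr T_gt0 l01 k01)|/(cn_ratio_incr T_gt0 k01 l01)|//] := ltgtP (kf m) k;
        by rewrite lE rE ltxx.
  + move=> m1 m2; rewrite !in_itv/= !andbT; exact: kf_incr.
- move=> k k01 bE TE u.
  have [k0 _] : 0 < k /\ k < 1 by apply/andP.
  (* With T = 4 K and b = 2 k^2 both scalings become trivial, so the profile is cn itself. *)
  have kap1 : kappa k T = 1 by rewrite /kappa -TE divff// gt_eqF.
  have amp1 : cn_amp b T k = 1.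
    by rewrite /cn_amp kap1 expr1n mulr1 -bE divff ?sqrtr1// gt_eqF.
  have uE : cn_profile b T k = u.
    by apply/funext => x; rewrite /cn_profile /cnT amp1 kap1 !mul1r.
  have M0 := cn_mass_gt0 T_gt0 k01.
  pose m := cn_mass k T / 2.
  have m0 : 0 < m by rewrite divr_gt0.
  have rE : cn_ratio T k = 2 * m * b.
    by rewrite /cn_ratio /m kap1 bE expr1n; field.
  have mE : mass T u = m by rewrite -uE (cn_profile_mass b_gt0 k01 rE).
  rewrite mE; split; last by rewrite -uE; exact: cn_profile_unique rE.
  rewrite /m cn_massE// kap1 ellE_ellK//; field; exact: lt0r_neq0.
Qed.
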